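(* Let $k$ be a field. Fix integers $d\geq 1$, $N\geq 3$ and $2\leq r\leq N$, and let $R=k[x_1,\ldots,x_{N+1}]$ with its standard grading. Then the ideal $I=I_2(A)$ generated by the $2\times 2$ minors of the $r\times (N-r+2)$ matrix $$A=\left(\begin{array}{cccc} x_1^d & x_2^d & \ldots & x_{N-r+2}^d\\ x_2^d & x_3^d & \ldots & x_{N-r+3}^d\\ \vdots & \vdots & & \vdots\\ x_r^d & x_{r+1}^d & \ldots & x_{N+1}^d \end{array}\right)$$ (whose $(i,j)$ entry is $x_{i+j-1}^d$) has maximal multiplicity. In particular, the defining ideals of the rational normal curves of $\mathbb P^N$, for any $N\geq 3$, have maximal multiplicity.
   Context: An ideal $J$ of $R$ is called Cohen-Macaulay if $R/J$ is Cohen-Macaulay. $e(S)$ denotes the (Hilbert-Samuel) multiplicity of a standard graded $k$-algebra $S$. For a homogeneous Cohen-Macaulay ideal $J$ of height $g$, $s(R/J)=\min\{i \mid \mathrm{Tor}_g^R(R/J,k)_i\neq 0\}-g$. A homogeneous ideal $I$ of $R$ has maximal multiplicity if there exist a homogeneous Cohen-Macaulay ideal $J$ and a homogeneous element $F\notin J$ with $I=J+(F)$, $\mathrm{ht}(I)=\mathrm{ht}(J)$ and $e(R/I)=e(R/J)-\max\{1,\ s(R/J)-\deg(F)+1\}$. *)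

(* Defs.v *)
From HB Require Import structures.
From mathcomp Require Import all_boot all_order all_algebra.
From mathcomp Require Import boolp.
From mathcomp Require Export mpoly.

Set Implicit Arguments.
Unset Strict Implicit.
Unset Printing Implicit Defensive.

Import Order.TTheory GRing.Theory Num.Theory.
Local Open Scope ring_scope.

(* An ideal of a ring R is a predicate on R.  The library's [idealr_closed]    *)
(* includes properness (1 is not in the ideal).  The ring R / J is never       *)
(* formed: elements of R / J are represented by elements of R, and the ideals  *)
(* of R / J are the ideals of R containing J.                                  *)

Section CommutativeAlgebra.

Variable R : comNzRingType.
Implicit Types (I J P M : {pred R}) (s : seq R).

Definition zero_ideal : {pred R} := pred1 0.

(* J + (s_0, ..., s_(m-1)) *)
Definition ideal_adjoin J s : {pred R} :=
  [pred p | `[< exists c : nat -> R,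
                  p - \sum_(0 <= i < size s) c i * s`_i \in J >]].

Definition ideal_gen s : {pred R} := ideal_adjoin zero_ideal s.

Definition prime_ideal P : Prop := idealr_closed P /\ prime_idealr_closed P.

Definition maximal_ideal M : Prop :=
  idealr_closed M /\
  forall M', idealr_closed M' -> {subset M <= M'} -> {subset M' <= M}.

(* C 0 < C 1 < ... < C h, primes containing J (the values C i, i > h, are      *)
(* irrelevant)                                                                 *)
Definition prime_chain J (h : nat) (C : nat -> {pred R}) : Prop :=
  [/\ {subset J <= C 0%N},
      forall i, (i <= h)%N -> prime_ideal (C i)
    & forall i, (i < h)%N ->
        {subset C i <= C i.+1} /\ ~ {subset C i.+1 <= C i}].

Definition is_krull_dim J (h : nat) : Prop :=
  (exists C, prime_chain J h C) /\
  (forall h' C, prime_chain J h' C -> (h' <= h)%N).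

(* h is the height of the prime P / J of R / J *)
Definition is_prime_height J P (h : nat) : Prop :=
  (exists C, prime_chain J h C /\ C h =i P) /\
  (forall h' C, prime_chain J h' C -> C h' =i P -> (h' <= h)%N).

(* The unit ideal has no height in this sense. *)
Definition is_height I (g : nat) : Prop :=
  (exists P, [/\ prime_ideal P, {subset I <= P}
                & is_prime_height zero_ideal P g]) /\
  (forall P g', prime_ideal P -> {subset I <= P} ->
     is_prime_height zero_ideal P g' -> (g <= g')%N).

(* s is a regular sequence on R / J *)
Definition regular_seq J s : Prop :=
  (forall i p, (i < size s)%N ->
     s`_i * p \in ideal_adjoin J (take i s) -> p \in ideal_adjoin J (take i s))
  /\ 1 \notin ideal_adjoin J s.

(* n is the depth of M / J on R / J *)
Definition is_depth J M (n : nat) : Prop :=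
  (exists s, [/\ {subset s <= M}, regular_seq J s & size s = n]) /\
  (forall s, {subset s <= M} -> regular_seq J s -> (size s <= n)%N).

(* Eisenbud's definition of a Cohen-Macaulay Noetherian ring:                  *)
(* depth(M, A) = codim M for every maximal ideal M of A, with A = R / J.       *)
Definition cohen_macaulay J : Prop :=
  forall M, maximal_ideal M -> {subset J <= M} ->
  exists n, is_depth J M n /\ is_prime_height J M n.

(* Ideal of t x t minors.  All maps of indices are allowed: a non-injective    *)
(* one gives 0, a non-increasing one gives +/- a minor.                        *)
Definition minors_ideal (t m n : nat) (A : 'M[R]_(m, n)) : {pred R} :=
  ideal_gen [seq \det (mxsub fg.1 fg.2 A)
            | fg : {ffun 'I_t -> 'I_m} * {ffun 'I_t -> 'I_n}].

End CommutativeAlgebra.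

Section Graded.

Variables (k : fieldType) (n : nat).
Local Notation R := {mpoly k[n]}.
Implicit Types (I J : {pred R}) (F : R).

Definition homogeneous_ideal I : Prop :=
  idealr_closed I /\ forall p d, p \in I -> pihomog mdeg d p \in I.

(* h = dim_k (R / J)_i *)
Definition is_hilbert_value J (i h : nat) : Prop :=
  exists b : 'I_h -> R,
    (forall j, b j \is i.-homog) /\
    (forall p : R, p \is i.-homog ->
       exists! c : 'rV[k]_h, p - \sum_j c 0 j *: b j \in J).

(* Hilbert-Samuel multiplicity of S = R / J: with D = dim S, it is D! times    *)
(* the coefficient of degree D of the polynomial giving, for large i, the      *)
(* length of S / S_+^i, that is \sum_(j < i) dim_k S_j.                        *)
Definition is_multiplicity J (e : nat) : Prop :=
  exists (D : nat) (H : nat -> nat) (P : {poly rat}) (i0 : nat),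
    [/\ is_krull_dim J D,
        forall i, is_hilbert_value J i (H i),
        forall i, (i0 <= i)%N -> (\sum_(j < i) H j)%:R = P.[i%:R]
      & e%:R = (D`!)%:R * P`_D].

(* F_j = \bigoplus_(q < rk j) R(- sh j q), elements being row vectors;         *)
(* aug : F_0 -> R and dif j : F_(j+1) -> F_j act by right multiplication.      *)
Record graded_free_seq := GradedFreeSeq {
  rk : nat -> nat;
  sh : forall j, 'I_(rk j) -> nat;
  aug : 'cV[R]_(rk 0);
  dif : forall j, 'M[R]_(rk j.+1, rk j)
}.

(* p has degree i as an element of R(-a) *)
Definition twisted_homog (a i : nat) (p : R) : bool :=
  if (a <= i)%N then p \is (i - a).-homog else p == 0.

Definition is_graded_resolution J (C : graded_free_seq) : Prop :=
  [/\ (forall q, aug C q 0 \is (sh q).-homog) /\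
      (forall j p q, twisted_homog (sh q) (sh p) (dif C j p q)),
      exists u : 'rV[R]_(rk C 0), (u *m aug C) 0 0 - 1 \in J,
      forall u : 'rV[R]_(rk C 0),
        (u *m aug C) 0 0 \in J <-> exists v, u = v *m dif C 0
    & forall j (u : 'rV[R]_(rk C j.+1)),
        u *m dif C j = 0 <-> exists v, u = v *m dif C j.+1].

(* The differential of C (x)_R k, where k = R / (x_1, ..., x_n): entries are   *)
(* reduced to their constant terms.                                            *)
Definition dif_k (C : graded_free_seq) j : 'M[k]_(rk C j.+1, rk C j) :=
  map_mx (mcoeff 0%MM) (dif C j).

Definition is_cycle_k (C : graded_free_seq) (g : nat) : 'rV[k]_(rk C g) -> Prop :=
  match g with
  | 0 => fun _ => True
  | g'.+1 => fun z => z *m dif_k C g' = 0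
  end.

(* Tor_g^R(R / J, k)_i <> 0, i.e. H_g(C (x)_R k)_i <> 0 for a resolution C of  *)
(* R / J by finitely generated graded free modules                             *)
Definition Tor_k_neq0 J (g i : nat) : Prop :=
  exists2 C : graded_free_seq, is_graded_resolution J C &
  exists z : 'rV[k]_(rk C g),
    [/\ forall q, z 0 q != 0 -> sh q = i,
        is_cycle_k z
      & ~ exists w, z = w *m dif_k C g].

(* s(R / J) *)
Definition is_s_invariant J (s : int) : Prop :=
  exists g i : nat,
    [/\ is_height J g, Tor_k_neq0 J g i,
        forall i', Tor_k_neq0 J g i' -> (i <= i')%N
      & s = i%:Z - g%:Z].

Definition maximal_multiplicity I : Prop :=
  homogeneous_ideal I /\
  exists (J : {pred R}) (F : R) (f : nat),
    [/\ homogeneous_ideal J /\ cohen_macaulay J,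
        F \is f.-homog /\ F \notin J,
        I =i ideal_adjoin J [:: F],
        exists g, is_height I g /\ is_height J g
      & exists (eI eJ : nat) (s : int),
          [/\ is_multiplicity I eI, is_multiplicity J eJ, is_s_invariant J s
            & eI%:Z = eJ%:Z - Num.max 1 (s - f%:Z + 1)]].

End Graded.

(* With indices from 0 the (i, j) entry is x_(i+j)^d, and i + j <= N, so that  *)
(* [inord] does not truncate when 2 <= r <= N.                                 *)
Definition hankel_power (k : fieldType) (d N r : nat) :
    'M[{mpoly k[N.+1]}]_(r, N - r + 2) :=
  \matrix_(i < r, j < N - r + 2) 'X_(inord (i + j)) ^+ d.

(* f_0, ..., f_N is a basis of the (N+1)-dimensional space of binary forms of  *)
(* degree N, so that [s : t] |-> [f_0 : ... : f_N] parametrizes a rational     *)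
(* normal curve of P^N                                                         *)
Definition rational_normal_param (k : fieldType) (N : nat)
    (f : N.+1.-tuple {mpoly k[2]}) : Prop :=
  (forall i, tnth f i \is N.-homog) /\
  (forall c : 'I_N.+1 -> k, \sum_i c i *: tnth f i = 0 -> forall i, c i = 0).

(* Kernel of k[x_0, ..., x_N] -> k[s, t], x_i |-> f_i: since k may be finite,  *)
(* vanishing on the curve is vanishing identically in s and t.                 *)
Definition curve_ideal (k : fieldType) (N : nat)
    (f : N.+1.-tuple {mpoly k[2]}) : {pred {mpoly k[N.+1]}} :=
  [pred p | comp_mpoly f p == 0].

(* Main.v *)
Require Import Defs.
From HB Require Import structures.
From mathcomp Require Import all_boot all_order all_algebra.
From mathcomp Require Import boolp ring zify ssrcomplements.
From mathcomp Require classical_sets.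

(** Write [y_i = x_i ^ d], let [P] be the ideal of the interior variables
    [x_1, ..., x_(N-1)] (indices from 0), let [F = y_0 y_N - y_1 y_(N-1)] and take
    [J = I /\ P].  Modulo [P] every element of [I] is a multiple of [F], so
    [I = J + (F)] and [I / J] is [R / P] shifted by [deg F].

    The quotient [R / I] is free over [A = k[x_0, x_N]] on standard monomials,
    hence [R / J] is free on these together with [F].  Freeness over [A] with a
    homogeneous basis of rank [e] gives everything else.  The ring is
    Cohen-Macaulay of dimension 2: a maximal ideal contains nonzero [p(x_0)] and
    [q(x_N)], and growth of Hilbert functions bounds chains of primes.  The
    multiplicity is [e], so [e(R/J) = e(R/I) + 1].  Finally the Koszul complex of
    the commuting operators [x_i - T_i] on [R^e], where [T_i] is multiplication by
    [x_i] on [R / J] in the basis, resolves [R / J] in length [N - 1]; since [P]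
    kills [F] in [R / J], the basis vector [F] survives in [Tor_(N-1)], in degree
    [deg F + N - 1].  Thus [s(R/J) <= deg F], and the maximum in the definition is 1.

    For a rational normal curve the same argument runs with [d = 1] in the linear
    coordinates in which the parametrization is monomial. *)

Set Implicit Arguments.
Unset Strict Implicit.
Unset Printing Implicit Defensive.

Import Order.TTheory GRing.Theory Num.Theory.
Local Open Scope ring_scope.

(** * Ideals and chains of primes *)

(** Dimensions are found by counting. If a prime [Q] lies strictly inside an ideal [Q'], the powers
    of an element of [Q'] outside [Q] are independent modulo [Q], so each step of a chain of primes
    raises the exponent of growth by one; a spanning family of polynomial size bounds that exponent.
    Conversely, chains are built downwards: below a prime containing [L] there is a prime over [L]
    that misses a given non-zero-divisor modulo [L].

    Height is harder than dimension, since every prime over J needs a chain of length n - 2 below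
    it. Replacing the interior coordinates one at a time by their multiplication matrices supplies a
    ladder of ideals for this. The resolution built from the operators l_j - T_j need not be
    minimal, so a Tor class is exhibited by following one cycle through iterated mapping cones
    instead of being read off from Betti numbers. One class suffices because s(R/J) is a minimum of
    degrees and only an upper bound for it is wanted. *)

Section Ideals.
Variable R : comNzRingType.
Implicit Types (L Q M : {pred R}) (x y : R).

(* Unlike [idealr_closed], this includes the unit ideal. *)
Definition is_ideal L : Prop :=
  0 \in L /\ forall a, {in L &, forall u v, a * u + v \in L}.

Lemma idealr_is_ideal L : idealr_closed L -> is_ideal L.
Proof. by case. Qed.

Section Closure.
Variables (L : {pred R}) (idL : is_ideal L).

Lemma ideal0 : 0 \in L. Proof. by case: idL. Qed.

Lemma idealD : {in L &, forall u v, u + v \in L}.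
Proof. by move=> u v Lu Lv; rewrite -[u]mul1r; case: idL => _ h; exact: h. Qed.

Lemma idealM a u : u \in L -> a * u \in L.
Proof. by rewrite -[a * u]addr0; case: idL => L0 h Lu; exact: h. Qed.

Lemma idealMr a u : u \in L -> u * a \in L.
Proof. by rewrite mulrC; exact: idealM. Qed.

Lemma idealN u : u \in L -> - u \in L.
Proof. by rewrite -mulN1r; exact: idealM. Qed.

Lemma idealB : {in L &, forall u v, u - v \in L}.
Proof. by move=> u v Lu Lv; apply: idealD => //; apply: idealN. Qed.

Lemma idealDr u v : u \in L -> (u + v \in L) = (v \in L).
Proof.
move=> Lu; apply/idP/idP => [Luv|]; last exact: idealD.
by rewrite -(addKr u v) addrC; apply: idealB.
Qed.

Lemma idealBr u v : u - v \in L -> (u \in L) = (v \in L).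
Proof. by move=> Luv; rewrite -[u](subrK v) idealDr. Qed.

Lemma ideal_sum (I : Type) (r : seq I) (P : pred I) (E : I -> R) :
  (forall i, P i -> E i \in L) -> \sum_(i <- r | P i) E i \in L.
Proof. by move=> EL; elim/big_ind: _ => //; [exact: ideal0 | exact: idealD]. Qed.

End Closure.

Lemma prime_mul Q u v : prime_ideal Q -> u * v \in Q -> u \notin Q -> v \in Q.
Proof. by case=> _ pQ /pQ /orP [-> | ]. Qed.

Lemma prime_exp Q u n : prime_ideal Q -> u ^+ n \in Q -> u \in Q.
Proof.
move=> pQ; elim: n => [|n IH].
  by case: pQ => [[_ Q1 _] _]; rewrite expr0 (negPf Q1).
by rewrite exprS; case: pQ => _ pQ /pQ /orP [].
Qed.

Lemma prime_is_ideal Q : prime_ideal Q -> is_ideal Q.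
Proof. by case=> /idealr_is_ideal. Qed.

Definition ideal_add1 L u : {pred R} :=
  [pred x | `[< exists2 q, q \in L & exists r, x = r * u + q >]].

Lemma ideal_add1P L u x :
  reflect (exists2 q, q \in L & exists r, x = r * u + q) (x \in ideal_add1 L u).
Proof. exact: asboolP. Qed.

Lemma ideal_add1_sub L u : {subset L <= ideal_add1 L u}.
Proof. by move=> x Lx; apply/ideal_add1P; exists x => //; exists 0; rewrite mul0r add0r. Qed.

Lemma ideal_add1_is_ideal L u : is_ideal L -> is_ideal (ideal_add1 L u).
Proof.
move=> idL; split; first exact/ideal_add1_sub/ideal0.
move=> a x y /ideal_add1P [q Lq [r ->]] /ideal_add1P [q' Lq' [r' ->]].
apply/ideal_add1P; exists (a * q + q'); first by apply: idealD => //; apply: idealM.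
by exists (a * r + r'); rewrite mulrDr mulrDl mulrA addrACA.
Qed.

Lemma ideal_add1_mem L u : is_ideal L -> u \in ideal_add1 L u.
Proof. by move=> idL; apply/ideal_add1P; exists 0; [exact: ideal0|exists 1; rewrite mul1r addr0]. Qed.

(** An ideal over [L] that is maximal among those disjoint from the multiplicative set [S] is prime;
    Zorn's lemma provides it. *)
Lemma prime_avoiding L (S : R -> Prop) :
    is_ideal L -> S 1 -> (forall x y, S x -> S y -> S (x * y)) ->
    (forall x, S x -> x \notin L) ->
  exists Q, [/\ prime_ideal Q, {subset L <= Q} & forall x, S x -> x \notin Q].
Proof.
move=> idL S1 SM SL.
(* Zorn's lemma runs over sets [X] whose union with [L] is an ideal missing [S], so that the empty
   chain is bounded by [L] itself. *)
pose U (X : R -> Prop) : {pred R} := [pred x | (x \in L) || `[< X x >]].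
have UP X x : x \in U X -> x \in L \/ X x by case/orP => [|/asboolP]; [left|right].
have US X Y : (forall x, X x -> Y x) -> {subset U X <= U Y}.
  by move=> XY x /UP [Lx|Xx]; apply/orP; [left | right; apply/asboolP/XY].
pose P (X : R -> Prop) := is_ideal (U X) /\ forall x, S x -> x \notin U X.
have P0 : P (fun=> False).
  have U0 : U (fun=> False) =i L by move=> x; apply/idP/idP => [/UP [] //|Lx]; apply/orP; left.
  split=> [|x /SL]; last by rewrite U0.
  split=> [|a x y]; rewrite !U0; [exact: ideal0|move=> Lx Ly].
  by apply: idealD => //; apply: idealM.
have [A [[idA SA] maxA]] : exists A, P A /\ forall B, classical_sets.proper A B -> ~ P B.
  apply: classical_sets.Zorn_bigcup => F FP Ftot.
  set V := classical_sets.bigcup _ _.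
  have sub X : F X -> {subset U X <= U V} by move=> FX; apply: US => x Xx; exists X.
  have key x y : x \in U V -> y \in U V ->
      exists X, [/\ P X, {subset U X <= U V}, x \in U X & y \in U X].
    have cov z : z \in U V -> z \in L \/ exists2 X, F X & z \in U X.
      by case/UP => [|[X FX Xz]]; [left|right; exists X => //; apply/orP; right; apply/asboolP].
    have inL X z : z \in L -> z \in U X by move=> Lz; apply/orP; left.
    case/cov => [Lx|[X FX Xx]] /cov [Ly|[Y FY Yy]].
    - by exists (fun=> False); split; [|apply: US|apply: inL|apply: inL].
    - by exists Y; split; [exact: FP|exact: sub|exact: inL|].
    - by exists X; split; [exact: FP|exact: sub| |exact: inL].
    - case: (Ftot _ _ FX FY) => XY.
        by exists Y; split; [exact: FP|exact: sub|exact: US Xx|].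
      by exists X; split; [exact: FP|exact: sub| |exact: US Yy].
  split; first split.
  - by apply/orP; left; apply: ideal0.
  - move=> a x y xV yV; have [X [[[_ idX] _] sXV xX yX]] := key _ _ xV yV.
    exact/sXV/idX.
  - move=> x Sx; apply/negP => xV; have [X [[_ dX] _ xX _]] := key _ _ xV xV.
    by move: (dX _ Sx); rewrite xX.
exists (U A); split=> //; last by move=> x Lx; apply/orP; left.
have meet u : u \notin U A -> exists2 s, S s & exists2 q, q \in U A & exists r, s = r * u + q.
  move=> uA; apply: contrapT => H.
  pose B x := x \in ideal_add1 (U A) u.
  have UB : U B =i ideal_add1 (U A) u.
    move=> x; apply/idP/idP => [/UP [Lx|//]|Bx]; last by apply/orP; right; apply/asboolP.
    by apply: ideal_add1_sub; apply/orP; left.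
  apply: (maxA B).
    split=> [x Ax|BA].
      by apply: ideal_add1_sub; apply/orP; right; apply/asboolP.
    by move/negP: uA; apply; apply/orP; right; apply/asboolP/BA/ideal_add1_mem.
  have [B0 BL] := ideal_add1_is_ideal u idA.
  split; first by split=> [|a x y]; rewrite !UB; [|exact: BL].
  move=> x Sx; rewrite UB; apply/negP => /ideal_add1P [q Aq [r xE]].
  by apply: H; exists x => //; exists q => //; exists r.
split; first by split; [exact: ideal0|exact: SA|case: idA].
move=> u v uv; apply/orP; apply: contrapT => /not_orP [/negP uA /negP vA].
have [s Ss [q Aq [r sE]]] := meet _ uA; have [s' Ss' [q' Aq' [r' s'E]]] := meet _ vA.
move/negP: (SA _ (SM _ _ Ss Ss')); apply.
have -> : s * s' = (r * r') * (u * v) + ((r * u) * q' + s' * q).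
  by rewrite sE s'E; ring.
by do 2?[apply: idealD => //]; exact: idealM.
Qed.

Definition nzd L f : Prop := forall p, f * p \in L -> p \in L.

(** Avoid the products [f ^+ n * t] with [t] outside [Q]: they miss [L] because [f] cancels modulo
    [L] and [L] lies in [Q]. The products with n = 0 force the new prime into [Q], and the one with
    n = 1, t = 1 keeps [f] out of it. *)
Lemma prime_below L Q f : is_ideal L -> prime_ideal Q -> {subset L <= Q} ->
  nzd L f -> exists Q', [/\ prime_ideal Q', {subset L <= Q'}, {subset Q' <= Q} & f \notin Q'].
Proof.
move=> idL pQ LQ nzf.
have Q1 : 1 \notin Q by case: pQ => [[]].
pose S x := exists n t, t \notin Q /\ x = f ^+ n * t.
have [|||Q' [pQ' LQ' SQ']] := @prime_avoiding L S idL.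
- by exists 0%N, 1; rewrite mul1r.
- move=> x y [n [t [Qt ->]]] [n' [t' [Qt' ->]]]; exists (n + n')%N, (t * t').
  split; last by rewrite exprD mulrACA.
  by apply/negP => Qtt; move/negP: Qt'; apply; apply: prime_mul Qtt Qt.
- move=> _ [n [t [/negP Qt ->]]]; apply/negP; elim: n => [|n IH].
    by rewrite mul1r => /LQ.
  by rewrite exprS -mulrA => /nzf.
exists Q'; split=> // [x Q'x|].
  by apply: contraT => Qx; move: Q'x; rewrite (negPf (SQ' _ _)) //; exists 0%N, x; rewrite mul1r.
by apply: SQ'; exists 1%N, 1; rewrite expr1 mulr1.
Qed.

(** The chain grows downwards from [Q]: [f h] lies in [L h.+1], hence in [Q], but not in the prime
    found below [Q], which makes the inclusion strict. *)
Lemma prime_chain_of_nzd (L : nat -> {pred R}) (f : nat -> R) h Q :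
    (forall i, (i <= h)%N -> is_ideal (L i)) ->
    (forall i, (i < h)%N -> {subset L i <= L i.+1}) ->
    (forall i, (i < h)%N -> f i \in L i.+1 /\ nzd (L i) (f i)) ->
    prime_ideal Q -> {subset L h <= Q} ->
  exists C, prime_chain (L 0%N) h C /\ C h = Q.
Proof.
elim: h Q => [|h IH] Q idL sL fL pQ LQ.
  by exists (fun=> Q); split=> //; split.
have [fh nzf] := fL h (ltnSn h).
have [Q' [pQ' LQ' Q'Q fQ']] : exists Q', [/\ prime_ideal Q', {subset L h <= Q'},
    {subset Q' <= Q} & f h \notin Q'].
  by apply: prime_below => //; [exact: idL|move=> x /sL; move/(_ (ltnSn h))/LQ].
have [|||C [[LC pC sC] CQ]] := IH Q' _ _ _ pQ' LQ'.
- by move=> i ih; apply/idL/leqW.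
- by move=> i ih; apply/sL/leqW.
- by move=> i ih; apply/fL/leqW.
exists (fun i => if (i <= h)%N then C i else Q); rewrite ltnn; split=> //.
split=> [//|i|i]; rewrite ?leq0n //.
  by rewrite leq_eqVlt => /orP [/eqP ->|]; rewrite ?ltnn // => ih; rewrite -ltnS ih; apply: pC.
rewrite ltnS => ilt; rewrite ilt; move: ilt; rewrite leq_eqVlt => /orP [/eqP ->|ih]; last first.
  by rewrite ih; apply: sC.
rewrite ltnn CQ; split=> // QQ'.
by move: fQ'; rewrite QQ' //; apply: LQ.
Qed.

Lemma ideal_adjoin_is_ideal L s : is_ideal L -> is_ideal (ideal_adjoin L s).
Proof.
move=> idL; split.
  apply/asboolP; exists (fun=> 0); rewrite big1 ?subr0; first exact: ideal0.
  by move=> i _; rewrite mul0r.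
move=> a x y /asboolP [c cL] /asboolP [c' c'L]; apply/asboolP.
exists (fun i => a * c i + c' i).
have -> : a * x + y - \sum_(0 <= i < size s) (a * c i + c' i) * s`_i =
    a * (x - \sum_(0 <= i < size s) c i * s`_i) + (y - \sum_(0 <= i < size s) c' i * s`_i).
  rewrite (eq_bigr (fun i => a * (c i * s`_i) + c' i * s`_i)); last first.
    by move=> i _; rewrite mulrDl mulrA.
  by rewrite big_split /= -mulr_sumr; ring.
by case: idL => _; apply.
Qed.

Lemma ideal_adjoin_sub L s : {subset L <= ideal_adjoin L s}.
Proof.
move=> x Lx; apply/asboolP; exists (fun=> 0); rewrite big1 ?subr0 // => i _.
by rewrite mul0r.
Qed.

Lemma ideal_adjoin_mem L s x : is_ideal L -> x \in s -> x \in ideal_adjoin L s.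
Proof.
move=> idL xs; apply/asboolP; exists (fun i => (i == index x s)%:R).
rewrite (bigD1_seq (index x s)) /=; first last.
- exact: iota_uniq.
- by rewrite mem_index_iota /= index_mem.
rewrite eqxx mul1r nth_index // big1 ?addr0 ?subrr; first exact: ideal0.
by move=> i /negPf ->; rewrite mul0r.
Qed.

Lemma ideal_adjoin_least L L' s : is_ideal L' -> {subset L <= L'} -> {subset s <= L'} ->
  {subset ideal_adjoin L s <= L'}.
Proof.
move=> idL' LL' sL' x /asboolP [c /LL' cL]; rewrite (idealBr idL' cL) big_nat.
by apply: ideal_sum => // i /andP [_ ilt]; apply: idealM => //; apply/sL'/mem_nth.
Qed.

Lemma ideal_adjoin1P L u x :
  reflect (exists c, x - c * u \in L) (x \in ideal_adjoin L [:: u]).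
Proof.
apply: (iffP (asboolP _)) => [[c]|[c cL]]; first by rewrite big_nat1; exists (c 0%N).
by exists (fun=> c); rewrite big_nat1.
Qed.

Lemma ideal_adjoin0 L : ideal_adjoin L [::] =i L.
Proof.
move=> x; apply/asboolP/idP => [[c]|Lx]; rewrite ?big_nil ?subr0 //.
by exists (fun=> 0); rewrite big_nil subr0.
Qed.

Lemma prime_chain_of_regular_seq J s Q : is_ideal J -> regular_seq J s ->
    prime_ideal Q -> {subset J <= Q} -> {subset s <= Q} ->
  exists C, prime_chain J (size s) C /\ C (size s) = Q.
Proof.
move=> idJ [regs _] pQ JQ sQ.
have [||||C [[JC pC sC] CQ]] := @prime_chain_of_nzd (fun i => ideal_adjoin J (take i s))
    (nth 0 s) (size s) Q _ _ _ pQ.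
- by move=> i _; apply: ideal_adjoin_is_ideal.
- move=> i ilt; apply: ideal_adjoin_least; first exact: ideal_adjoin_is_ideal.
    exact: ideal_adjoin_sub.
  move=> x xs; apply: ideal_adjoin_mem => //.
  by rewrite (take_nth 0) // mem_rcons inE xs orbT.
- move=> i ilt; split=> [|p]; last exact: regs.
  by apply: ideal_adjoin_mem => //; rewrite (take_nth 0) // mem_rcons mem_head.
- rewrite take_size; apply: ideal_adjoin_least => //; exact: prime_is_ideal.
by exists C; split=> //; split=> // x Jx; apply/JC/ideal_adjoin_sub.
Qed.

Lemma maximal_inv M u : maximal_ideal M -> u \notin M -> exists w, w * u - 1 \in M.
Proof.
case=> [[M0 M1 idM] maxM] uM; have idM' : is_ideal M by [].
apply: contrapT => H; move/negP: uM; apply.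
apply: (maxM (ideal_add1 M u)); last exact: ideal_add1_mem.
  have [? ?] := ideal_add1_is_ideal u idM'; split=> //.
  apply/negP => /ideal_add1P [q qM [r rE]]; apply: H; exists r.
  by rewrite rE opprD addrA subrr add0r; apply: idealN.
exact: ideal_add1_sub.
Qed.

Lemma maximal_prime M : maximal_ideal M -> prime_ideal M.
Proof.
move=> maxM; have [idM _] := maxM; split=> // u v uv.
apply/orP; case: (boolP (u \in M)) => [|uM]; [by left | right].
have [w wM] := maximal_inv maxM uM; have idM' := idealr_is_ideal idM.
have -> : v = w * (u * v) - v * (w * u - 1) by ring.
by apply: idealB => //; apply: idealM.
Qed.

End Ideals.

(** * Growth of quotients *)

Section Growth.
Variables (k : fieldType) (n : nat).
Local Notation R := {mpoly k[n]}.
Implicit Types (J Q : {pred R}) (I S : finType) (f p : R).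

Lemma idealZ J (c : k) p : is_ideal J -> p \in J -> c *: p \in J.
Proof. by move=> idJ; rewrite -mul_mpolyC; exact: idealM. Qed.

Lemma msizeM_add p f : (msize (p * f) <= msize p + msize f)%N.
Proof.
have [->|p0] := eqVneq p 0; first by rewrite mul0r msize0.
have [->|f0] := eqVneq f 0; first by rewrite mulr0 msize0.
by rewrite msizeM // leq_pred.
Qed.

Lemma msizeX_le f j : (msize (f ^+ j) <= (j * msize f).+1)%N.
Proof.
elim: j => [|j IH]; first by rewrite expr0 msize1.
rewrite exprS (leq_trans (msizeM_add _ _)) // mulSn -addnS.
by rewrite leq_add2l.
Qed.

Definition indep J I (b : I -> R) : Prop :=
  forall c : I -> k, \sum_i c i *: b i \in J -> forall i, c i = 0.

(** A lower bound [D] for the dimension of R / J. Degrees are bounded through [msize], without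
    homogeneity, because the primes of a chain are arbitrary. *)
Definition grows J (D : nat) : Prop :=
  exists c, forall T, exists (I : finType) (b : I -> R),
    [/\ #|I| = (T.+1 ^ D)%N, forall i, (msize (b i) <= c * T.+1)%N & indep J b].

Definition spanned_polynomially J (E : nat) : Prop :=
  exists m c, forall M, exists (S : finType) (w : S -> R),
    (#|S| <= m * (c + M.+1) ^ E)%N /\
    forall p, (msize p <= M)%N -> exists c' : S -> k, p - \sum_s c' s *: w s \in J.

Lemma grows_sub J Q D : {subset J <= Q} -> grows Q D -> grows J D.
Proof.
move=> JQ [c cP]; exists c => T; have [I [b [cardI szb indb]]] := cP T.
by exists I, b; split=> // c' c'J; apply/indb/JQ.
Qed.

Lemma grows0 Q : is_ideal Q -> 1 \notin Q -> grows Q 0.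
Proof.
move=> idQ Q1; exists 1%N => T; exists unit, (fun=> 1); split=> [|_|c].
- by rewrite card_unit expn0.
- by rewrite msize1 mul1n.
- rewrite (bigD1 tt) //= big1 ?addr0; last by case.
  move=> cQ [] ; apply/eqP; apply: contraNT Q1 => c0.
  by rewrite -[1](scalerK c0) -[c tt *: _]mul1r mul1r; apply: idealZ.
Qed.

(* Powers of an element of Q' outside Q are independent modulo Q over any family
   that is independent modulo Q'. *)
Lemma grows_step Q Q' D : prime_ideal Q -> is_ideal Q' -> {subset Q <= Q'} ->
  ~ {subset Q' <= Q} -> grows Q' D -> grows Q D.+1.
Proof.
move=> pQ idQ' QQ' nQ'Q [c cP]; have idQ := prime_is_ideal pQ.
have [f Q'f Qf] : exists2 f, f \in Q' & f \notin Q.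
  apply: contrapT => H; apply: nQ'Q => x Q'x; apply: contraT => Qx.
  by case: H; exists x.
exists (msize f + c).+1 => T; have [I [b [cardI szb indb]]] := cP T.
exists ('I_T.+1 * I)%type, (fun x : 'I_T.+1 * I => f ^+ x.1 * b x.2); split.
- by rewrite card_prod card_ord cardI expnS.
- case=> j i /=; rewrite (leq_trans (msizeM_add _ _)) //.
  have := msizeX_le f j; have := szb i; have := ltn_ord j; nia.
- move=> e eQ.
  suff H T' (g : nat -> I -> k) :
      \sum_(j < T') f ^+ j * (\sum_i g j i *: b i) \in Q ->
      forall j : 'I_T', forall i, g j i = 0.
    case=> j i; pose g j i := e (inord j, i).
    have := H T.+1 g _ j i; rewrite /g inord_val; apply.
    rewrite (_ : \sum_(_ < _) _ = \sum_i e i *: (f ^+ i.1 * b i.2)) //.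
    rewrite [RHS](eq_bigr (fun x => e (x.1, x.2) *: (f ^+ x.1 * b x.2))); last by case.
    rewrite -(pair_bigA _ (fun (j : 'I_T.+1) i => e (j, i) *: (f ^+ j * b i))) /=.
    apply: eq_bigr => x _; rewrite mulr_sumr; apply: eq_bigr => y _.
    by rewrite inord_val scalerAr.
  elim: T' g => [|T' IH] g gQ; first by case.
  move: gQ; rewrite big_ord_recl expr0 mul1r.
  set z := \sum_(_ < T') _.
  have zE : z = f * \sum_(j < T') f ^+ j * (\sum_i g j.+1 i *: b i).
    by rewrite mulr_sumr; apply: eq_bigr => j _; rewrite mulrA -exprS.
  (* All terms but the one of exponent 0 are multiples of [f], hence in [Q']; so that one is in [Q']
     too and its coefficients vanish. Afterwards [f] is cancelled modulo the prime [Q]. *)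
  move=> gQ; have g0 : forall i, g 0%N i = 0.
    apply: indb; move: (QQ' _ gQ); rewrite addrC idealDr // zE.
    exact: idealMr.
  move: gQ; rewrite big1 => [|i _]; last by rewrite g0 scale0r.
  rewrite add0r zE => gQ; have gS := IH (fun j => g j.+1) (prime_mul pQ gQ Qf).
  move=> j i.
  by case: (unliftP 0 j) => [j'|] ->; [exact: gS | exact: g0].
Qed.

Lemma prime_chain_grows J h C D :
  prime_chain J h C -> grows (C h) D -> grows J (D + h)%N.
Proof.
elim: h D => [|h IH] D [JC pC sC] gC; first by rewrite addn0; apply: grows_sub gC.
rewrite addnS -addSn; apply: IH.
  by split=> // i ih; [apply: pC | apply: sC]; apply: leqW.
have [sub nsub] := sC h (ltnSn h).
apply: grows_step gC => //; first exact: pC.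
exact/prime_is_ideal/pC.
Qed.

Lemma indep_leq_card J I S (b : I -> R) (w : S -> R) :
  is_ideal J -> indep J b ->
  (forall i, exists c : S -> k, b i - \sum_s c s *: w s \in J) -> (#|I| <= #|S|)%N.
Proof.
move=> idJ indb /choice [c cP]; rewrite leqNgt; apply/negP => ltSI.
pose M : 'M[k]_(#|I|, #|S|) := \matrix_(i, s) c (enum_val i) (enum_val s).
have : kermx M != 0.
  by rewrite kermx_eq0 -row_leq_rank -ltnNge (leq_ltn_trans (rank_leq_col M)).
case/rowV0Pn => u /sub_kermxP uM u0.
have : \sum_i u 0 (enum_rank i) *: b i \in J.
  have -> : \sum_i u 0 (enum_rank i) *: b i =
      \sum_i u 0 (enum_rank i) *: (b i - \sum_s c i s *: w s).
    under [RHS]eq_bigr do rewrite scalerBr.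
    rewrite big_split /= sumrN -[LHS]subr0; congr (_ - _).
    under [RHS]eq_bigr do rewrite scaler_sumr.
    rewrite exchange_big big1 //= => s _.
    under eq_bigr do rewrite scalerA.
    rewrite -scaler_suml; move/matrixP/(_ 0 (enum_rank s)): uM; rewrite !mxE.
    rewrite (reindex (@enum_rank I)) /=; last first.
      by exists enum_val => x _; rewrite (enum_rankK, enum_valK).
    under eq_bigr do rewrite mxE !enum_rankK.
    by move=> ->; rewrite scale0r.
  by apply: ideal_sum => // i _; apply: idealZ.
move/indb => u00; case/eqP: u0; apply/rowP => i.
by rewrite mxE -(enum_valK i) u00.
Qed.

Lemma grows_leq J D E : is_ideal J -> grows J D -> spanned_polynomially J E -> (D <= E)%N.
Proof.
move=> idJ [c cP] [m [c' mP]]; rewrite leqNgt; apply/negP => ltED.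
(* Chosen so that the spanning family has at most T * (T + 1)^E elements, fewer than (T + 1)^(E +
   1). *)
pose T := (m * (c + c').+1 ^ E)%N.
have [I [b [cardI szb indb]]] := cP T.
have [S [w [cardS spanS]]] := mP (c * T.+1)%N.
have : (#|I| <= #|S|)%N by apply: indep_leq_card indb _ => // i; apply: spanS.
rewrite cardI leqNgt => /negP; apply; rewrite (leq_ltn_trans cardS) //.
apply: (@leq_trans (T.+1 ^ E.+1)); last by rewrite leq_pexp2l.
rewrite expnS; apply: (@leq_ltn_trans (T * T.+1 ^ E)); last first.
  by rewrite ltn_pmul2r ?expn_gt0.
rewrite /T -mulnA leq_mul // -expnMn; case: (E) => [//|E'].
rewrite leq_exp2r //; nia.
Qed.
End Growth.

(** * Quotients free over k[a, b] *)

Lemma pihomog_sum (S : nzRingType) n d I (r : seq I) P (E : I -> {mpoly S[n]}) :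
  pihomog mdeg d (\sum_(i <- r | P i) E i) = \sum_(i <- r | P i) pihomog mdeg d (E i).
Proof. exact: raddf_sum. Qed.

Lemma pihomogZ (S : nzRingType) n d x (p : {mpoly S[n]}) :
  pihomog mdeg d (x *: p) = x *: pihomog mdeg d p.
Proof. exact: linearZ. Qed.

Lemma poly_sumE (S : nzSemiRingType) (p : {poly S}) B :
  (size p <= B)%N -> p = \sum_(i < B) p`_i *: 'X^i.
Proof.
move=> szp; rewrite -poly_def; apply/polyP => i; rewrite coef_poly.
by case: ltnP => // Bi; rewrite nth_default // (leq_trans szp).
Qed.

Section Bivariate.
Variables (k : fieldType) (n : nat) (a b : {mpoly k[n]}).
Local Notation R := {mpoly k[n]}.
Local Notation A := {poly {poly k}}.
Hypotheses (ha : a \is 1.-homog) (hb : b \is 1.-homog).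

(* c(a, b), the inner variable of [{poly {poly k}}] being sent to [a], the outer one to [b]. *)
Definition biv : A -> R := horner_eval b \o map_poly (horner_alg a).
HB.instance Definition _ := GRing.RMorphism.copy biv (horner_eval b \o map_poly (horner_alg a)).

Arguments biv : simpl never.

Lemma biv_poly (c : {poly k}) : biv c%:P = horner_alg a c.
Proof. by rewrite /biv /= /horner_eval map_polyC hornerC. Qed.

Lemma bivC (x : k) : biv x%:P%:P = x%:MP.
Proof. by rewrite biv_poly horner_algC /= alg_mpolyC. Qed.

Lemma bivX : biv 'X = b.
Proof. by rewrite /biv /= /horner_eval map_polyX hornerX. Qed.

Lemma bivXC : biv 'X%:P = a.
Proof. by rewrite biv_poly horner_algX. Qed.

Lemma bivM : {morph biv : c d / c * d}. Proof. exact: rmorphM. Qed.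
Lemma bivD : {morph biv : c d / c + d}. Proof. exact: rmorphD. Qed.
Lemma bivB : {morph biv : c d / c - d}. Proof. exact: rmorphB. Qed.
Lemma biv0 : biv 0 = 0. Proof. exact: rmorph0. Qed.
Lemma bivXn c t : biv (c ^+ t) = biv c ^+ t. Proof. exact: rmorphXn. Qed.
Lemma biv_sum I (r : seq I) P (E : I -> A) :
  biv (\sum_(i <- r | P i) E i) = \sum_(i <- r | P i) biv (E i).
Proof. exact: raddf_sum. Qed.

Lemma biv_mon x s t : biv ((x *: 'X^s)%:P * 'X^t) = x *: (a ^+ s * b ^+ t).
Proof.
rewrite bivM bivXn bivX biv_poly linearZ /= rmorphXn /= horner_algX.
by rewrite -!scalerAl mul1r.
Qed.

Lemma bivE B (c : A) : (size c <= B)%N -> (forall t, (size (c`_t)%R <= B)%N) ->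
  biv c = \sum_(t < B) \sum_(s < B) c`_t`_s *: (a ^+ s * b ^+ t).
Proof.
move=> szc szct; rewrite [in LHS](poly_sumE szc) biv_sum; apply: eq_bigr => t _.
rewrite -mul_polyC [in LHS](poly_sumE (szct t)) raddf_sum /= mulr_suml biv_sum.
by apply: eq_bigr => s _; apply: biv_mon.
Qed.

Lemma poly_size_bound (c : A) d : exists B, [/\ (d < B)%N, (size c <= B)%N &
  forall t, (size (c`_t)%R <= B)%N].
Proof.
exists (maxn d.+1 (maxn (size c) (\max_(t < size c) size (c`_t)%R))); split.
- exact: leq_maxl.
- by rewrite leq_max orbC leq_maxl.
- move=> t; rewrite !leq_max; case: (ltnP t (size c)) => h.
    by rewrite (leq_bigmax (Ordinal h)) !orbT.
  by rewrite nth_default // size_poly0.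
Qed.

(** Only the terms with s + t + e = d survive. For e > d the truncated bound [d.+1 - e] is 0, and so
    is the sum. *)
Lemma pihomog_biv (v : R) e d (c : A) : v \is e.-homog ->
  pihomog mdeg d (biv c * v) =
  \sum_(s < d.+1 - e) c`_(d - e - s)`_s *: (a ^+ s * b ^+ (d - e - s) * v).
Proof.
move=> hv; have [B [dB szc szct]] := poly_size_bound c d.
have hm s t : a ^+ s * b ^+ t * v \is (s + t + e).-homog.
  apply: dhomogM hv; have := dhomogM (dhomogMn s ha) (dhomogMn t hb).
  by rewrite !mul1n.
rewrite (bivE szc szct) exchange_big mulr_suml pihomog_sum.
have le : (d.+1 - e <= B)%N by lia.
rewrite (big_ord_widen _ (fun s => c`_(d - e - s)`_s *: (a ^+ s * b ^+ (d - e - s) * v)) le).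
rewrite [RHS]big_mkcond; apply: eq_bigr => s _.
rewrite mulr_suml pihomog_sum.
have E t : (s + t + e != d)%N -> pihomog mdeg d (c`_t`_s *: (a ^+ s * b ^+ t) * v) = 0.
  by move=> st; rewrite -scalerAl pihomogZ (pihomog_ne0 st) ?scaler0.
case: ltnP => hs; last first.
  by rewrite big1 // => t _; apply: E; lia.
have tB : (d - e - s < B)%N by lia.
rewrite (bigD1 (Ordinal tB)) //= big1 ?addr0 => [|t /negP tne]; last first.
  apply: E; apply/eqP => ?; apply: tne; apply/eqP/val_inj => /=; lia.
rewrite -scalerAl pihomogZ pihomog_dE //.
by have := hm s (d - e - s)%N; have -> : (s + (d - e - s) + e = d)%N by lia.
Qed.

(** As the coefficients range over the abstract ring [A], the last clause also makes [a] and [b]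
    algebraically independent modulo [J] when m > 0. *)
Definition free_over (J : {pred R}) m (v : 'I_m -> R) (dv : 'I_m -> nat) : Prop :=
  [/\ forall q, v q \is (dv q).-homog,
      forall p, exists c : 'I_m -> A, p - \sum_q biv (c q) * v q \in J
    & forall c : 'I_m -> A, \sum_q biv (c q) * v q \in J -> forall q, c q = 0].

Section Free.
Variables (J : {pred R}) (m : nat) (v : 'I_m -> R) (dv : 'I_m -> nat).
Hypotheses (homJ : homogeneous_ideal J) (freeJ : free_over J v dv).

Let idJ : is_ideal J. Proof. exact/idealr_is_ideal/(proj1 homJ). Qed.
Let J1 : 1 \notin J. Proof. by case: homJ => [[]]. Qed.

Definition hbasis d q s := a ^+ s * b ^+ (d - dv q - s) * v q.

Lemma hbasis_homog d q s : (s < d.+1 - dv q)%N -> hbasis d q s \is d.-homog.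
Proof.
move=> hs; case: freeJ => hv _ _.
have := dhomogM (dhomogM (dhomogMn s ha) (dhomogMn (d - dv q - s) hb)) (hv q).
by rewrite !mul1n; have -> : (s + (d - dv q - s) + dv q = d)%N by lia.
Qed.

Lemma hbasis_span d p : p \is d.-homog -> exists e : 'I_m -> nat -> k,
  p - \sum_q \sum_(s < d.+1 - dv q) e q s *: hbasis d q s \in J.
Proof.
move=> hp; case: freeJ => hv spanJ _; have [c cJ] := spanJ p.
exists (fun q s => (c q)`_(d - dv q - s)`_s).
have := proj2 homJ _ d cJ; rewrite pihomogB (pihomog_dE hp) pihomog_sum.
by under eq_bigr do rewrite (pihomog_biv _ _ (hv _)).
Qed.

Lemma hbasis_free d (e : 'I_m -> nat -> k) :
  \sum_q \sum_(s < d.+1 - dv q) e q s *: hbasis d q s \in J ->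
  forall q s, (s < d.+1 - dv q)%N -> e q s = 0.
Proof.
case: freeJ => _ _ indJ eJ.
pose c q : A := \sum_(s < d.+1 - dv q) (e q s *: 'X^s)%:P * 'X^(d - dv q - s).
have c0 : forall q, c q = 0.
  apply: indJ; congr (_ \in J): eJ; apply: eq_bigr => q _.
  rewrite biv_sum mulr_suml; apply: eq_bigr => s _.
  by rewrite biv_mon -scalerAl.
move=> q s hs; have := congr1 (fun p : A => p`_(d - dv q - s)`_s) (c0 q).
rewrite !coef0 coef_sum coef_sum (bigD1 (Ordinal hs)) //= big1 => [|t /negP tne].
  by rewrite coefCM coefXn eqxx mulr1 coefZ coefXn eqxx mulr1 addr0.
rewrite coefCM coefXn; case: eqP => [E|_]; last by rewrite mulr0 coef0.
by case: tne; apply/eqP/val_inj => /=; have := ltn_ord t; lia.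
Qed.

(** Up to degree M the elements [hbasis d q s] fit into m * (M + 1)^2 triples of indices; those with
    [s] out of range are sent to 0. *)
Lemma free_spanned : spanned_polynomially J 2.
Proof.
exists m, 0%N => M; exists ('I_m * 'I_M.+1 * 'I_M.+1)%type.
exists (fun x : 'I_m * 'I_M.+1 * 'I_M.+1 =>
          if (x.1.2 < x.2.+1 - dv x.1.1)%N then hbasis x.2 x.1.1 x.1.2 else 0); split.
  by rewrite !card_prod !card_ord; lia.
move=> p szp.
have hE d : exists e : 'I_m -> nat -> k,
    pihomog mdeg d p - \sum_q \sum_(s < d.+1 - dv q) e q s *: hbasis d q s \in J.
  exact/hbasis_span/pihomogP.
case/choice: hE => e eJ; exists (fun x : 'I_m * 'I_M.+1 * 'I_M.+1 => e x.2 x.1.1 x.1.2).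
have -> : \sum_(x : 'I_m * 'I_M.+1 * 'I_M.+1) e x.2 x.1.1 x.1.2 *:
      (if (x.1.2 < x.2.+1 - dv x.1.1)%N then hbasis x.2 x.1.1 x.1.2 else 0) =
    \sum_(d < M.+1) \sum_q \sum_(s < d.+1 - dv q) e d q s *: hbasis d q s.
  rewrite -(pair_bigA _ (fun (y : 'I_m * 'I_M.+1) (d : 'I_M.+1) => e d y.1 y.2 *:
      (if (y.2 < d.+1 - dv y.1)%N then hbasis d y.1 y.2 else 0))) exchange_big /=.
  apply: eq_bigr => d _.
  rewrite -(pair_bigA _ (fun q (s : 'I_M.+1) => e d q s *:
      (if (s < d.+1 - dv q)%N then hbasis d q s else 0))) /=.
  apply: eq_bigr => q _; have le : (d.+1 - dv q <= M.+1)%N by have := ltn_ord d; lia.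
  rewrite (big_ord_widen _ (fun s => e d q s *: hbasis d q s) le) [RHS]big_mkcond.
  by apply: eq_bigr => s _; case: ifP; rewrite ?scaler0.
rewrite [X in X - _](@pihomog_partitionE _ _ mdeg M.+1); last exact: leqW.
rewrite -sumrB; apply: ideal_sum => // d _; exact: eJ.
Qed.

(** The top prime of a chain has growth at least 0, so a chain of length h forces growth h modulo
    [J]. *)
Lemma free_chain_leq2 h C : prime_chain J h C -> (h <= 2)%N.
Proof.
move=> chC; have [_ pC _] := chC; have pCh := pC h (leqnn h).
apply: grows_leq free_spanned => //; rewrite -[h]add0n.
apply: prime_chain_grows chC (grows0 (prime_is_ideal pCh) _).
by case: pCh => [[]].
Qed.

End Free.
End Bivariate.

(** * Maximal ideals contain univariate polynomials *)

Arguments biv {k n} a b _ : simpl never.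

(** As a polynomial in [x] the determinant takes the value [\det X] at 0, so the difference is
    divisible by [x]. *)
Lemma det_add_scale (B : comNzRingType) m (X Y : 'M[B]_m) x :
  exists w, \det (X + x *: Y) = \det X + x * w.
Proof.
pose q := \det (map_mx polyC X + 'X *: map_mx polyC Y) : {poly B}.
have qE y : q.[y] = \det (X + y *: Y).
  rewrite -[LHS]/(horner_eval y q) -det_map_mx; congr (\det _).
  by apply/matrixP => i j; rewrite !mxE /= /horner_eval !hornerE.
have /factor_theorem [w wE] : root (q - (\det X)%:P) 0.
  by rewrite /root !hornerE qE scale0r addr0 subrr.
exists w.[x]; rewrite -qE -[q](subrK (\det X)%:P) wE !hornerE subr0.
by rewrite addrC mulrC.
Qed.

Section IntegralOverSubring.
Variables (R : comNzRingType) (M : {pred R}) (maxM : maximal_ideal M).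
Variables (B : comNzRingType) (beta : {rmorphism B -> R}).
Hypothesis (injB : forall x, beta x \in M -> x = 0).

(* R / M is a field, finite over B[1/c]; hence B[1/c] is a field. *)
Lemma localization_is_field m (v : 'I_m -> R) (c u : B) :
    c != 0 -> u != 0 ->
    (forall p, exists t (x : 'I_m -> B), beta c ^+ t * p - \sum_i beta (x i) * v i \in M) ->
  exists t w, c ^+ t = u * w.
Proof.
move=> c0 u0 spanv; have pM := maximal_prime maxM; have idM := prime_is_ideal pM.
have cM t : beta c ^+ t \notin M.
  by apply/negP => /(prime_exp pM) /injB /eqP; rewrite (negPf c0).
have [w0 w0M] : exists w, w * beta u - 1 \in M.
  by apply: maximal_inv => //; apply/negP => /injB /eqP; rewrite (negPf u0).
have /choice [t /choice [x xM]] : forall i, exists t (x : 'I_m -> B),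
  beta c ^+ t * (w0 * v i) - \sum_j beta (x j) * v j \in M by move=> i; apply: spanv.
pose T := (\sum_i t i)%N; have tT i : (t i <= T)%N by rewrite /T (bigD1 i) //= leq_addr.
(* Here w0 is an inverse of [u] modulo [M]. With the common denominator [c ^+ T] cleared,
   multiplication by w0 on the generators has a matrix over [B]; as in Cayley-Hamilton, [\det D]
   kills all generators and hence lies in [M]. *)
pose X : 'M[B]_m := \matrix_(i, j) (c ^+ (T - t i) * x i j).
pose D := (beta c ^+ T * w0)%:M - map_mx beta X.
pose V : 'cV[R]_m := \col_i v i.
have DV i : (D *m V) i 0 \in M.
  rewrite mulmxBl mul_scalar_mx !mxE.
  have -> : \sum_j map_mx beta X i j * V j 0 = beta c ^+ (T - t i) * \sum_j beta (x i j) * v j.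
    by rewrite mulr_sumr; apply: eq_bigr => j _; rewrite !mxE rmorphM rmorphXn mulrA.
  rewrite -[in X in X - _](subnK (tT i)) exprD -!mulrA -mulrBr.
  exact: idealM.
have detV i : \det D * v i \in M.
  have -> : \det D * v i = (\adj D *m (D *m V)) i 0.
    by rewrite mulmxA mul_adj_mx mul_scalar_mx !mxE.
  by rewrite mxE; apply: ideal_sum => // j _; apply: idealM.
have detM : \det D \in M.
  have [t1 [y yM]] := spanv 1; apply: (prime_mul pM _ (cM t1)).
  rewrite mulrC -[beta c ^+ t1]mulr1.
  rewrite (idealBr idM (v := \det D * \sum_i beta (y i) * v i)); last first.
    by rewrite -mulrBr; apply: idealM.
  rewrite mulr_sumr; apply: ideal_sum => // i _.
  by rewrite mulrCA; apply: idealM.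
(* Multiplying by [u] removes w0 modulo [M]. What remains is a determinant over [B], zero by
   injectivity and congruent to a power of [c] modulo [u]. *)
have uD : beta u *: D =
    map_mx beta ((c ^+ T)%:M + u *: (- X)) + (w0 * beta u - 1) *: (beta c ^+ T)%:M.
  apply/matrixP => i j; rewrite !mxE !(rmorphD, rmorphMn, rmorphM, rmorphN, rmorphXn) !mulrnAr.
  by ring.
have := idealM idM (beta u ^+ m) detM; rewrite -detZ uD.
have [w ->] := det_add_scale (map_mx beta ((c ^+ T)%:M + u *: (- X)))
  ((beta c ^+ T)%:M) (w0 * beta u - 1).
rewrite addrC idealDr //; last exact: idealMr.
rewrite det_map_mx => /injB; have [w' ->] := det_add_scale ((c ^+ T)%:M) (- X) u.
rewrite det_scalar -exprM => /eqP; rewrite addr_eq0 => /eqP cE.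
by exists (T * m)%N, (- w'); rewrite mulrN.
Qed.

End IntegralOverSubring.

Section UnivariateElements.
Variables (k : fieldType) (n : nat) (a b : {mpoly k[n]}).
Local Notation R := {mpoly k[n]}.
Local Notation A := {poly {poly k}}.
Variables (J : {pred R}) (m : nat) (v : 'I_m -> R) (dv : 'I_m -> nat).

Lemma biv_swapXY (c : A) : biv b a (swapXY c) = biv a b c.
Proof.
have [B [_ szc szct]] := poly_size_bound c 0.
have [B' [_ szc' szct']] := poly_size_bound (swapXY c) 0.
pose N := maxn B B'.
rewrite (@bivE _ _ _ _ N); last first.
- by move=> t; apply: leq_trans (szct' t) (leq_maxr _ _).
- exact: leq_trans szc' (leq_maxr _ _).
rewrite (@bivE _ _ _ _ N); last first.
- by move=> t; apply: leq_trans (szct t) (leq_maxl _ _).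
- exact: leq_trans szc (leq_maxl _ _).
rewrite exchange_big; apply: eq_bigr => t _; apply: eq_bigr => s _.
by rewrite coef_swapXY [b ^+ _ * _]mulrC.
Qed.

Lemma free_over_swap : free_over a b J v dv -> free_over b a J v dv.
Proof.
case=> hv spanJ indJ; split=> // [p | c cJ q].
  have [c cJ] := spanJ p; exists (fun q => swapXY (c q)).
  by under eq_bigr do rewrite biv_swapXY.
have cE q' : c q' = swapXY (swapXY (c q')) by rewrite swapXYK.
rewrite cE (indJ (fun q => swapXY (c q))) ?raddf0 //.
by under eq_bigr do rewrite -biv_swapXY swapXYK.
Qed.

Hypothesis (freeJ : free_over a b J v dv).

(** Two descents. If [M] met k[a, b] only in 0, R / M would be finite over it and [b] would be
    invertible there. So some nonzero [f] lies in [M], and R / M is finite over k[a] localized at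
    the leading coefficient [c] of [f] in [b]; were [M] to meet k[a] only in 0, that localization
    would be a field, which it is not. *)
Lemma maximal_contains_univariate (M : {pred R}) : maximal_ideal M -> {subset J <= M} ->
  exists2 p : {poly k}, p != 0 & biv a b p%:P \in M.
Proof.
move=> maxM JM; have idM := prime_is_ideal (maximal_prime maxM).
have [f f0 fM] : exists2 f, f != 0 & biv a b f \in M.
  apply: contrapT => H.
  have inj x : biv a b x \in M -> x = 0.
    by move=> xM; apply/eqP; apply: contraT => x0; case: H; exists x.
  have [|||t [w]] := localization_is_field maxM inj (v := v) (c := 1) (u := 'X).
  - exact: oner_neq0.
  - by rewrite polyX_eq0.
  - move=> p; case: freeJ => _ + _; move/(_ p) => [c cJ].
    by exists 0%N, c; rewrite expr0 mul1r; apply: JM.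
  - rewrite expr1n => /(congr1 (fun p : A => p`_0)).
    by rewrite coefXM coef1 => /eqP; rewrite oner_eq0.
apply: contrapT => H; pose beta : {rmorphism {poly k} -> R} := biv a b \o polyC.
have inj x : beta x \in M -> x = 0.
  by move=> xM; apply/eqP; apply: contraT => x0; case: H; exists x.
pose c := lead_coef f; have c0 : c != 0 by rewrite lead_coef_eq0.
pose I : finType := ('I_m * 'I_(size f))%type.
pose w (i : 'I_#|I|) := b ^+ (enum_val i).2 * v (enum_val i).1.
(* [1 + 'X * c] is the test element: nonconstant because [c] is nonzero, and coprime to [c], it
   divides no power of [c]. *)
have szu : size (1 + 'X * c) = (size c).+1.
  have szXc : size ('X * c) = (size c).+1 by rewrite mulrC size_mulX.
  by rewrite addrC size_polyDl ?size_poly1 // szXc ltnS size_poly_gt0.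
have [|||t [w']] := localization_is_field maxM inj (v := w) (c := c) (u := 1 + 'X * c).
- exact: c0.
- by rewrite -size_poly_gt0 szu ltnS.
- move=> p; case: freeJ => _ + _; move/(_ p) => [e eJ].
  (* Pseudo-division of each coefficient by [f] costs a power of [c]; T is a common exponent, and
     the remainders have bounded degree in [b]. *)
  pose T := (\sum_q scalp (e q) f)%N.
  have sT q : (scalp (e q) f <= T)%N by rewrite /T (bigD1 q) //= leq_addr.
  pose r q : A := c ^+ (T - scalp (e q) f) *: (e q %% f).
  have szr q : (size (r q) <= size f)%N.
    by rewrite (leq_trans (size_scale_leq _ _)) // ltnW // ltn_modp.
  have eE q : (c ^+ T)%:P * e q = c ^+ (T - scalp (e q) f) *: (e q %/ f) * f + r q.
    rewrite mul_polyC -{1}(subnK (sT q)) exprD -scalerA Pdiv.Idomain.divp_eq.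
    by rewrite scalerDr scalerAl.
  have bE q : beta c ^+ T * biv a b (e q) =
      biv a b (c ^+ (T - scalp (e q) f) *: (e q %/ f)) * biv a b f + biv a b (r q).
    rewrite -bivM -bivD -eE bivM; congr (_ * _).
    by rewrite polyC_exp bivXn.
  exists T, (fun i : 'I_#|I| => (r (enum_val i).1)`_(enum_val i).2).
  have -> : \sum_(i < #|I|) beta (r (enum_val i).1)`_(enum_val i).2 * w i =
      \sum_q biv a b (r q) * v q.
    rewrite (reindex (@enum_rank I)) /=; last first.
      by exists enum_val => x _; rewrite (enum_rankK, enum_valK).
    rewrite (eq_bigr (fun i : I => biv a b ((r i.1)`_i.2)%:P * (b ^+ i.2 * v i.1))).
      rewrite -(pair_bigA _ (fun q (t : 'I_(size f)) =>
        biv a b ((r q)`_t)%:P * (b ^+ t * v q))) /=.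
      apply: eq_bigr => q _; rewrite [in RHS](poly_sumE (szr q)) biv_sum mulr_suml.
      by apply: eq_bigr => t _; rewrite -mul_polyC bivM bivXn bivX mulrA.
    by move=> i _; rewrite /w enum_rankK.
  have -> : beta c ^+ T * p - \sum_q biv a b (r q) * v q =
      beta c ^+ T * (p - \sum_q biv a b (e q) * v q) +
      \sum_q biv a b (c ^+ (T - scalp (e q) f) *: (e q %/ f)) * v q * biv a b f.
    rewrite mulrBr -addrA; congr (_ + _); rewrite mulr_sumr -!sumrN -big_split /=.
    apply: eq_bigr => q _.
    rewrite mulrA bE; ring.
  by apply: idealD => //; [apply: idealM => //; exact: JM | apply: ideal_sum => // q _; exact: idealM].
move=> cE; have : coprimep (1 + 'X * c) (c ^+ t).
  apply: coprimep_expr; apply/Bezout_coprimepP; exists (1, - 'X).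
  by rewrite /= mul1r mulNr addrK eqpxx.
rewrite cE => /(coprimep_dvdl (dvdp_mulr _ (dvdpp _))).
by rewrite coprimepp szu eqSS size_poly_eq0 (negPf c0).
Qed.

End UnivariateElements.

(** * Cohen-Macaulayness *)

Lemma subr_cross (V : zmodType) (x y s t : V) : x - y - (x - s - (y - t)) = s - t.
Proof. by rewrite !opprB addrA subrKA addrC subrKA. Qed.

Lemma mcoeff_pihomog (S : nzRingType) n d (p : {mpoly S[n]}) j :
  (pihomog mdeg d p)@_j = if mdeg j == d then p@_j else 0.
Proof.
rewrite [p in LHS]mpolyE pihomog_sum [p in RHS]mpolyE !raddf_sum /=.
have E i : (pihomog mdeg d (p@_i *: 'X_[i]))@_j =
    if mdeg j == d then (p@_i *: 'X_[i])@_j else 0.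
  rewrite pihomogZ pihomogX; case: (eqVneq i j) => [->|ij].
    by case: eqP => // _; rewrite mcoeffZ mcoeff0 mulr0.
  have z : (p@_i *: 'X_[i])@_j = 0 by rewrite mcoeffZ mcoeffX (negPf ij) mulr0.
  by rewrite z if_same; case: eqP => _; rewrite ?z // mcoeffZ mcoeff0 mulr0.
rewrite (eq_bigr _ (fun i _ => E i)).
by case: eqP => // _; rewrite big1.
Qed.

(** The coefficients of [map_poly polyC q] are constants, so multiplication by it commutes with
    reducing coefficients modulo [p]; it kills the reduction of [c], which is then 0 in a domain. *)
Lemma dvd_coefs_of_mul (k : fieldType) (p q : {poly k}) (c d : {poly {poly k}}) :
  q != 0 -> map_poly polyC q * c = d * p%:P -> exists c', c = c' * p%:P.
Proof.
move=> q0 cE; have m0 : (fun z => z %% p) 0 = 0 by rewrite mod0p.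
have c''0 : map_poly (fun z => z %% p) c = 0.
  have : map_poly polyC q * map_poly (fun z => z %% p) c = 0.
    apply/polyP => t; rewrite coef0 coefM.
    transitivity ((map_poly polyC q * c)`_t %% p); last by rewrite cE coefMC modp_mull.
    rewrite coefM (big_morph (fun z => z %% p) (modpD p) (mod0p p)).
    by apply: eq_bigr => j _; rewrite coef_map /= coef_map_id0 // !mul_polyC modpZl.
  move/eqP; rewrite mulf_eq0 => /orP [|/eqP //].
  by rewrite map_poly_eq0_id0 ?(negPf q0) // polyC_eq0 lead_coef_eq0.
exists (map_poly (fun z => z %/ p) c); apply/polyP => t.
rewrite coefMC coef_map_id0 ?div0p // [LHS](divp_eq _ p).
by have := congr1 (fun u : {poly {poly k}} => u`_t) c''0; rewrite coef_map_id0 // coef0 => ->; rewrite addr0.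
Qed.

Section FreeCM.
Variables (k : fieldType) (n : nat) (a b : {mpoly k[n]}).
Local Notation R := {mpoly k[n]}.
Local Notation A := {poly {poly k}}.
Variables (J : {pred R}) (m : nat) (v : 'I_m -> R) (dv : 'I_m -> nat).
Hypotheses (ha : a \is 1.-homog) (hb : b \is 1.-homog).
Hypotheses (homJ : homogeneous_ideal J) (freeJ : free_over a b J v dv).

Let idJ : is_ideal J. Proof. exact/idealr_is_ideal/(proj1 homJ). Qed.

(** Regularity is read off the coordinates in the free basis, where nonzero polynomials p(a) and
    q(b) behave as on k[a, b] itself; properness comes from [M]. *)
Lemma free_regular_seq (M : {pred R}) (p q : {poly k}) :
    is_ideal M -> 1 \notin M -> {subset J <= M} -> p != 0 -> q != 0 ->
    biv a b p%:P \in M -> biv a b (map_poly polyC q) \in M ->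
  regular_seq J [:: biv a b p%:P; biv a b (map_poly polyC q)].
Proof.
move=> idM M1 JM p0 q0 pM qM; case: freeJ => _ spanJ indJ.
have pC0 : p%:P != 0 :> A by rewrite polyC_eq0.
split; last first.
  apply: contra M1; apply: ideal_adjoin_least => // x.
  by rewrite !inE => /orP [] /eqP ->.
have scal e x (c : 'I_m -> A) : x - \sum_q biv a b (c q) * v q \in J ->
    biv a b e * x - \sum_q biv a b (e * c q) * v q \in J.
  move=> xJ; rewrite (_ : _ - _ = biv a b e * (x - \sum_q biv a b (c q) * v q)).
    exact: idealM.
  by rewrite mulrBr mulr_sumr; under eq_bigr do rewrite bivM -mulrA.
case=> [|[|//]] x _ /=.
- rewrite !ideal_adjoin0 => pxJ; have [c xJ] := spanJ x.
  have pc0 : forall r, p%:P * c r = 0.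
    by apply: (indJ (fun r => p%:P * c r)); rewrite -(idealBr idJ (scal _ _ _ xJ)).
  rewrite (idealBr idJ xJ) big1 => [|r _]; first exact: ideal0.
  move/eqP: (pc0 r); rewrite mulf_eq0 (negPf pC0) => /eqP ->.
  by rewrite biv0 mul0r.
- move=> /ideal_adjoin1P [r rJ]; have [c xJ] := spanJ x; have [d rJ'] := spanJ r.
  have E s : map_poly polyC q * c s - p%:P * d s = 0.
    apply: (indJ (fun s => map_poly polyC q * c s - p%:P * d s)).
    have := idealB idJ rJ (idealB idJ (scal (map_poly polyC q) _ _ xJ) (scal p%:P _ _ rJ')).
    congr (_ \in J); under [in RHS]eq_bigr do rewrite bivB mulrBl.
    by rewrite sumrB [r * _]mulrC subr_cross.
  have /choice [c' c'E] s : exists c', c s = c' * p%:P.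
    by apply: (dvd_coefs_of_mul q0 (d := d s)); rewrite [RHS]mulrC; apply/eqP; rewrite -subr_eq0 E.
  apply/ideal_adjoin1P; exists (\sum_s biv a b (c' s) * v s).
  congr (_ \in J): xJ; congr (_ - _); rewrite mulr_suml; apply: eq_bigr => s _.
  by rewrite c'E bivM mulrAC.
Qed.

Lemma maximal_regular_seq (M : {pred R}) : maximal_ideal M -> {subset J <= M} ->
  exists s, [/\ {subset s <= M}, regular_seq J s & size s = 2].
Proof.
move=> maxM JM; have idM := prime_is_ideal (maximal_prime maxM).
have M1 : 1 \notin M by case: maxM => [[]].
have [p p0 pM] := maximal_contains_univariate freeJ maxM JM.
have [q q0 qM] := maximal_contains_univariate (free_over_swap freeJ) maxM JM.
have qE : biv b a q%:P = biv a b (map_poly polyC q) by rewrite -(biv_swapXY a b) swapXY_map_polyC.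
exists [:: biv a b p%:P; biv a b (map_poly polyC q)]; split=> //.
  by move=> x; rewrite !inE => /orP [] /eqP -> //; rewrite -qE.
by apply: free_regular_seq idM M1 JM p0 q0 pM _; rewrite -qE.
Qed.

(** Every maximal ideal over [J] has depth and height 2. One regular sequence of length 2 gives both
    lower bounds; both upper bounds come from chains of primes, since a regular sequence also
    produces a chain. *)
Lemma free_cohen_macaulay : cohen_macaulay J.
Proof.
move=> M maxM JM; have pM := maximal_prime maxM; exists 2.
have chain s : {subset s <= M} -> regular_seq J s ->
    exists C, prime_chain J (size s) C /\ C (size s) = M.
  by move=> sM regs; apply: prime_chain_of_regular_seq.
have [s [sM regs szs]] := maximal_regular_seq maxM JM.
split; split.
- by exists s.
- move=> s' s'M /(chain _ s'M) [C [chC _]]; exact (free_chain_leq2 ha hb homJ freeJ chC).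
- by have [C [chC CM]] := chain s sM regs; exists C; rewrite -szs CM.
- by move=> h' C chC _; exact (free_chain_leq2 ha hb homJ freeJ chC).
Qed.

Lemma homogeneous_mcoeff0 p : p \in J -> p@_0%MM = 0.
Proof.
move=> pJ; apply/eqP; apply: contraT => p0; case: homJ => [[_ J1 _] hJ].
have hp := pihomogP mdeg 0 p.
have E : pihomog mdeg 0 p = (p@_0%MM)%:MP.
  apply/mpolyP => j; rewrite mcoeff_pihomog mcoeffC mdeg_eq0 [_ == 0%MM]eq_sym.
  by case: eqP => [->|_]; rewrite ?mulr1 ?mulr0.
have := hJ _ 0%N pJ; rewrite E => /(idealZ (p@_0%MM)^-1 idJ).
by rewrite -mul_mpolyC -mpolyCM mulVf // (negPf J1).
Qed.

Lemma irrelevant_maximal : maximal_ideal [pred p : R | p@_0%MM == 0].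
Proof.
split; first split.
- by rewrite inE mcoeff0.
- by rewrite inE mcoeff1 eqxx oner_eq0.
- move=> x p q; rewrite !inE => /eqP p0 /eqP q0.
  by rewrite mcoeffD q0 addr0 -[_@__]/(mcoeff 0%MM _) rmorphM /= p0 mulr0.
move=> M' idM' sub p pM'; apply/eqP; apply/eqP; apply: contraT => p0.
have idM := idealr_is_ideal idM'; case: idM' => _ M1 _; move/negP: M1 => [].
have : p - (p@_0%MM)%:MP \in M' by apply: sub; rewrite inE mcoeffB mcoeffC eqxx mulr1 subrr.
move=> /(idealB idM pM'); rewrite opprB addrC subrK.
by move=> /(idealZ (p@_0%MM)^-1 idM); rewrite -mul_mpolyC -mpolyCM mulVf.
Qed.

Lemma free_krull_dim : is_krull_dim J 2.
Proof.
have JM : {subset J <= [pred p : R | p@_0%MM == 0]}.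
  by move=> p pJ; apply/eqP/homogeneous_mcoeff0.
split; last by move=> h C chC; exact (free_chain_leq2 ha hb homJ freeJ chC).
have [s [sM regs szs]] := maximal_regular_seq irrelevant_maximal JM.
have [C [chC _]] := prime_chain_of_regular_seq idJ regs (maximal_prime irrelevant_maximal) JM sM.
by exists C; rewrite szs in chC.
Qed.

End FreeCM.

(** * Multiplicity *)

Section Multiplicity.
Variables (k : fieldType) (n : nat) (a b : {mpoly k[n]}).
Local Notation R := {mpoly k[n]}.
Variables (J : {pred R}) (m : nat) (v : 'I_m -> R) (dv : 'I_m -> nat).
Hypotheses (ha : a \is 1.-homog) (hb : b \is 1.-homog).
Hypotheses (homJ : homogeneous_ideal J) (freeJ : free_over a b J v dv).

Let idJ : is_ideal J. Proof. exact/idealr_is_ideal/(proj1 homJ). Qed.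

Lemma free_hilbert_value d : is_hilbert_value J d (\sum_q (d.+1 - dv q))%N.
Proof.
pose I : finType := {q : 'I_m & 'I_(d.+1 - dv q)}.
have <- : #|I| = (\sum_q (d.+1 - dv q))%N.
  rewrite card_tagged sumnE big_map big_enum /=.
  by apply: eq_bigr => q _; rewrite card_ord.
pose B (x : I) := hbasis a b v dv d (tag x) (tagged x).
have sumE (e : 'I_m -> nat -> k) : \sum_(x : I) e (tag x) (tagged x) *: B x =
    \sum_q \sum_(s < d.+1 - dv q) e q s *: hbasis a b v dv d q s.
  by rewrite sig_big_dep.
have rowE (c : 'rV[k]_#|I|) : \sum_j c 0 j *: B (enum_val j) =
    \sum_(x : I) c 0 (enum_rank x) *: B x.
  rewrite (reindex (@enum_rank I)) /=; last first.
    by exists enum_val => x _; rewrite (enum_rankK, enum_valK).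
  by apply: eq_bigr => x _; rewrite enum_rankK.
have freeB (c : 'rV[k]_#|I|) : \sum_j c 0 j *: B (enum_val j) \in J -> c = 0.
  pose e (q : 'I_m) (s : nat) :=
    if (insub s : option 'I_(d.+1 - dv q)) is Some s'
    then c 0 (enum_rank (existT (fun q => 'I_(d.+1 - dv q)) q s' : I)) else 0.
  have eE (x : I) : e (tag x) (tagged x) = c 0 (enum_rank x).
    by rewrite /e valK /=; case: x.
  rewrite rowE -(eq_bigr _ (fun x _ => congr1 (fun y => y *: B x) (eE x))) sumE.
  move=> /(hbasis_free ha hb homJ freeJ) e0; apply/rowP => j; rewrite mxE -(enum_valK j) -eE.
  exact: e0.
exists (fun j => B (enum_val j)); split; first by move=> j; apply: (hbasis_homog ha hb homJ freeJ).
move=> p hp; have [e eJ] := hbasis_span ha hb homJ freeJ hp.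
pose c0 : 'rV[k]_#|I| := \row_(j < #|I|) let x : I := enum_val j in e (tag x) (tagged x).
have cJ : p - \sum_j c0 0 j *: B (enum_val j) \in J.
  by rewrite rowE; under eq_bigr do rewrite mxE enum_rankK; rewrite sumE.
exists c0; split=> // c c'J.
apply/eqP; rewrite eq_sym -subr_eq0; apply/eqP/freeB.
have := idealB idJ cJ c'J; congr (_ \in J).
rewrite opprB addrC subrKA -sumrB; apply: eq_bigr => j _.
by rewrite -scalerBl !mxE.
Qed.

(** The sum of the Hilbert function of k[a, b](-e), doubled to stay in nat; truncated subtraction
    makes both sides 0 for i <= e. *)
Lemma sum_succ_sub i e : ((\sum_(j < i) (j.+1 - e)) * 2 = (i - e) * (i - e).+1)%N.
Proof.
elim: i => [|i IH]; first by rewrite big_ord0.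
rewrite big_ord_recr /= mulnDl IH; case: (leqP e i) => h; last by nia.
by rewrite !subSn //; nia.
Qed.

Lemma free_multiplicity : is_multiplicity J m.
Proof.
(* The expansion of (X - c)(X - c + 1), half of which sums the Hilbert function of k[a, b](-c). *)
pose Q (c : rat) : {poly rat} := 'X^2 + (1 - c - c)%:P * 'X + (c * c - c)%:P.
(* The threshold [\sum_q dv q] bounds every [dv q], so that [i - dv q] is not truncated from there
   on. *)
exists 2, (fun i => \sum_q (i.+1 - dv q))%N, (2^-1 *: \sum_q Q (dv q)%:R), (\sum_q dv q)%N; split.
- exact: free_krull_dim ha hb homJ freeJ.
- exact: free_hilbert_value.
- move=> i ige; rewrite exchange_big hornerZ horner_sum natr_sum mulr_sumr.
  apply: eq_bigr => q _; have dq : (dv q <= i)%N.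
    by apply: leq_trans ige; rewrite (bigD1 q) //= leq_addr.
  apply: (@mulIf _ 2%:R) => //; rewrite -natrM sum_succ_sub natrM -addn1 natrD natrB //.
  rewrite /Q !(hornerD, hornerM, hornerX, hornerXn, hornerC).
  by field.
- rewrite coefZ coef_sum (eq_bigr (fun=> 1)) => [|q _]; last first.
    by rewrite !coefD coefXn coefMX !coefC.
  by rewrite sumr_const card_ord mulrA mulfV // mul1r.
Qed.

End Multiplicity.

(** * Linear coordinates *)

Section MmapComm.
Variables (k : fieldType) (n : nat) (S : nzRingType) (f : {rmorphism k -> S}) (h : 'I_n -> S).
Hypothesis (commh : forall i j, GRing.comm (h i) (h j)).
Hypothesis (commf : forall c x, GRing.comm (f c) x).

(* The library's [commr_mmap_is_multiplicative] asks the [h i] to be central. *)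
Lemma mmap_mul_comm p q : mmap f h (p * q) = mmap f h p * mmap f h q.
Proof.
have hM m1 m2 : mmap1 h (m1 + m2)%MM = mmap1 h m1 * mmap1 h m2.
  rewrite /mmap1 -prodrM_comm => [|i j _ _]; last exact/commrX/commr_sym/commrX/commr_sym/commh.
  by apply: eq_bigr => i _; rewrite mnmDE exprD.
elim/mpolyind: p => [|c m p _ _ IH]; first by rewrite mul0r mmap0 mul0r.
rewrite mulrDl !mmapD mulrDl IH; congr (_ + _); rewrite -scalerAl !mmapZ -mulrA mmapX.
congr (_ * _); elim/mpolyind: q {IH} => [|d m' q _ _ IH]; first by rewrite mulr0 mmap0 mulr0.
rewrite mulrDr !mmapD mulrDr IH; congr (_ + _).
by rewrite -scalerAr -mpolyXD !mmapZ !mmapX hM !mulrA commf.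
Qed.

End MmapComm.

Lemma mpoly_alg_ind (k : fieldType) n (P : {mpoly k[n]} -> Prop) :
    (forall c, P c%:MP) -> (forall i, P 'X_i) ->
    (forall p q, P p -> P q -> P (p + q)) -> (forall p q, P p -> P q -> P (p * q)) ->
  forall p, P p.
Proof.
move=> PC PX PD PM; elim/mpolyind => [|c m p _ _ Pp]; first by rewrite -mpolyC0.
apply: (PD) => //; rewrite -mul_mpolyC; apply: (PM) => //; rewrite mpolyXE_id.
elim/big_ind: _ => [||i _]; [by rewrite -mpolyC1 | exact: PM | ].
elim: (m i) => [|e IH]; first by rewrite expr0 -mpolyC1.
by rewrite exprS; apply: PM.
Qed.

Section Coordinates.
Variables (k : fieldType) (n : nat).
Local Notation R := {mpoly k[n]}.

(** [s] is the substitution inverse to [l]: [p \mPo s] is [p] written in the coordinates [l]. *)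
Definition coordinates (l s : n.-tuple R) : Prop :=
  [/\ forall i, tnth l i \is 1.-homog, forall i, tnth s i \is 1.-homog,
      forall i, tnth s i \mPo l = 'X_i & forall i, tnth l i \mPo s = 'X_i].

Variables (l s : n.-tuple R) (ls : coordinates l s).

Lemma comp_coordK p : (p \mPo s) \mPo l = p.
Proof.
case: ls => _ _ sl _; elim/mpoly_alg_ind: p => [c|i|p q IHp IHq|p q IHp IHq].
- by rewrite !comp_mpolyC.
- by rewrite comp_mpolyXU -tnth_nth sl.
- by rewrite !comp_mpolyD IHp IHq.
- by rewrite !rmorphM /= IHp IHq.
Qed.

Lemma coord_ind (P : R -> Prop) :
    (forall c, P c%:MP) -> (forall i, P (tnth l i)) ->
    (forall p q, P p -> P q -> P (p + q)) -> (forall p q, P p -> P q -> P (p * q)) ->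
  forall p, P p.
Proof.
move=> PC Pl PD PM p; rewrite -(comp_coordK p); move: (p \mPo s) => {}p.
elim/mpoly_alg_ind: p => [c|i|p q IHp IHq|p q IHp IHq].
- by rewrite comp_mpolyC.
- by rewrite comp_mpolyXU -tnth_nth.
- by rewrite comp_mpolyD; apply: PD.
- by rewrite rmorphM; apply: PM.
Qed.

Section Evaluation.
Variables (S : nzRingType) (f : {rmorphism k -> S}) (h : 'I_n -> S).

(** The map sending [l_i] to [h i]. The target may be non-commutative, as matrices will be
    substituted. *)
Definition coord_ev (p : R) : S := mmap f h (p \mPo s).

Lemma coord_evC c : coord_ev c%:MP = f c.
Proof. by rewrite /coord_ev comp_mpolyC mmapC. Qed.

Lemma coord_evl i : coord_ev (tnth l i) = h i.
Proof. by case: ls => _ _ _ ls'; rewrite /coord_ev ls' mmapX mmap1U. Qed.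

Lemma coord_evD p q : coord_ev (p + q) = coord_ev p + coord_ev q.
Proof. by rewrite /coord_ev comp_mpolyD mmapD. Qed.

Lemma coord_evM : (forall i j, GRing.comm (h i) (h j)) ->
  (forall c x, GRing.comm (f c) x) ->
  forall p q, coord_ev (p * q) = coord_ev p * coord_ev q.
Proof. by move=> *; rewrite /coord_ev rmorphM mmap_mul_comm. Qed.

Lemma coord_ev_rmorph : (forall i j, GRing.comm (h i) (h j)) ->
  (forall c x, GRing.comm (f c) x) -> exists F : {rmorphism R -> S}, F =1 coord_ev.
Proof.
move=> commh commf.
pose M1 := GRing.isMonoidMorphism.Build R S coord_ev
  (conj (etrans (coord_evC 1) (rmorph1 f)) (coord_evM commh commf)).
have Bm : zmod_morphism coord_ev by move=> p q; rewrite /coord_ev comp_mpolyB mmapB.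
pose M2 := GRing.isZmodMorphism.Build R S coord_ev Bm.
pose F : {rmorphism R -> S} := HB.pack coord_ev M1 M2.
by exists F.
Qed.

End Evaluation.
End Coordinates.

(** * Multiplication matrices *)

Lemma subr_add_add (V : zmodType) (x y z t : V) : x + y - (z + t) = (x - z) + (y - t).
Proof. by rewrite opprD addrACA. Qed.

Lemma scalar_mxD (B : pzRingType) m (x y : B) : (x + y)%:M = x%:M + y%:M :> 'M[B]_m.
Proof. exact: raddfD. Qed.

Lemma scalar_mx0 (B : pzRingType) m : 0%:M = 0 :> 'M[B]_m.
Proof. exact: raddf0. Qed.

Section MultiplicationMatrices.
Variables (k : fieldType) (n : nat).
Local Notation R := {mpoly k[n]}.
Local Notation A := {poly {poly k}}.
Variables (l s : n.-tuple R) (ls : coordinates l s) (i0 i1 : 'I_n).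
Local Notation a := (tnth l i0).
Local Notation b := (tnth l i1).
Variables (J : {pred R}) (m : nat) (v : 'I_m.+1 -> R) (dv : 'I_m.+1 -> nat).
Hypotheses (homJ : homogeneous_ideal J) (freeJ : free_over a b J v dv).

Let idJ : is_ideal J. Proof. exact/idealr_is_ideal/(proj1 homJ). Qed.
Let ha : a \is 1.-homog. Proof. by case: ls. Qed.
Let hb : b \is 1.-homog. Proof. by case: ls. Qed.

Lemma free_span_homog d p : p \is d.-homog -> exists c : 'I_m.+1 -> A,
  (forall r, twisted_homog (dv r) d (biv a b (c r))) /\ p - \sum_r biv a b (c r) * v r \in J.
Proof.
move=> hp; have [e eJ] := hbasis_span ha hb homJ freeJ hp.
exists (fun r => \sum_(t < d.+1 - dv r) (e r t *: 'X^t)%:P * 'X^(d - dv r - t)).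
split=> [r|]; last first.
  congr (_ \in J): eJ; congr (_ - _); apply: eq_bigr => r _.
  rewrite biv_sum mulr_suml; apply: eq_bigr => t _.
  by rewrite biv_mon -scalerAl.
rewrite /twisted_homog biv_sum; case: leqP => [le|lt].
  apply: rpred_sum => t _; rewrite biv_mon; apply: rpredZ.
  have := dhomogM (dhomogMn t ha) (dhomogMn (d - dv r - t) hb).
  by rewrite !mul1n subnKC //; have := ltn_ord t; lia.
by rewrite big1 // => t _; have := ltn_ord t; lia.
Qed.

Definition mult_mx (T : 'I_n -> 'M[A]_m.+1) : Prop :=
  (forall j q, tnth l j * v q - \sum_r biv a b (T j q r) * v r \in J) /\
  (forall j q r, twisted_homog (dv r) (dv q).+1 (biv a b (T j q r))).

Lemma exists_mult_mx : exists T, mult_mx T.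
Proof.
have /choice [T TP] : forall x : 'I_n * 'I_m.+1, exists c : 'I_m.+1 -> A,
  (forall r, twisted_homog (dv r) (dv x.2).+1 (biv a b (c r))) /\
  tnth l x.1 * v x.2 - \sum_r biv a b (c r) * v r \in J.
  case=> j q; apply: free_span_homog; apply: (@dhomogM _ _ mdeg 1); first by case: ls.
  by case: freeJ.
exists (fun j => \matrix_(q, r) T (j, q) r); split=> j q => [|r].
  by under eq_bigr do rewrite mxE; case: (TP (j, q)).
by rewrite mxE; case: (TP (j, q)).
Qed.

Variables (T : 'I_n -> 'M[A]_m.+1) (TP : mult_mx T).

(** Both products represent multiplication by l_i l_j, and coordinates in the free basis are
    unique. *)
Lemma mult_mxC i j : T i *m T j = T j *m T i.
Proof.
have key x y q : tnth l y * tnth l x * v q - \sum_r biv a b ((T x *m T y) q r) * v r \in J.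
  have -> : \sum_r biv a b ((T x *m T y) q r) * v r =
      \sum_u biv a b (T x q u) * (\sum_r biv a b (T y u r) * v r).
    under [RHS]eq_bigr do rewrite mulr_sumr.
    rewrite exchange_big; apply: eq_bigr => r _.
    rewrite mxE biv_sum mulr_suml; apply: eq_bigr => u _.
    by rewrite bivM mulrA.
  have -> : tnth l y * tnth l x * v q - \sum_u biv a b (T x q u) * (\sum_r biv a b (T y u r) * v r) =
      tnth l y * (tnth l x * v q - \sum_u biv a b (T x q u) * v u) +
      \sum_u biv a b (T x q u) * (tnth l y * v u - \sum_r biv a b (T y u r) * v r).
    rewrite mulrBr mulrA -addrA; congr (_ + _); rewrite [tnth l y * _]mulr_sumr -!sumrN -big_split.
    by apply: eq_bigr => u _; rewrite /= [X in _ + X]mulrBr [tnth l y * _]mulrCA addKr.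
  by apply: idealD => //; [apply: idealM => //; case: TP | apply: ideal_sum => // u _;
    apply: idealM => //; case: TP].
apply/matrixP => q r; apply/eqP; rewrite -subr_eq0; apply/eqP.
case: freeJ => _ _ indJ; apply: (indJ (fun r => (T i *m T j) q r - (T j *m T i) q r)).
under eq_bigr do rewrite bivB mulrBl.
rewrite sumrB; have := idealB idJ (key j i q) (key i j q).
by rewrite [tnth l i * _]mulrC; congr (_ \in J); rewrite opprB addrC addrA subrK.
Qed.

Definition tmx j : 'M[R]_m.+1 := map_mx (biv a b) (T j).
(** The characteristic matrix of [T j] taken at [l_j]. The cokernel of all interior ones together is
    R / J, see [seq0_ker]. *)
Definition dmx j : 'M[R]_m.+1 := (tnth l j)%:M - tmx j.

Lemma tmxC i j : GRing.comm (tmx i) (tmx j).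
Proof. by rewrite /GRing.comm -!mulmxE /tmx -!map_mxM mult_mxC. Qed.

Lemma scalar_comm (x : R) (X : 'M[R]_m.+1) : GRing.comm X x%:M.
Proof. by rewrite /GRing.comm -!mulmxE scalar_mxC. Qed.

Definition subst_val (js : seq 'I_n) j : 'M[R]_m.+1 := if j \in js then tmx j else (tnth l j)%:M.

(** [p] with [l_j] replaced by the matrix [T j] for [j] in [js], the other coordinates staying
    scalars; multiplicative because the [T j] commute. *)
Definition subst_mx js : R -> 'M[R]_m.+1 :=
  coord_ev s (@scalar_mx R m.+1 \o @mpolyC n k) (subst_val js).

Lemma comm_subst_val js i X : (forall j, GRing.comm X (tmx j)) -> GRing.comm X (subst_val js i).
Proof. by move=> cX; rewrite /subst_val; case: ifP => _ //; apply: scalar_comm. Qed.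

Lemma subst_mxM js p q : subst_mx js (p * q) = subst_mx js p *m subst_mx js q.
Proof.
apply: coord_evM => [i j|c x]; last exact/commr_sym/scalar_comm.
by apply: comm_subst_val => j'; apply/commr_sym/comm_subst_val => i'; apply: tmxC.
Qed.

Lemma subst_mxD js p q : subst_mx js (p + q) = subst_mx js p + subst_mx js q.
Proof. exact: coord_evD. Qed.

Lemma subst_mxC js c : subst_mx js c%:MP = (c%:MP)%:M.
Proof. exact: coord_evC. Qed.

Lemma subst_mxl js j : subst_mx js (tnth l j) = subst_val js j.
Proof. exact: coord_evl. Qed.

Opaque subst_mx.

Lemma comm_subst_mx js p X : (forall j, GRing.comm X (tmx j)) -> GRing.comm X (subst_mx js p).
Proof.
move=> cX; elim/(coord_ind ls): p => [c|i|p q IHp IHq|p q IHp IHq].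
- by rewrite subst_mxC; apply: scalar_comm.
- by rewrite subst_mxl; apply: comm_subst_val.
- by rewrite subst_mxD; apply: commrD.
- by rewrite subst_mxM; apply: commrM.
Qed.

Lemma comm_dmx_tmx j i : GRing.comm (dmx j) (tmx i).
Proof. by apply/commr_sym; apply: commrB; [exact: scalar_comm | exact: tmxC]. Qed.

Lemma dmxC i j : dmx i *m dmx j = dmx j *m dmx i.
Proof. by apply: commrB; [exact: scalar_comm | exact: comm_dmx_tmx]. Qed.

(** The case at hand is a [p] free of the coordinates in [js]. If [js] is interior, the entries of
    the [T j] qualify, as they involve only [a] and [b]. *)
Definition scalar_under js p := subst_mx js p = p%:M.

Lemma scalar_underM js p q : scalar_under js p -> scalar_under js q -> scalar_under js (p * q).
Proof. by rewrite /scalar_under subst_mxM => -> ->; rewrite -scalar_mxM. Qed.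

Lemma scalar_underD js p q : scalar_under js p -> scalar_under js q -> scalar_under js (p + q).
Proof. by rewrite /scalar_under subst_mxD => -> ->; rewrite scalar_mxD. Qed.

Lemma scalar_underC js c : scalar_under js c%:MP. Proof. exact: subst_mxC. Qed.

Lemma scalar_underN js p : scalar_under js p -> scalar_under js (- p).
Proof.
rewrite -mulN1r -(mpolyC1 n k) -mpolyCN => pP.
by apply: scalar_underM => //; apply: scalar_underC.
Qed.

Lemma scalar_underl js j : j \notin js -> scalar_under js (tnth l j).
Proof. by rewrite /scalar_under subst_mxl /subst_val => /negPf ->. Qed.

Lemma scalar_under_sum js I (r : seq I) (E : I -> R) :
  (forall i, scalar_under js (E i)) -> scalar_under js (\sum_(i <- r) E i).
Proof.
move=> EP; elim/big_ind: _ => //; last exact: scalar_underD.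
by rewrite -(mpolyC0 n k); apply: scalar_underC.
Qed.

Lemma scalar_under_prod js I (r : seq I) (E : I -> R) :
  (forall i, scalar_under js (E i)) -> scalar_under js (\prod_(i <- r) E i).
Proof.
move=> EP; elim/big_ind: _ => //; last exact: scalar_underM.
by rewrite -(mpolyC1 n k); apply: scalar_underC.
Qed.

Lemma scalar_underX js p e : scalar_under js p -> scalar_under js (p ^+ e).
Proof.
move=> pP; elim: e => [|e IH]; last by rewrite exprS; apply: scalar_underM.
by rewrite expr0 -(mpolyC1 n k); apply: scalar_underC.
Qed.

Lemma scalar_under_biv js c : i0 \notin js -> i1 \notin js -> scalar_under js (biv a b c).
Proof.
move=> hi0 hi1; have [B [_ szc szct]] := poly_size_bound c 0.
rewrite (bivE _ _ szc szct); apply: scalar_under_sum => t; apply: scalar_under_sum => u.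
rewrite -mul_mpolyC; apply: scalar_underM; first exact: scalar_underC.
by apply: scalar_underM; apply: scalar_underX; apply: scalar_underl.
Qed.

(* The submodule of R^(m+1) spanned by the images of the [dmx j]. *)
Fixpoint im_dmx (js : seq 'I_n) (u : 'rV[R]_m.+1) : Prop :=
  if js is j :: js' then exists w, im_dmx js' (u - w *m dmx j) else u = 0.

Lemma im_dmx0 js : im_dmx js 0.
Proof. by elim: js => //= j js IH; exists 0; rewrite mul0mx subr0. Qed.

Lemma im_dmxD js u w : im_dmx js u -> im_dmx js w -> im_dmx js (u + w).
Proof.
elim: js u w => [|j js IH] u w /=; first by move=> -> ->; rewrite addr0.
by move=> [x xP] [y yP]; exists (x + y); rewrite mulmxDl opprD addrACA; apply: IH.
Qed.

Lemma im_dmxM js u X : (forall j, dmx j *m X = X *m dmx j) -> im_dmx js u -> im_dmx js (u *m X).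
Proof.
move=> cX; elim: js u => [|j js IH] u /=; first by move=> ->; rewrite mul0mx.
move=> [x xP]; exists (x *m X).
by rewrite -mulmxA -cX mulmxA -mulmxBl; apply: IH.
Qed.

Lemma im_dmx_mem js j w : j \in js -> im_dmx js (w *m dmx j).
Proof.
elim: js => //= i js IH; rewrite inE => /orP [/eqP <-|/IH h].
  by exists w; rewrite subrr; apply: im_dmx0.
by exists 0; rewrite mul0mx subr0.
Qed.

Lemma im_dmx_cons j js u : im_dmx js u -> im_dmx (j :: js) u.
Proof. by exists 0; rewrite mul0mx subr0. Qed.

(** A normal form of [u] modulo the images of the [dmx j], [j] in [js]: for interior [js] it is 0
    exactly on those images, by [subst_row_eq0] and [subst_row_im]. *)
Definition subst_row js (u : 'rV[R]_m.+1) : 'rV[R]_m.+1 :=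
  \sum_q row q (subst_mx js (u 0 q)).

Lemma subst_rowD js u w : subst_row js (u + w) = subst_row js u + subst_row js w.
Proof.
rewrite /subst_row -big_split /=; apply: eq_bigr => q _.
by rewrite mxE subst_mxD raddfD.
Qed.

(** p(l) - p(T) lies in the ideal generated by the l_j - T_j. For a product, pq - p'q' = p(q - q') +
    (p - p')q', where the factor q' commutes with every [dmx j]. *)
Lemma im_sub_subst_mx js p w : im_dmx js (w *m (p%:M - subst_mx js p)).
Proof.
elim/(coord_ind ls): p w => [c|i|p q IHp IHq|p q IHp IHq] w.
- by rewrite subst_mxC subrr mulmx0; apply: im_dmx0.
- rewrite subst_mxl /subst_val; case: ifP => h; last by rewrite subrr mulmx0; apply: im_dmx0.
  exact: im_dmx_mem.
- have -> : (p + q)%:M - subst_mx js (p + q) =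
      (p%:M - subst_mx js p) + (q%:M - subst_mx js q).
    rewrite subst_mxD scalar_mxD; exact: subr_add_add.
  rewrite mulmxDr; apply: im_dmxD; [exact: IHp | exact: IHq].
- have -> : (p * q)%:M - subst_mx js (p * q) =
      p%:M *m (q%:M - subst_mx js q) + (p%:M - subst_mx js p) *m subst_mx js q.
    by rewrite subst_mxM mulmxBr mulmxBl -scalar_mxM addrA subrK.
  rewrite mulmxDr !mulmxA; apply: im_dmxD; first exact: IHq.
  apply: im_dmxM => // j; apply: comm_subst_mx => i; exact: comm_dmx_tmx.
Qed.

Lemma row_sum_scalar (u : 'rV[R]_m.+1) : u = \sum_q delta_mx 0 q *m (u 0 q)%:M.
Proof.
rewrite [LHS]row_sum_delta; apply: eq_bigr => q _.
by rewrite mul_mx_scalar.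
Qed.

Lemma subst_rowE js u : subst_row js u = \sum_q delta_mx 0 q *m subst_mx js (u 0 q).
Proof. by apply: eq_bigr => q _; rewrite rowE. Qed.

Lemma subst_row_eq0 js u : subst_row js u = 0 -> im_dmx js u.
Proof.
move=> u0; rewrite -[u]subr0 -u0 subst_rowE {1}[u]row_sum_scalar -sumrB.
elim/big_ind: _ => [||q _]; [exact: im_dmx0 | exact: im_dmxD | ].
by rewrite -mulmxBr; apply: im_sub_subst_mx.
Qed.

(** The entries of [T j] are in k[a, b] and survive the substitution. For [j] in [js] the term l_j
    turns into [T j] and cancels; otherwise [dmx j] is unchanged and moves out by commutation. *)
Lemma subst_row_dmx js j u : i0 \notin js -> i1 \notin js ->
  subst_row js (u *m dmx j) = if j \in js then 0 else subst_row js u *m dmx j.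
Proof.
move=> hi0 hi1.
have rowD q : subst_row js (row q (dmx j)) = if j \in js then 0 else row q (dmx j).
  have E r : subst_mx js (row q (dmx j) 0 r) = (subst_val js j *+ (q == r)) - (biv a b (T j q r))%:M.
    rewrite !mxE; have := scalar_under_biv (T j q r) hi0 hi1; set B := biv _ _ _ => BE.
    have BN : subst_mx js (- B) = - B%:M.
      by apply/eqP; rewrite -addr_eq0 -BE -subst_mxD addNr -mpolyC0 subst_mxC mpolyC0 scalar_mx0.
    rewrite subst_mxD BN; case: eqP => _; first by rewrite mulr1n subst_mxl mulr1n.
    by rewrite !mulr0n -(mpolyC0 n k) subst_mxC mpolyC0 scalar_mx0.
  rewrite subst_rowE; under eq_bigr do rewrite E mulmxBr mul_mx_scalar.
  rewrite sumrB (bigD1 q) //= eqxx mulr1n big1 => [|r /negPf rq]; last first.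
    by rewrite eq_sym rq mulr0n mulmx0.
  have -> : \sum_r biv a b (T j q r) *: delta_mx 0 r = row q (tmx j).
    by rewrite [RHS]row_sum_scalar; apply: eq_bigr => r _; rewrite mul_mx_scalar !mxE.
  rewrite addr0 -rowE -linearB /= /subst_val; case: ifP => _; last by [].
  by rewrite subrr linear0.
have E : u *m dmx j = \sum_q (u 0 q)%:M *m row q (dmx j).
  by rewrite mulmx_sum_row; apply: eq_bigr => q _; rewrite mul_scalar_mx.
have substZ p (w : 'rV[R]_m.+1) : subst_row js (p%:M *m w) = subst_row js w *m subst_mx js p.
  rewrite mul_scalar_mx !subst_rowE mulmx_suml; apply: eq_bigr => q _.
  rewrite mxE mulrC subst_mxM mulmxA //.
have subst0 : subst_row js 0 = 0.
  by apply: (addrI (subst_row js 0)); rewrite -subst_rowD !addr0.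
rewrite E (big_morph _ (subst_rowD js) subst0).
under eq_bigr do rewrite substZ rowD.
case: ifP => _; first by rewrite big1 // => q _; rewrite mul0mx.
rewrite subst_rowE mulmx_suml; apply: eq_bigr => q _.
rewrite rowE -!mulmxA; congr (_ *m _); apply: comm_subst_mx => i; exact: comm_dmx_tmx.
Qed.

Lemma subst_row_im js u : i0 \notin js -> i1 \notin js -> im_dmx js u -> subst_row js u = 0.
Proof.
move=> hi0 hi1; suff H js' : {subset js' <= js} -> im_dmx js' u -> subst_row js u = 0 by apply: H.
elim: js' u => [|j js' IH] u sub /=.
  by move=> ->; apply: (addrI (subst_row js 0)); rewrite -subst_rowD !addr0.
case=> w wP; rewrite -[u](subrK (w *m dmx j)) subst_rowD IH //; last first.
  by move=> x xjs; apply: sub; rewrite inE xjs orbT.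
by rewrite subst_row_dmx // sub ?mem_head // addr0.
Qed.

End MultiplicationMatrices.

(** * Heights *)

Opaque subst_mx.

Lemma scalemx_inj (B : idomainType) p q (x : B) (X : 'M[B]_(p, q)) :
  x != 0 -> x *: X = 0 -> X = 0.
Proof.
move=> x0 /matrixP xX; apply/matrixP => i j; have /eqP := xX i j.
by rewrite !mxE mulf_eq0 (negPf x0) => /eqP.
Qed.

Section Heights.
Variables (k : fieldType) (n : nat).
Local Notation R := {mpoly k[n]}.
Local Notation A := {poly {poly k}}.
Variables (l s : n.-tuple R) (ls : coordinates l s) (i0 i1 : 'I_n).
Hypothesis (i01 : i0 != i1).
Local Notation a := (tnth l i0).
Local Notation b := (tnth l i1).
Variables (J : {pred R}) (m : nat) (v : 'I_m.+1 -> R) (dv : 'I_m.+1 -> nat).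
Hypotheses (homJ : homogeneous_ideal J) (freeJ : free_over a b J v dv).

Let idJ : is_ideal J. Proof. exact/idealr_is_ideal/(proj1 homJ). Qed.
Let ha : a \is 1.-homog. Proof. by case: ls. Qed.
Let hb : b \is 1.-homog. Proof. by case: ls. Qed.

Variables (T : 'I_n -> 'M[A]_m.+1) (TP : mult_mx l i0 i1 J v dv T).
Local Notation dmx := (dmx l i0 i1 T).
Local Notation tmx := (tmx l i0 i1 T).
Local Notation subst_mx := (subst_mx l s i0 i1 T).

(* Killing all coordinates but [l_j] maps [det (dmx j)] to a characteristic polynomial. *)
Lemma det_dmx_neq0 j : j != i0 -> j != i1 -> \det (dmx j) != 0.
Proof.
move=> j0 j1; pose h i : {poly k} := if i == j then 'X else 0.
have [||chi chiE] := @coord_ev_rmorph k n s {poly k} polyC h.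
- by move=> i i'; apply: mulrC.
- by move=> c x; apply: mulrC.
have chil i : chi (tnth l i) = h i by rewrite chiE (coord_evl ls).
have ha0 : h i0 = 0 by rewrite /h eq_sym (negPf j0).
have hb0 : h i1 = 0 by rewrite /h eq_sym (negPf j1).
have chiC c : chi c%:MP = c%:P by rewrite chiE coord_evC.
have /choice [t tE] : forall c, exists x, chi (biv a b c) = x%:P.
  elim/poly_ind => [|c d _]; first by exists 0; rewrite biv0 rmorph0.
  rewrite bivD bivM bivX rmorphD rmorphM chil hb0 mulr0 add0r.
  elim/poly_ind: d => [|d x _]; first by exists 0; rewrite biv0 rmorph0.
  exists x; rewrite polyCD polyCM bivD bivM bivXC bivC rmorphD rmorphM chil ha0 mulr0 add0r.
  exact: chiC.
have chij : chi (tnth l j) = 'X by rewrite chil /h eqxx.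
have E : map_mx chi (dmx j) = char_poly_mx (\matrix_(q, r) t (T j q r)).
  apply/matrixP => q r; rewrite !mxE rmorphB rmorphMn /= tE.
  by rewrite chij.
apply/eqP => d0; have := congr1 chi d0; rewrite rmorph0 -det_map_mx E.
by move/eqP; rewrite -[\det _]/(char_poly _) (negPf (monic_neq0 (char_poly_monic _))).
Qed.

Lemma dmx_inj j (u : 'rV[R]_m.+1) : j != i0 -> j != i1 -> u *m dmx j = 0 -> u = 0.
Proof.
move=> j0 j1 u0; have : \det (dmx j) *: u = 0.
  by rewrite -mul_mx_scalar -mul_mx_adj mulmxA u0 mul0mx.
exact/scalemx_inj/det_dmx_neq0.
Qed.

(** For interior [js] this is the annihilator of the quotient of R^(m+1) by the images of the
    [dmx j], [j] in [js], by [subst_ker_im_dmx]. *)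
Definition subst_ker js : {pred R} := [pred p | subst_mx js p == 0].

Lemma subst_kerP js p : reflect (subst_mx js p = 0) (p \in subst_ker js).
Proof. exact: eqP. Qed.

Lemma subst_ker_is_ideal js : is_ideal (subst_ker js).
Proof.
split=> [|x p q]; first by apply/subst_kerP; rewrite -(mpolyC0 n k) subst_mxC mpolyC0 scalar_mx0.
move=> /subst_kerP p0 /subst_kerP q0; apply/subst_kerP.
by rewrite subst_mxD (subst_mxM s homJ freeJ TP) p0 q0 mulmx0 addr0.
Qed.

Lemma subst_ker_im js p : subst_mx js p = 0 <->
  forall q, subst_row l s i0 i1 T js (p *: delta_mx 0 q) = 0.
Proof.
have E q : subst_row l s i0 i1 T js (p *: delta_mx 0 q) = row q (subst_mx js p).
  rewrite /subst_row (bigD1 q) //= big1 ?addr0 => [|r /negPf rq]; rewrite !mxE ?eqxx ?rq.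
    by rewrite mulr1.
  by rewrite mulr0 -(mpolyC0 n k) subst_mxC mpolyC0 scalar_mx0 linear0.
split=> [p0 q|p0]; first by rewrite E p0 linear0.
by apply/row_matrixP => q; rewrite -E p0 linear0.
Qed.

Lemma subst_ker_im_dmx js p : i0 \notin js -> i1 \notin js ->
  subst_mx js p = 0 <-> forall q, im_dmx l i0 i1 T js (p *: delta_mx 0 q).
Proof.
move=> h0 h1; rewrite subst_ker_im; split=> H q.
  exact: (subst_row_eq0 ls homJ freeJ TP (H q)).
exact: (subst_row_im ls homJ freeJ TP h0 h1 (H q)).
Qed.

Lemma im_dmx_J js u : im_dmx l i0 i1 T js u -> \sum_q u 0 q * v q \in J.
Proof.
elim: js u => [|j js IH] u /=.
  by move=> ->; rewrite big1 ?ideal0 // => q _; rewrite mxE mul0r.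
case=> w /IH; rewrite -(idealBr idJ (u := \sum_q u 0 q * v q)) //.
rewrite -sumrB.
have -> : \sum_q (u 0 q * v q - (u - w *m dmx j) 0 q * v q) =
    \sum_q w 0 q * (tnth l j * v q - \sum_r biv a b (T j q r) * v r).
  transitivity (\sum_r (\sum_q w 0 q * dmx j q r) * v r).
    by apply: eq_bigr => r _; rewrite !mxE mulrDl opprD addrA subrr add0r mulNr opprK.
  under eq_bigr do rewrite mulr_suml.
  rewrite exchange_big; apply: eq_bigr => q _ /=.
  under eq_bigr do rewrite -mulrA; rewrite -mulr_sumr; congr (_ * _).
  have dE r : dmx j q r = tnth l j *+ (q == r) - biv a b (T j q r) by rewrite !mxE.
  rewrite [LHS](eq_bigr (fun r => tnth l j *+ (q == r) * v r - biv a b (T j q r) * v r)); last first.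
    by move=> r _; rewrite dE mulrBl.
  rewrite sumrB; congr (_ - _); rewrite (bigD1 q) //= eqxx mulr1n big1 ?addr0 // => r.
  by rewrite eq_sym => /negPf ->; rewrite mulr0n mul0r.
by apply: ideal_sum => // q _; apply: idealM => //; case: TP.
Qed.

Definition interior := [seq j <- enum 'I_n | (j != i0) && (j != i1)].

Lemma size_interior : (size interior + 2 = n)%N.
Proof.
rewrite size_filter -[RHS](size_enum_ord n) -(count_predC [pred j | (j != i0) && (j != i1)]).
congr (_ + _)%N; rewrite -size_filter.
have /perm_size -> // : perm_eq [seq j <- enum 'I_n | predC [pred j | (j != i0) && (j != i1)] j] [:: i0; i1].
apply: uniq_perm; [exact/filter_uniq/enum_uniq | by rewrite /= inE i01 | ].
by move=> j; rewrite mem_filter mem_enum andbT !inE negb_and !negbK.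
Qed.

(* The kernels of the substitutions [l_j := T_j] for more and more interior [j] increase
   from 0 to [J]; [det (dmx j)] is regular modulo one of them and, by Cayley-Hamilton,
   lies in the next. *)
Lemma prime_above_chain (Q : {pred R}) : prime_ideal Q -> {subset J <= Q} ->
  exists C, prime_chain (@zero_ideal _) (n - 2) C /\ C (n - 2)%N = Q.
Proof.
move=> pQ JQ; pose g := size interior; have gE : (n - 2 = g)%N.
  by rewrite -[n]size_interior addnK.
(* The last [i] interior indices, so that passing from [js i] to [js i.+1] adds [jj i] at the
   head. *)
pose js i := drop (g - i) interior.
have intj j : j \in interior -> j != i0 /\ j != i1.
  by rewrite mem_filter => /andP [/andP []].
have js0 i : i0 \notin js i by apply/negP => /mem_drop /intj []; rewrite eqxx.
have js1 i : i1 \notin js i by apply/negP => /mem_drop /intj []; rewrite eqxx.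
pose jj i := nth i0 interior (g - i.+1).
have jsS i : (i < g)%N -> js i.+1 = jj i :: js i.
  move=> ig; rewrite /js (drop_nth i0); last by rewrite -/g; lia.
  by congr (_ :: drop _ _); lia.
have jjP i : (i < g)%N -> jj i != i0 /\ jj i != i1.
  by move=> ig; apply/intj/mem_nth; rewrite -/g; lia.
have jjn i : (i < g)%N -> jj i \notin js i.
  move=> ig; have : uniq (js i.+1) by apply/drop_uniq/filter_uniq/enum_uniq.
  by rewrite jsS //= => /andP [].
have [||||C [[LC pC sC] CQ]] := @prime_chain_of_nzd _ (fun i => subst_ker (js i))
    (fun i => \det (dmx (jj i))) g Q _ _ _ pQ.
- by move=> i _; apply: subst_ker_is_ideal.
- move=> i ig p /subst_kerP /(subst_ker_im_dmx _ (js0 i) (js1 i)) H; apply/subst_kerP.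
  apply/(subst_ker_im_dmx _ (js0 i.+1) (js1 i.+1)) => q.
  by rewrite jsS //; apply: im_dmx_cons.
- move=> i ig; have [j0 j1] := jjP i ig; split=> [|p].
    apply/subst_kerP/(subst_ker_im_dmx _ (js0 i.+1) (js1 i.+1)) => q.
    rewrite -mul_mx_scalar -mul_adj_mx mulmxA; apply: im_dmx_mem.
    by rewrite jsS // mem_head.
  move=> /subst_kerP; rewrite (subst_mxM s homJ freeJ TP).
  (* The index [jj i] is not in [js i], so the substitution leaves the determinant alone and it acts
     as a nonzero scalar. *)
  have -> : subst_mx (js i) (\det (dmx (jj i))) = (\det (dmx (jj i)))%:M.
    apply: (scalar_under_sum) => sg.
    apply: (scalar_underM homJ freeJ TP).
      rewrite -signr_odd; case: (odd _); rewrite ?expr0 ?expr1.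
        by rewrite -(mpolyC1 n k) -mpolyCN; apply: scalar_underC.
      by rewrite -(mpolyC1 n k); apply: scalar_underC.
    apply: (scalar_under_prod homJ freeJ TP) => q; rewrite !mxE.
    apply: (scalar_underD); last first.
      apply: (scalar_underN homJ freeJ TP).
      exact: (scalar_under_biv ls homJ freeJ TP).
    case: (_ == _); last by rewrite mulr0n -(mpolyC0 n k); apply: scalar_underC.
    by rewrite mulr1n; apply: (scalar_underl ls); rewrite ?jjn.
  rewrite mul_scalar_mx => /(scalemx_inj (det_dmx_neq0 j0 j1)) H.
  exact/subst_kerP.
- move=> p /subst_kerP /(subst_ker_im_dmx _ (js0 g) (js1 g)); rewrite /js subnn drop0 => H.
  (* What annihilates the quotient of R^(m+1) annihilates its image R / J. *)
  have pv q : p * v q \in J.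
    have := im_dmx_J (H q); rewrite (bigD1 q) //= big1 ?addr0 => [|r /negPf rq].
      by rewrite !mxE !eqxx mulr1.
    by rewrite !mxE rq andbF mulr0 mul0r.
  apply: JQ; case: freeJ => _ /(_ 1) [c cJ] _.
  rewrite -[p]mulr1 (idealBr idJ (v := p * \sum_q biv a b (c q) * v q)).
    by rewrite mulr_sumr; apply: ideal_sum => // q _; rewrite mulrCA; apply: idealM.
  by rewrite -mulrBr; apply: idealM.
exists C; rewrite gE; split=> //; split=> // p /eqP ->.
by apply: ideal0; apply/prime_is_ideal/pC.
Qed.
End Heights.

Lemma msize_homog (S : nzRingType) n d (p : {mpoly S[n]}) :
  p \is d.-homog -> (msize p <= d.+1)%N.
Proof.
move=> /dhomogP hp; rewrite msizeE; apply/bigmax_leqP_seq => j jp _.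
by rewrite ltnS (hp _ jp).
Qed.

Lemma zero_is_ideal (R : comNzRingType) : is_ideal (@zero_ideal R).
Proof.
split=> [|x p q]; rewrite ?inE ?eqxx //.
by move=> /eqP -> /eqP ->; rewrite mulr0 addr0.
Qed.

Section PolynomialRingGrowth.
Variables (k : fieldType) (n : nat).
Local Notation R := {mpoly k[n]}.

(** The monomials with every exponent at most M form a box of (M + 1)^n elements that contains all
    those of degree at most M. *)
Lemma zero_spanned_polynomially : @spanned_polynomially k n (@zero_ideal _) n.
Proof.
exists 1%N, 0%N => M; exists {ffun 'I_n -> 'I_M.+1}.
exists (fun e : {ffun 'I_n -> 'I_M.+1} => 'X_[[multinom (e i : nat) | i < n]]); split.
  by rewrite card_ffun !card_ord mul1n add0n.
move=> p szp; pose mon (e : {ffun 'I_n -> 'I_M.+1}) : 'X_{1..n} := [multinom (e i : nat) | i < n].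
exists (fun e => p@_(mon e)).
rewrite inE subr_eq0; apply/eqP/mpolyP => j; rewrite raddf_sum /=.
have [jM|jM] := boolP [forall i, (j i < M.+1)%N].
  move/forallP: jM => jM; pose e0 : {ffun 'I_n -> 'I_M.+1} := [ffun i => inord (j i)].
  have e0E : mon e0 = j by apply/mnmP => i; rewrite mnmE ffunE inordK.
  rewrite (bigD1 e0) //= big1 ?addr0 => [|e /negP ee0].
    by rewrite -/(mon e0) e0E mcoeffZ mcoeffX eqxx mulr1.
  rewrite -/(mon e) mcoeffZ mcoeffX; case: eqP => [ej|_]; last by rewrite mulr0.
  case: ee0; apply/eqP/ffunP => i; apply/val_inj.
  by rewrite ffunE /= inordK // -ej mnmE.
rewrite big1 => [|e _].
  apply: memN_msupp_eq0; apply: contra jM => /msize_mdeg_lt lt.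
  apply/forallP => i; rewrite ltnS; apply: leq_trans (leq_trans (ltnW lt) szp).
  by rewrite mdegE (bigD1 i) //= leq_addr.
rewrite -/(mon e) mcoeffZ mcoeffX; case: eqP => [ej|_]; last by rewrite mulr0.
by case/negP: jM; apply/forallP => i; rewrite -ej mnmE.
Qed.

End PolynomialRingGrowth.

Section IsHeight.
Variables (k : fieldType) (n : nat).
Local Notation R := {mpoly k[n]}.
Local Notation A := {poly {poly k}}.
Variables (l s : n.-tuple R) (ls : coordinates l s) (i0 i1 : 'I_n).
Hypothesis (i01 : i0 != i1).
Local Notation a := (tnth l i0).
Local Notation b := (tnth l i1).
Variables (J : {pred R}) (m : nat) (v : 'I_m.+1 -> R) (dv : 'I_m.+1 -> nat).
Hypotheses (homJ : homogeneous_ideal J) (freeJ : free_over a b J v dv).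

Let idJ : is_ideal J. Proof. exact/idealr_is_ideal/(proj1 homJ). Qed.
Let ha : a \is 1.-homog. Proof. by case: ls. Qed.
Let hb : b \is 1.-homog. Proof. by case: ls. Qed.

Lemma biv_inj_grows (Q : {pred R}) : (forall c, biv a b c \in Q -> c = 0) -> grows Q 2.
Proof.
(* Exponents up to N give size at most 2N + 1, whence the constant 3. *)
move=> injQ; exists 3 => N; exists ('I_N.+1 * 'I_N.+1)%type.
exists (fun x : 'I_N.+1 * 'I_N.+1 => a ^+ x.1 * b ^+ x.2); split.
- by rewrite card_prod !card_ord expnS expn1.
- case=> t u /=; have := msize_homog (dhomogM (dhomogMn t ha) (dhomogMn u hb)).
  by have := ltn_ord t; have := ltn_ord u; rewrite !mul1n => tN uN /leq_trans; apply; lia.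
- move=> c cQ; pose C : A := \sum_(x : 'I_N.+1 * 'I_N.+1) (c x *: 'X^(x.1))%:P * 'X^(x.2).
  have C0 : C = 0.
    apply: injQ; congr (_ \in Q): cQ; rewrite biv_sum; apply: eq_bigr => x _.
    by rewrite biv_mon.
  case=> t u; have := congr1 (fun p : A => p`_u`_t) C0.
  rewrite !coef0 !coef_sum (bigD1 (t, u)) //= big1 => [|[t' u'] /negP ne].
    by rewrite coefCM coefXn eqxx mulr1 coefZ coefXn eqxx mulr1 addr0.
  rewrite coefCM coefXn; case: eqP => [uu|_]; last by rewrite mulr0 coef0.
  rewrite mulr1 coefZ coefXn; case: eqP => [tt|_]; last by rewrite mulr0.
  by case: ne; apply/eqP; congr (_, _); apply/val_inj.
Qed.

(** A prime over [J] that misses every nonzero element of k[a, b] has growth at least 2, so a chain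
    of length h from 0 up to it gives growth h + 2 in n variables. *)
Lemma exists_minimal_prime : exists Q, [/\ prime_ideal Q, {subset J <= Q} &
  forall h C, prime_chain (@zero_ideal _) h C -> C h =i Q -> (h <= n - 2)%N].
Proof.
pose S x := exists2 c : A, c != 0 & x = biv a b c.
have [|||Q [pQ JQ SQ]] := @prime_avoiding _ J S idJ.
- by exists 1; [exact: oner_neq0 | rewrite /biv rmorph1].
- move=> _ _ [c c0 ->] [d d0 ->]; exists (c * d); last by rewrite bivM.
  by rewrite mulf_neq0.
- move=> _ [c c0 ->]; apply/negP => cJ; move/eqP: c0; apply.
  case: freeJ => _ _ indJ; pose e (q : 'I_m.+1) := if q == ord0 then c else 0.
  have := indJ e _ ord0; rewrite /e eqxx; apply.
  rewrite (bigD1 ord0) //= big1 ?addr0 => [|q /negPf ->]; last by rewrite biv0 mul0r.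
  exact: idealMr.
exists Q; split=> // h C chC ChQ.
have gQ : grows (C h) 2.
  apply: biv_inj_grows => c; rewrite ChQ => cQ.
  by apply/eqP; apply: contraT => c0; rewrite (negPf (SQ _ _)) // in cQ; exists c.
have := grows_leq (@zero_is_ideal _) (prime_chain_grows chC gQ) (zero_spanned_polynomially k n).
by lia.
Qed.

(** Every prime over [J] has a chain of length n - 2 below it, and one of them has none longer. *)
Lemma free_is_height : is_height J (n - 2).
Proof.
have [T TP] := exists_mult_mx ls homJ freeJ.
have chain Q : prime_ideal Q -> {subset J <= Q} ->
    exists C, prime_chain (@zero_ideal _) (n - 2) C /\ C (n - 2)%N = Q.
  exact: (prime_above_chain ls i01 homJ freeJ TP).
have [Q [pQ JQ maxQ]] := exists_minimal_prime; split.
  exists Q; split=> //; split; last exact: maxQ.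
  by have [C [chC <-]] := chain Q pQ JQ; exists C.
move=> P g' pP JP [_ maxP]; have [C [chC CP]] := chain P pP JP.
by apply: (maxP _ C) => //; rewrite CP.
Qed.

End IsHeight.

(** * Iterated mapping cones *)

Section Cone.
Variables (k : fieldType) (n : nat).
Local Notation R := {mpoly k[n]}.

Definition endo (C : graded_free_seq k n) := forall j, 'M[R]_(rk C j).

Section Construction.
Variables (C : graded_free_seq k n) (F : endo C).

Definition cone_rk j := if j is j'.+1 then (rk C j'.+1 + rk C j')%N else rk C 0.

(** The second summand is twisted by -1, because [F] raises degrees by one, see [homog_endo]. *)
Definition cone_sh j : 'I_(cone_rk j) -> nat :=
  match j with
  | 0 => @sh k n C 0
  | j'.+1 => fun i => match split i with inl x => sh x | inr y => (sh y).+1 end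
  end.

Definition cone_dif j : 'M[R]_(cone_rk j.+1, cone_rk j) :=
  match j with
  | 0 => col_mx (dif C 0) (F 0)
  | j'.+1 => block_mx (dif C j'.+1) 0 (F j'.+1) (- dif C j')
  end.

Definition cone : graded_free_seq k n := @GradedFreeSeq k n cone_rk cone_sh (aug C) cone_dif.

(** The intended [E] commute with [F] exactly, not merely up to homotopy, so they extend
    diagonally. *)
Definition cone_endo (E : endo C) : endo cone := fun j =>
  match j with
  | 0 => E 0%N
  | j'.+1 => block_mx (E j'.+1) 0 0 (E j')
  end.

End Construction.

Definition chain_endo C (E : endo C) : Prop :=
  forall j, E j.+1 *m dif C j = dif C j *m E j.

Definition homog_endo C (E : endo C) : Prop :=
  forall j p q, twisted_homog (sh q) (sh p).+1 (E j p q).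

Definition comm_endo C (E F : endo C) : Prop := forall j, E j *m F j = F j *m E j.

Definition homog_seq (C : graded_free_seq k n) : Prop :=
  forall j p q, twisted_homog (sh q) (sh p) (dif C j p q).

Definition exact_seq (C : graded_free_seq k n) : Prop :=
  forall j (u : 'rV[R]_(rk C j.+1)), u *m dif C j = 0 <-> exists v, u = v *m dif C j.+1.

Definition im0 (C : graded_free_seq k n) (u : 'rV[R]_(rk C 0)) : Prop :=
  exists v, u = v *m dif C 0.

Lemma twistedSS x y (p : R) : twisted_homog x.+1 y.+1 p = twisted_homog x y p.
Proof. by rewrite /twisted_homog ltnS subSS. Qed.

Lemma twisted0 x y : twisted_homog x y (0 : R).
Proof. by rewrite /twisted_homog eqxx rpred0 if_same. Qed.

Lemma twistedN x y (p : R) : twisted_homog x y (- p) = twisted_homog x y p.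
Proof. by rewrite /twisted_homog rpredN oppr_eq0. Qed.

Lemma twistedD x y (p q : R) : twisted_homog x y p -> twisted_homog x y q ->
  twisted_homog x y (p + q).
Proof.
by rewrite /twisted_homog; case: leqP => _; [exact: rpredD | move=> /eqP -> /eqP ->; rewrite addr0].
Qed.

Lemma cone_homog C (F : endo C) : homog_seq C -> homog_endo F -> homog_seq (cone F).
Proof.
move=> hC hF [|j] p q /=.
  by rewrite mxE; case: (split p) => x; [exact: hC | exact: hF].
rewrite !mxE; case: (split p) => x; rewrite mxE; case: (split q) => y.
- exact: hC.
- by rewrite mxE; apply: twisted0.
- exact: hF.
- by rewrite mxE twistedSS twistedN; apply: hC.
Qed.

Lemma cone_endo_homog C (F E : endo C) : homog_endo E -> homog_endo (cone_endo F E).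
Proof.
move=> hE [|j] p q /=; first exact: hE.
rewrite !mxE; case: (split p) => x; rewrite mxE; case: (split q) => y;
  rewrite ?mxE ?twisted0 ?twistedSS //; exact: hE.
Qed.

Lemma cone_endo_chain C (F E : endo C) : chain_endo E -> comm_endo E F ->
  chain_endo (cone_endo F E).
Proof.
move=> cE EF [|j] /=.
  rewrite mul_block_col mul_col_mx !mul0mx addr0 add0r cE.
  by congr (col_mx _ _); apply: EF.
rewrite !mulmx_block !mul0mx !mulmx0 !addr0 !add0r cE EF.
by rewrite mulmxN mulNmx cE.
Qed.

Lemma cone_endo_comm C (F E E' : endo C) : comm_endo E E' ->
  comm_endo (cone_endo F E) (cone_endo F E').
Proof.
move=> EE' [|j] /=; first exact: EE'.
by rewrite !mulmx_block !mul0mx !mulmx0 !addr0 !add0r !EE'.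
Qed.

Lemma exact_dif2 C j (u : 'rV[R]_(rk C j.+2)) : exact_seq C ->
  u *m dif C j.+1 *m dif C j = 0.
Proof. by move=> exC; apply/exC; exists u. Qed.

(** In the long exact sequence of the cone, the only homology that could appear in positive degree
    is the kernel of [F] on H_0(C), which the last hypothesis makes 0. *)
Lemma cone_exact C (F : endo C) : exact_seq C -> chain_endo F ->
  (forall u, im0 (u *m F 0%N) -> im0 u) -> exact_seq (cone F).
Proof.
move=> exC cF regF [|j] u.
  rewrite /= -[u]hsubmxK; move: (lsubmx u) (rsubmx u) => x y.
  rewrite mul_row_col; split=> [xy|[w]].
    have [y0 yE] : im0 y.
      apply: regF; exists (- x); rewrite mulNmx; apply/eqP.
      by rewrite -addr_eq0 addrC xy.
    have /exC [x' xE] : (x + y0 *m F 1%N) *m dif C 0 = 0.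
      by rewrite mulmxDl -mulmxA cF mulmxA -yE.
    exists (row_mx x' (- y0)); rewrite mul_row_block mulmx0 add0r !mulNmx mulmxN opprK -yE.
    by rewrite -xE addrK.
  rewrite -[w]hsubmxK; move: (lsubmx w) (rsubmx w) => x' y'.
  rewrite mul_row_block mulmx0 add0r => /eq_row_mx [-> ->].
  by rewrite mulmxDl exact_dif2 // add0r -mulmxA cF mulmxN mulNmx mulmxA addrN.
rewrite /= -[u]hsubmxK; move: (lsubmx u) (rsubmx u) => x y.
rewrite mul_row_block mulmx0 add0r -(@row_mx0 _ 1); split=> [|[w]].
  case/eq_row_mx => xy /eqP; rewrite mulmxN oppr_eq0 => /eqP /exC [y0 yE].
  have /exC [x' xE] : (x + y0 *m F j.+2) *m dif C j.+1 = 0.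
    by rewrite mulmxDl -mulmxA cF mulmxA -yE.
  exists (row_mx x' (- y0)); rewrite mul_row_block mulmx0 add0r !mulNmx mulmxN opprK -yE.
  by rewrite -xE addrK.
rewrite -[w]hsubmxK; move: (lsubmx w) (rsubmx w) => x' y'.
rewrite mul_row_block mulmx0 add0r => /eq_row_mx [-> ->].
congr row_mx.
  by rewrite mulmxDl exact_dif2 // add0r -mulmxA cF mulmxN mulNmx mulmxA addrN.
by rewrite !mulmxN mulNmx opprK exact_dif2.
Qed.

Lemma cone_im0 C (F : endo C) (u : 'rV[R]_(rk C 0)) :
  im0 (C := cone F) u <-> exists w, im0 (u - w *m F 0%N).
Proof.
split=> [[v]|[w [x xE]]].
  rewrite /= -[v]hsubmxK mul_row_col => ->; exists (rsubmx v), (lsubmx v).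
  by rewrite addrK.
by exists (row_mx x w); rewrite /= mul_row_col -xE subrK.
Qed.

Section Iterate.
Variable (I : eqType).

(* The submodule of the first term generated by [B] and the images of the [E j], [j \in js]. *)
Fixpoint add_ims C (E : I -> endo C) js (B : 'rV[R]_(rk C 0) -> Prop) : 'rV[R]_(rk C 0) -> Prop :=
  if js is j :: js' then add_ims E js' (fun u => exists w, B (u - w *m E j 0%N)) else B.

Fixpoint regular_on C (E : I -> endo C) js (B : 'rV[R]_(rk C 0) -> Prop) : Prop :=
  if js is j :: js' then
    (forall u, B (u *m E j 0%N) -> B u) /\
    regular_on E js' (fun u => exists w, B (u - w *m E j 0%N))
  else True.

(** The cycle is carried along as [row_mx 0 z]: each cone raises its homological and internal
    degrees by one, and it stays a cycle because the endomorphisms kill it over k. It always sits in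
    the top homological degree, so it is never a boundary. *)
Lemma iterated_cone_Tor J js C (E : I -> endo C) t (z : 'rV[k]_(rk C t)) e :
    (forall q, aug C q 0 \is (@sh k n C 0 q).-homog) -> homog_seq C -> exact_seq C ->
    (exists u : 'rV[R]_(rk C 0), (u *m aug C) 0 0 - 1 \in J) ->
    (forall u : 'rV[R]_(rk C 0), (u *m aug C) 0 0 \in J <-> add_ims E js (im0 (C := C)) u) ->
    (forall j, homog_endo (E j)) -> (forall j, chain_endo (E j)) ->
    (forall i j, comm_endo (E i) (E j)) -> regular_on E js (im0 (C := C)) ->
    (forall i, (t < i)%N -> rk C i = 0%N) -> z != 0 -> (forall q, z 0 q != 0 -> @sh k n C t q = e) -> @is_cycle_k k n C t z ->
    (forall j, j \in js -> z *m map_mx (mcoeff 0%MM) (E j t) = 0) ->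
  Tor_k_neq0 J (t + size js) (e + size js).
Proof.
elim: js C E t z e => [|j js IH] C E t z e haug hC exC surj ker hE cE EE reg rk0 z0 hz cz zE.
  rewrite !addn0; exists C; first by split=> //; split.
  exists z; split=> // [[w wE]]; case/eqP: z0; rewrite wE.
  by move: (dif_k C t) w {wE}; rewrite rk0 // => X w; rewrite [w]thinmx0 mul0mx.
rewrite -!addSnnS.
have imE : im0 (C := cone (E j)) = fun u => exists w, im0 (C := C) (u - w *m E j 0%N).
  by apply/funext => u; apply/propext; exact (cone_im0 (E j) u).
have addE js' B : add_ims (C := cone (E j)) (fun i => cone_endo (E j) (E i)) js' B =
    add_ims E js' B by elim: js' B => //= i js' IH' B; rewrite IH'.
have regE js' B : regular_on (C := cone (E j)) (fun i => cone_endo (E j) (E i)) js' B =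
    regular_on E js' B by elim: js' B => //= i js' IH' B; rewrite IH'.
case: reg => regj reg.
apply: (IH (cone (E j)) (fun i => cone_endo (E j) (E i)) t.+1 (row_mx 0 z)).
- exact: haug.
- exact: cone_homog.
- exact: cone_exact.
- exact: surj.
- by move=> u; rewrite addE imE; apply: ker.
- by move=> i; apply: cone_endo_homog.
- by move=> i; apply: cone_endo_chain.
- by move=> i i'; apply: cone_endo_comm.
- by rewrite regE imE.
- by case=> // i ti /=; rewrite !rk0 // ltnW.
- apply: contra z0 => /eqP; rewrite -(@row_mx0 _ 1) => /eq_row_mx [_ ->]; exact: eqxx.
- move=> q /=; rewrite mxE; case: (split q) => x; rewrite ?mxE ?eqxx //.
  by move/hz ->.
- have zF : z *m map_mx (mcoeff 0%MM) (E j t) = 0 by apply: zE; rewrite mem_head.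
  rewrite /= /dif_k /=; case: (t) z zF cz {z0 hz zE rk0} => [|t'] z zF cz /=.
    by rewrite map_col_mx mul_row_col mul0mx add0r.
  rewrite map_block_mx mul_row_block !mul0mx !add0r zF map_mxN mulmxN.
  by rewrite [z *m _]cz oppr0 row_mx0.
- move=> i ijs /=; have zi : z *m map_mx (mcoeff 0%MM) (E i t) = 0.
    by apply: zE; rewrite inE ijs orbT.
  by rewrite map_block_mx mul_row_block !mul0mx !add0r zi map_mx0 mulmx0 row_mx0.
Qed.

End Iterate.
End Cone.

(** * A Koszul resolution of R / J and a nonzero Tor class *)

Section TorOfFree.
Variables (k : fieldType) (n : nat).
Local Notation R := {mpoly k[n]}.
Local Notation A := {poly {poly k}}.
Variables (l s : n.-tuple R) (ls : coordinates l s) (i0 i1 : 'I_n).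
Hypothesis (i01 : i0 != i1).
Local Notation a := (tnth l i0).
Local Notation b := (tnth l i1).
Variables (J : {pred R}) (m : nat) (v : 'I_m.+1 -> R) (dv : 'I_m.+1 -> nat).
Hypotheses (homJ : homogeneous_ideal J) (freeJ : free_over a b J v dv).

Let idJ : is_ideal J. Proof. exact/idealr_is_ideal/(proj1 homJ). Qed.

Definition seq0_rk j := if j is 0 then m.+1 else 0%N.

Definition seq0_sh j : 'I_(seq0_rk j) -> nat :=
  match j with 0 => dv | _.+1 => fun=> 0%N end.

(** The free module R^(m+1) alone in degree 0; successive cones over the [dmx j] turn it into the
    Koszul complex. *)
Definition seq0 : graded_free_seq k n :=
  @GradedFreeSeq k n seq0_rk seq0_sh (\col_q v q) (fun j => 0).

Variables (T : 'I_n -> 'M[A]_m.+1) (TP : mult_mx l i0 i1 J v dv T).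
Local Notation dmx := (dmx l i0 i1 T).
Local Notation im_dmx := (im_dmx l i0 i1 T).
Local Notation intr := (interior i0 i1).

Definition dmx_endo (i : 'I_n) : endo seq0 := fun j =>
  match j with 0 => dmx i | _.+1 => 0 end.

Lemma add_ims_dmx js ds : add_ims dmx_endo js (im_dmx ds) = im_dmx (catrev js ds).
Proof. by elim: js ds => //= j js IH ds; rewrite -IH. Qed.

(** Here [ds] holds the indices already used. Through [subst_row] the quotient by their images
    embeds in R^(m+1), where [dmx j] acts injectively. *)
Lemma regular_on_dmx js ds : uniq (js ++ ds) -> {subset js ++ ds <= intr} ->
  regular_on dmx_endo js (im_dmx ds).
Proof.
elim: js ds => //= j js IH ds /andP [jn un] sub.
have sub' x : x \in js ++ ds -> x \in intr by move=> h; apply: sub; rewrite inE h orbT.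
have nin i : i \notin intr -> i \notin ds.
  by apply: contra => h; apply: sub'; rewrite mem_cat h orbT.
have h0 : i0 \notin ds by apply: nin; rewrite mem_filter eqxx.
have h1 : i1 \notin ds by apply: nin; rewrite mem_filter eqxx andbF.
have jds : j \notin ds by apply: contra jn; rewrite mem_cat => ->; rewrite orbT.
have : j \in intr by apply: sub; rewrite mem_head.
rewrite mem_filter => /andP [/andP [j0 j1] _].
split=> [u imu|].
  have := subst_row_im ls homJ freeJ TP h0 h1 imu.
  rewrite (subst_row_dmx ls homJ freeJ TP) // (negPf jds) => /(dmx_inj ls j0 j1).
  exact: (subst_row_eq0 ls homJ freeJ TP).
apply: (IH (j :: ds)).
  rewrite -cat_rcons cat_uniq; move: un jn; rewrite cat_uniq mem_cat negb_or.
  case/and3P => u1 u2 u3 /andP [jjs jds'].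
  rewrite rcons_uniq jjs u1 /= u3 andbT; apply: contra u2 => /hasP [x xds].
  rewrite mem_rcons inE => /orP [/eqP xj|xjs]; first by rewrite xj (negPf jds) in xds.
  by apply/hasP; exists x.
move=> x; rewrite mem_cat inE orbCA -mem_cat => /orP [/eqP ->|]; last exact: sub'.
by apply: sub; rewrite mem_head.
Qed.

(** Once all interior coordinates are replaced, only [a] and [b] are left. *)
Lemma full_subst_row_biv js u : {subset intr <= js} ->
  exists c, forall q, subst_row l s i0 i1 T js u 0 q = biv a b (c q).
Proof.
move=> sub; suff H q : exists c, subst_row l s i0 i1 T js u 0 q = biv a b c.
  by have /choice [c cE] := H; exists c.
have mxP p : exists X, subst_mx l s i0 i1 T js p = map_mx (biv a b) X.
  elim/(coord_ind ls): p => [c|i|p p' [X XE] [Y YE]|p p' [X XE] [Y YE]].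
  - by exists (c%:P%:P)%:M; rewrite subst_mxC map_scalar_mx /= bivC.
  - rewrite (subst_mxl ls) /subst_val; case: ifP => [_|ijs]; first by exists (T i).
    have : i \notin intr by apply/negP => /sub; rewrite ijs.
    rewrite mem_filter mem_enum andbT negb_and !negbK.
    case/orP => /eqP ->; [exists ('X%:P)%:M | exists 'X%:M];
      by rewrite map_scalar_mx /= ?bivXC ?bivX.
  - by exists (X + Y); rewrite subst_mxD XE YE map_mxD.
  - by exists (X *m Y); rewrite (subst_mxM s homJ freeJ TP) XE YE map_mxM.
have /choice [X XE] := fun r => mxP (u 0 r).
exists (\sum_r X r r q); rewrite /subst_row summxE biv_sum; apply: eq_bigr => r _.
by rewrite XE !mxE.
Qed.

(** Modulo the images, [u] equals its normal form, whose entries are in k[a, b]; if [u] maps into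
    [J], freeness makes that normal form 0. *)
Lemma seq0_ker (u : 'rV[R]_m.+1) js : js =i intr ->
  (\sum_q u 0 q * v q \in J) <-> im_dmx js u.
Proof.
move=> jsE; split=> [uJ|]; last exact: (im_dmx_J homJ TP).
have h0 : i0 \notin js by rewrite jsE mem_filter eqxx.
have h1 : i1 \notin js by rewrite jsE mem_filter eqxx andbF.
apply: (subst_row_eq0 ls homJ freeJ TP).
have [|c cE] := @full_subst_row_biv js u; first by move=> x; rewrite jsE.
pose w := subst_row l s i0 i1 T js u.
have : \sum_q biv a b (c q) * v q \in J.
  have -> : \sum_q biv a b (c q) * v q = \sum_q u 0 q * v q - \sum_q (u - w) 0 q * v q.
    by rewrite -sumrB; apply: eq_bigr => q _; rewrite -cE !mxE -/w mulrBl opprB addrC subrK.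
  apply: idealB => //; apply: (im_dmx_J homJ TP).
  rewrite /w subst_rowE [X in X - _](row_sum_scalar u) -sumrB.
  apply: (big_ind (im_dmx js)) => [||q _]; [exact: im_dmx0 | exact: im_dmxD | ].
  by rewrite -mulmxBr; apply: (im_sub_subst_mx ls homJ freeJ TP).
case: freeJ => _ _ indJ /indJ c0; apply/rowP => q.
by rewrite cE c0 biv0 mxE.
Qed.

(** If the interior coordinates kill [v q0] in R / J, row [q0] of each interior [T j] is 0, so row
    [q0] of [dmx j] has no constant term: the basis vector [q0] is killed over k by all Koszul
    operators. *)
Lemma Tor_socle q0 : (forall j, j \in intr -> tnth l j * v q0 \in J) ->
  Tor_k_neq0 J (n - 2) (dv q0 + (n - 2)).
Proof.
move=> soc; have szi : (n - 2)%N = size intr by have := size_interior i01; lia.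
rewrite szi -[X in Tor_k_neq0 J X]add0n.
have im0E : im0 (C := seq0) = im_dmx [::].
  apply/funext => u; apply/propext; split=> [[x ->] //=|/= ->]; first by rewrite mulmx0.
  by exists 0; rewrite mul0mx.
apply: (@iterated_cone_Tor _ _ _ J intr seq0 dmx_endo 0 (delta_mx 0 q0)).
- by move=> q /=; rewrite mxE; case: freeJ.
- by move=> j p q /=; rewrite mxE; apply: twisted0.
- move=> j u; split=> [_|_]; last by rewrite mulmx0.
  by exists 0; rewrite mul0mx [u]thinmx0.
- case: freeJ => _ /(_ 1) [c cJ] _; exists (\row_q biv a b (c q)).
  rewrite mxE; move/(idealN idJ): cJ; rewrite opprB; congr (_ - _ \in J).
  by apply: eq_bigr => q _; rewrite !mxE.
- move=> u; rewrite im0E add_ims_dmx -seq0_ker; last first.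
    by move=> x; rewrite catrevE cats0 mem_rev.
  by rewrite mxE; under eq_bigr do rewrite mxE.
- move=> i [|j] p q /=; last by rewrite mxE; apply: twisted0.
  case: TP => _ hT; rewrite !mxE; apply: twistedD; last by rewrite twistedN; apply: hT.
  case: (eqVneq p q) => [->|_]; last exact: twisted0.
  by rewrite mulr1n /twisted_homog leqnSn subSnn; case: ls.
- by move=> i j /=; rewrite mulmx0 mul0mx.
- by move=> i j [|t] /=; [apply: (dmxC homJ freeJ TP) | rewrite mul0mx].
- rewrite im0E; apply: regular_on_dmx; rewrite cats0 //.
  exact/filter_uniq/enum_uniq.
- by case.
- apply/eqP => /matrixP /(_ 0 q0) /eqP; rewrite !mxE !eqxx; exact/negP/oner_neq0.
- by move=> q; rewrite mxE eqxx; case: (eqVneq q q0) => [-> //|_]; rewrite eqxx.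
- by [].
- move=> j jint /=; rewrite -rowE; apply/rowP => r; rewrite !mxE.
  have T0 : T j q0 r = 0.
    case: freeJ => _ _ indJ; case: TP => /(_ j q0) TJ _.
    by apply: (indJ (T j q0)); rewrite -(idealBr idJ TJ); apply: soc.
  have lj0 : (tnth l j)@_0%MM = 0.
    by apply: (@dhomog_nemf_coeff _ _ mdeg 1); [case: ls | rewrite mf0].
  by rewrite T0 biv0 subr0 mcoeffMn lj0 mul0rn.
Qed.

End TorOfFree.

(** * Adding a codimension-one component *)

Lemma comp_mpoly_sum (S : nzRingType) n n' (t : n.-tuple {mpoly S[n']}) I (r : seq I) P
    (E : I -> {mpoly S[n]}) :
  (\sum_(i <- r | P i) E i) \mPo t = \sum_(i <- r | P i) (E i \mPo t).
Proof. exact: raddf_sum. Qed.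

Lemma comp_mpoly_homog (k : fieldType) n n' (t : n.-tuple {mpoly k[n']}) e d p :
  (forall i, tnth t i \is e.-homog) -> p \is d.-homog -> p \mPo t \is (e * d).-homog.
Proof.
move=> ht /dhomogP hp; rewrite comp_mpolyEX big_seq; apply: rpred_sum => j jp.
apply: rpredZ; rewrite comp_mpolyX; have <- : mdeg j = d := hp j jp; rewrite mdegE.
rewrite big_distrr; elim/big_rec2: _ => [|i d' q _ hq]; first exact: dhomog1.
by apply: dhomogM => //; apply: dhomogMn.
Qed.

Lemma pihomog_comp_mpoly (k : fieldType) n n' (t : n.-tuple {mpoly k[n']}) e d p :
  (0 < e)%N -> (forall i, tnth t i \is e.-homog) ->
  pihomog mdeg (e * d) (p \mPo t) = pihomog mdeg d p \mPo t.
Proof.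
move=> e0 ht.
rewrite [p in LHS](pihomog_partitionE (leqnn (msize p))) comp_mpoly_sum pihomog_sum.
rewrite [p in RHS](pihomog_partitionE (leqnn (msize p))) pihomog_sum comp_mpoly_sum.
apply: eq_bigr => i _; have hi := pihomogP mdeg i p.
have [<-|ne] := eqVneq (nat_of_ord i) d.
  by rewrite [in RHS]pihomog_id pihomog_dE //; apply: comp_mpoly_homog.
rewrite (pihomog_ne0 ne hi) comp_mpoly0 (@pihomog_ne0 _ _ mdeg (e * i)%N) //.
  by rewrite eqn_pmul2l.
exact: comp_mpoly_homog.
Qed.

Section MaximalMultiplicity.
Variables (k : fieldType) (n : nat).
Local Notation R := {mpoly k[n]}.
Local Notation A := {poly {poly k}}.
Variables (l s : n.-tuple R) (ls : coordinates l s) (i0 i1 : 'I_n).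
Hypothesis (i01 : i0 != i1).
Local Notation a := (tnth l i0).
Local Notation b := (tnth l i1).

Definition edge_tuple : n.-tuple R :=
  [tuple if (i == i0) || (i == i1) then tnth l i else 0 | i < n].

(* A retraction onto k[a, b] whose kernel is generated by the other coordinates. *)
Definition edge_proj (p : R) : R := (p \mPo s) \mPo edge_tuple.

Lemma edge_projM p q : edge_proj (p * q) = edge_proj p * edge_proj q.
Proof. by rewrite /edge_proj !rmorphM. Qed.

Lemma edge_projD p q : edge_proj (p + q) = edge_proj p + edge_proj q.
Proof. by rewrite /edge_proj !comp_mpolyD. Qed.

Lemma edge_projB p q : edge_proj (p - q) = edge_proj p - edge_proj q.
Proof. by rewrite /edge_proj !comp_mpolyB. Qed.

Lemma edge_projC c : edge_proj c%:MP = c%:MP.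
Proof. by rewrite /edge_proj !comp_mpolyC. Qed.

Lemma edge_projl i : edge_proj (tnth l i) = if (i == i0) || (i == i1) then tnth l i else 0.
Proof.
by case: ls => _ _ _ ls'; rewrite /edge_proj ls' comp_mpolyXU -tnth_nth tnth_mktuple.
Qed.

Lemma edge_proj_biv c : edge_proj (biv a b c) = biv a b c.
Proof.
elim/poly_ind: c => [|c d IH]; first by rewrite biv0 -(mpolyC0 n k) edge_projC.
rewrite bivD bivM bivX edge_projD edge_projM IH edge_projl eqxx orbT; congr (_ + _).
elim/poly_ind: d => [|d x IH']; first by rewrite biv0 -(mpolyC0 n k) edge_projC.
rewrite polyCD polyCM bivD bivM bivXC bivC edge_projD edge_projM IH' edge_projl eqxx.
by rewrite edge_projC.
Qed.

Lemma edge_proj_homog d p : pihomog mdeg d (edge_proj p) = edge_proj (pihomog mdeg d p).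
Proof.
case: ls => hl hs _ _; rewrite /edge_proj -[d in LHS]mul1n pihomog_comp_mpoly // => [|i].
  by rewrite -[d in LHS]mul1n pihomog_comp_mpoly.
by rewrite tnth_mktuple; case: ifP => _; rewrite ?rpred0.
Qed.

Variables (I : {pred R}) (m : nat) (v : 'I_m.+1 -> R) (dv : 'I_m.+1 -> nat).
Hypotheses (homI : homogeneous_ideal I) (freeI : free_over a b I v dv).
Variables (F : R) (f : nat).
Hypotheses (FI : F \in I) (hF : F \is f.-homog) (F0 : edge_proj F != 0).
Hypothesis (IF : forall p, p \in I -> exists c, edge_proj p = biv a b c * edge_proj F).

Let idI : is_ideal I. Proof. exact/idealr_is_ideal/(proj1 homI). Qed.

Definition residual : {pred R} := [pred p | (p \in I) && (edge_proj p == 0)].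
Local Notation J := residual.

Lemma residualP p : reflect (p \in I /\ edge_proj p = 0) (p \in J).
Proof. by apply: (iffP andP) => [[-> /eqP]|[-> /eqP]]. Qed.

Lemma residual_homogeneous : homogeneous_ideal J.
Proof.
have [[I0 I1 idI'] hI] := homI; split; first split.
- by apply/residualP; split=> //; rewrite -(mpolyC0 n k) edge_projC.
- by apply: contra I1 => /residualP [].
- move=> x p q /residualP [pI p0] /residualP [qI q0]; apply/residualP; split.
    exact: idI'.
  by rewrite edge_projD edge_projM p0 q0 mulr0 addr0.
- move=> p d /residualP [pI p0]; apply/residualP; split; first exact: hI.
  by rewrite -edge_proj_homog p0 pihomog0.
Qed.

(** [edge_proj] is the identity on k[a, b], so the factor [c] found for the projections serves for
    [F] itself. *)
Lemma residual_adjoin p : p \in I -> exists c, p - biv a b c * F \in J.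
Proof.
move=> pI; have [c cE] := IF pI; exists c; apply/residualP; split.
  by apply: idealB => //; apply: idealM.
by rewrite edge_projB edge_projM edge_proj_biv cE subrr.
Qed.

Definition residual_basis (i : 'I_m.+2) : R := if unlift ord0 i is Some j then v j else F.
Definition residual_degree (i : 'I_m.+2) : nat := if unlift ord0 i is Some j then dv j else f.

Lemma residual_sum (c : 'I_m.+2 -> A) :
  \sum_i biv a b (c i) * residual_basis i =
  biv a b (c ord0) * F + \sum_j biv a b (c (lift ord0 j)) * v j.
Proof.
rewrite big_ord_recl /residual_basis unlift_none; congr (_ + _).
by apply: eq_bigr => j _; rewrite liftK.
Qed.

(** A relation is first read modulo [I], which contains [F]: the coefficients of the [v j] vanish.
    The projection then leaves a product in a domain with the nonzero factor [edge_proj F]. *)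
Lemma residual_free : free_over a b J residual_basis residual_degree.
Proof.
have [hv spanI indI] := freeI; split=> [q|p|c].
- by rewrite /residual_basis /residual_degree; case: (unlift ord0 q).
- have [c cI] := spanI p; have [c0 c0J] := residual_adjoin cI.
  exists (fun i => if unlift ord0 i is Some j then c j else c0).
  rewrite residual_sum unlift_none; under eq_bigr do rewrite liftK.
  by move: c0J; rewrite -addrA -opprD addrC [X in p - X]addrC addrC.
- rewrite residual_sum => /residualP [cI c0].
  have cl : forall j, c (lift ord0 j) = 0.
    by apply: indI; rewrite -(idealDr idI _ (idealM idI (biv a b (c ord0)) FI)).
  move: c0; rewrite big1 => [|j _]; last by rewrite cl biv0 mul0r.
  rewrite addr0 edge_projM edge_proj_biv => /eqP; rewrite mulf_eq0 (negPf F0) orbF => /eqP c0.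
  move=> i; case: (unliftP ord0 i) => [j ->|->]; first exact: cl.
  (* [biv a b] is injective: an element of its kernel annihilates [v ord0] modulo [I]. *)
  pose e (q : 'I_m.+1) := if q == ord0 then c ord0 else 0.
  have := indI e _ ord0; rewrite /e eqxx; apply.
  rewrite big1 => [|q _]; first exact: ideal0.
  by case: ifP => _; rewrite ?biv0 ?c0 mul0r.
Qed.

Lemma maximal_multiplicity_of_free : maximal_multiplicity I.
Proof.
have hl : forall i, tnth l i \is 1.-homog by case: ls.
have homJ := residual_homogeneous; have freeJ := residual_free.
have idJ : is_ideal J by exact/idealr_is_ideal/(proj1 homJ).
split=> //; exists J, F, f; split.
- by split=> //; apply: (free_cohen_macaulay (hl i0) (hl i1) homJ freeJ).
- by split=> //; apply/residualP => [[_ /eqP]]; rewrite (negPf F0).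
- move=> p; apply/idP/idP => [pI|].
    by have [c cJ] := residual_adjoin pI; apply/ideal_adjoin1P; exists (biv a b c).
  apply: ideal_adjoin_least => // [x /residualP []//|x].
  by rewrite inE => /eqP ->.
- by exists (n - 2)%N; split; [exact: (free_is_height ls i01 homI freeI) |
                               exact: (free_is_height ls i01 homJ freeJ)].
have [T TP] := exists_mult_mx ls homJ freeJ.
(* Interior coordinates times [F] lie in [I] and project to 0, hence lie in [J], so [Tor_socle]
   applies to the basis element [F]. *)
have tor : Tor_k_neq0 J (n - 2) (f + (n - 2)).
  have := @Tor_socle _ _ _ _ ls _ _ i01 _ _ _ _ homJ freeJ T TP ord0.
  rewrite /residual_degree /residual_basis unlift_none; apply=> j.
  rewrite mem_filter => /andP [/andP [j0 j1] _]; apply/residualP; split.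
    exact: idealM.
  by rewrite edge_projM edge_projl (negPf j0) (negPf j1) mul0r.
(* The least degree with nonzero Tor defines s, and the class of [F] bounds it by f + (n - 2); thus
   s - f + 1 is at most 1. *)
have exi : exists i, `[< Tor_k_neq0 J (n - 2) i >] by exists (f + (n - 2))%N; apply/asboolP.
case: (ex_minnP exi) => i /asboolP tori mini.
exists m.+1, m.+2, (i%:Z - (n - 2)%:Z); split.
- exact: (free_multiplicity (hl i0) (hl i1) homI freeI).
- exact: (free_multiplicity (hl i0) (hl i1) homJ freeJ).
- exists (n - 2)%N, i; split=> //; first exact: (free_is_height ls i01 homJ freeJ).
  by move=> i' /asboolP /mini.
- have le : (i <= f + (n - 2))%N by apply/mini/asboolP.
  rewrite max_l; lia.
Qed.

End MaximalMultiplicity.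

(** * Monomials modulo the quadrics *)

Section Key.
Variables (k : fieldType) (N d : nat).
Hypothesis (d0 : (0 < d)%N).
Local Notation n := N.+1.
Local Notation mon := 'X_{1..n}.

Definition quo_deg (m : mon) : nat := (\sum_i m i %/ d)%N.
Definition quo_weight (m : mon) : nat := (\sum_(i < n) i * (m i %/ d))%N.

(* Two monomials have the same key iff they agree after replacing each
   [x_i ^ (q * d + r)], [r < d], by [s ^ ((N - i) * q) * t ^ (i * q) * x_i ^ r]. *)
Definition key (m : mon) : nat * nat * {ffun 'I_n -> nat} :=
  (quo_deg m, quo_weight m, [ffun i => (m i %% d)%N]).

Lemma keyP m m' : key m = key m' <->
  [/\ quo_deg m = quo_deg m', quo_weight m = quo_weight m' & forall i, (m i %% d = m' i %% d)%N].
Proof.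
split=> [[-> -> /ffunP E]|[E1 E2 E3]]; last first.
  by rewrite /key E1 E2; congr (_, _, _); apply/ffunP => i; rewrite !ffunE.
by split=> // i; have := E i; rewrite !ffunE.
Qed.

Lemma mon_eq_divmod (m m' : mon) :
  (forall i, (m i %/ d = m' i %/ d)%N) -> (forall i, (m i %% d = m' i %% d)%N) -> m = m'.
Proof. by move=> hq hr; apply/mnmP => i; rewrite (divn_eq (m i) d) hq hr -divn_eq. Qed.

(** The coefficient indexed by [kappa] in the image of [q] under the linear replacement of monomials
    that [key] encodes. *)
Definition key_sum kappa (q : {mpoly k[n]}) : k := \sum_(m <- msupp q | key m == kappa) q@_m.

Lemma key_sumwE K kappa q : (msize q <= K)%N ->
  key_sum kappa q = \sum_(m : 'X_{1..n < K} | key m == kappa) q@_m.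
Proof.
move=> le; pose I : subFinType (fun m : mon => (mdeg m < K)%N) := 'X_{1..n < K}.
rewrite /key_sum (big_mksub_cond I) //=; first last.
+ by move=> m /msize_mdeg_lt /leq_trans /(_ le) ->.
+ exact: msupp_uniq.
rewrite -big_filter_cond big_rmcond ?big_filter //=.
by move=> m /memN_msupp_eq0 ->.
Qed.

Lemma key_sumD kappa p q : key_sum kappa (p + q) = key_sum kappa p + key_sum kappa q.
Proof.
pose K := maxn (msize (p + q)) (maxn (msize p) (msize q)).
rewrite !(@key_sumwE K) ?leq_max ?leqnn ?orbT // -big_split.
by apply: eq_bigr => m _; rewrite mcoeffD.
Qed.

Lemma key_sum0 kappa : key_sum kappa 0 = 0.
Proof. by rewrite /key_sum msupp0 big_nil. Qed.

Lemma key_sum_sum kappa J (r : seq J) (P : pred J) (E : J -> {mpoly k[n]}) :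
  key_sum kappa (\sum_(j <- r | P j) E j) = \sum_(j <- r | P j) key_sum kappa (E j).
Proof. exact: (big_morph _ (key_sumD kappa) (key_sum0 kappa)). Qed.

Lemma key_sumZX kappa c m : key_sum kappa (c *: 'X_[m]) = if key m == kappa then c else 0.
Proof.
have [->|c0] := eqVneq c 0; first by rewrite scale0r key_sum0 if_same.
rewrite /key_sum (perm_big _ (msuppZ _ c0)) msuppX big_mkcond big_seq1.
by rewrite mcoeffZ mcoeffX eqxx mulr1.
Qed.

Lemma key_sum_single q m : (forall m', key m' = key m -> m' = m) -> key_sum (key m) q = q@_m.
Proof.
move=> h; rewrite /key_sum (eq_bigl (pred1 m)) => [|m']; last first.
  by apply/eqP/eqP => [/h //|->].
have [mq|mq] := boolP (m \in msupp q); first by rewrite -big_filter filter_pred1_uniq ?msupp_uniq // big_seq1.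
rewrite big_seq_cond big1 => [|m' /andP [m'q /eqP m'm]]; first by rewrite memN_msupp_eq0.
by rewrite m'm (negPf mq) in m'q.
Qed.

Definition interior_ord (i : 'I_n) := (i != ord0) && (i != ord_max).

(** Remainders modulo d are free, and at most one interior variable has exponent at least d, then
    below 2d. For N > 0 this leaves N * d^(N - 1) monomials, which will be the multiplicity of R /
    I. *)
Definition standard (m : mon) : bool := [&& m ord0 == 0%N, m ord_max == 0%N & (quo_deg m <= 1)%N].

Lemma quo_deg0P (m : mon) : reflect (forall i, (m i %/ d = 0)%N) (quo_deg m == 0%N).
Proof.
rewrite sum_nat_eq0; apply: (iffP forallP) => h i; first exact/eqP/(h i).
by rewrite h.
Qed.

Lemma standardP (m : mon) : standard m ->
  (quo_deg m = 0%N /\ forall i, m i %/ d = 0)%N \/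
  quo_deg m = 1%N /\ exists2 j, interior_ord j & forall i, (m i %/ d = (i == j))%N.
Proof.
case/and3P => /eqP m0 /eqP mN; rewrite leq_eqVlt ltnS leqn0 => /orP [/eqP m1|m1]; [right|left].
  split=> //; have [j mj] : exists j, (m j %/ d != 0)%N.
    apply/existsP; apply: contraT; rewrite negb_exists => /forallP h.
    suff : quo_deg m == 0%N by rewrite m1.
    by apply/quo_deg0P => i; apply/eqP; have := h i; rewrite negbK.
  have E : (m j %/ d = 1 /\ \sum_(i < n | i != j) m i %/ d = 0)%N.
    move: m1; rewrite /quo_deg (bigD1 j) //=; move: mj; move: (m j %/ d)%N (\sum_(i < n | i != j) _)%N.
    by move=> x y; rewrite -lt0n; lia.
  exists j => [|i].
    by apply/andP; split; apply: contra mj => /eqP ->; rewrite ?m0 ?mN div0n.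
  have [->|ij] := eqVneq i j; first by case: E.
  by case: E => _ /eqP; rewrite sum_nat_eq0 => /forallP /(_ i); rewrite ij => /eqP.
by split; [exact/eqP | exact/quo_deg0P].
Qed.

Definition edge_mul (u t : nat) (m : mon) : mon := (m + U_(ord0) *+ u + U_(ord_max) *+ t)%MM.

(** End variables change the weight by multiples of N, while a standard monomial has weight 0 or an
    interior index below N. So the weight modulo N recovers the quotients of [m], its quotient by N
    that of [t], and the degree then that of [u]; the remainders are part of the key. *)
Lemma standard_key_inj u t m u' t' m' : (0 < N)%N -> standard m -> standard m' ->
  key (edge_mul u t m) = key (edge_mul u' t' m') -> [/\ u = u', t = t' & m = m'].
Proof.
move=> N0 sm sm'; have ne : (ord_max : 'I_n) != ord0 by rewrite -val_eqE /= -lt0n.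
have E0 u1 t1 m1 : standard m1 -> edge_mul u1 t1 m1 ord0 = u1.
  case/and3P => /eqP h _ _; rewrite !mnmDE !mulmnE !mnm1E eqxx (negPf ne) h.
  by rewrite mul1n mul0n addn0.
have EN u1 t1 m1 : standard m1 -> edge_mul u1 t1 m1 ord_max = t1.
  case/and3P => _ /eqP h _; rewrite !mnmDE !mulmnE !mnm1E eqxx eq_sym (negPf ne) h.
  by rewrite mul1n mul0n.
have Ei u1 t1 m1 i : interior_ord i -> edge_mul u1 t1 m1 i = m1 i.
  case/andP => i0 iN; rewrite !mnmDE !mulmnE !mnm1E eq_sym (negPf i0) eq_sym (negPf iN).
  by rewrite !mul0n !addn0.
have sumE (G : 'I_n -> nat) : (\sum_i G i = G ord0 + G ord_max + \sum_(i | interior_ord i) G i)%N.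
  rewrite (bigD1 ord0) //= (bigD1 ord_max) //= addnA; congr (_ + _)%N.
have degE u1 t1 m1 : standard m1 -> quo_deg (edge_mul u1 t1 m1) = (u1 %/ d + t1 %/ d + quo_deg m1)%N.
  move=> s1; rewrite /quo_deg !sumE E0 // EN //; congr (_ + _)%N.
  case/and3P: s1 => /eqP -> /eqP -> _; rewrite div0n !add0n.
  by apply: eq_bigr => i /Ei ->.
have wE u1 t1 m1 : standard m1 -> quo_weight (edge_mul u1 t1 m1) = (N * (t1 %/ d) + quo_weight m1)%N.
  move=> s1; rewrite /quo_weight !sumE EN //= !mul0n !add0n; congr (_ + _)%N.
  case/and3P: s1 => /eqP _ /eqP -> _; rewrite div0n muln0 add0n.
  by apply: eq_bigr => i /Ei ->.
case/keyP; rewrite !degE // !wE // => hdeg hw hmod.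
have sw m1 : standard m1 -> (quo_deg m1 = 0 /\ quo_weight m1 = 0 /\ (forall i, m1 i %/ d = 0))%N \/
    quo_deg m1 = 1%N /\ (0 < quo_weight m1 < N)%N /\ (forall i, (m1 i %/ d = (quo_weight m1 == i)))%N.
  move=> /standardP [[z1 z2]|[z1 [j intj z2]]]; [left|right]; split=> //.
    by split=> //; rewrite /quo_weight big1 // => i _; rewrite z2 muln0.
  have -> : quo_weight m1 = j.
    rewrite /quo_weight (bigD1 j) //= z2 eqxx muln1 big1 ?addn0 // => i /negPf ij.
    by rewrite z2 ij muln0.
  split; last by move=> i; rewrite z2 eq_sym.
  case/andP: intj; rewrite -!val_eqE /= => j0 jN; have := ltn_ord j; lia.
have [tE w_eq] : (t %/ d = t' %/ d)%N /\ quo_weight m = quo_weight m'.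
  have wl m1 : standard m1 -> (quo_weight m1 < N)%N.
    by move=> /sw [[_ [-> _]]|[_ [/andP [_ ->] _]]].
  have := wl _ sm; have := wl _ sm' => l' l0.
  have := congr1 (fun x => x %/ N)%N hw; have := congr1 (fun x => x %% N)%N hw.
  rewrite ![(N * _)%N]mulnC !modnMDl !divnMDl // !modn_small //.
  by rewrite (divn_small l0) (divn_small l') !addn0.
have [deg_eq quoE] : quo_deg m = quo_deg m' /\ forall i, (m i %/ d = m' i %/ d)%N.
  case: (sw _ sm) => [[h1 [h2 h3]]|[h1 [h2 h3]]]; case: (sw _ sm') => [[h1' [h2' h3']]|[h1' [h2' h3']]].
  - by split=> [|i]; rewrite ?h1 ?h1' // h3 h3'.
  - by move: h2'; rewrite -w_eq h2.
  - by move: h2; rewrite w_eq h2'.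
  - by split=> [|i]; rewrite ?h1 ?h1' // h3 h3' w_eq.
have uE : (u %/ d = u' %/ d)%N by lia.
have uu : u = u'.
  by have := hmod ord0; rewrite !E0 // => hm; rewrite (divn_eq u d) uE hm -divn_eq.
have tt : t = t'.
  by have := hmod ord_max; rewrite !EN // => hm; rewrite (divn_eq t d) tE hm -divn_eq.
split=> //; apply: mon_eq_divmod => // i.
case: (boolP (interior_ord i)) => [ii|]; first by have := hmod i; rewrite !Ei.
case/and3P: sm => /eqP h0 /eqP hN _; case/and3P: sm' => /eqP h0' /eqP hN' _.
by rewrite negb_and !negbK => /orP [] /eqP ->; rewrite ?h0 ?h0' ?hN ?hN'.
Qed.

(** In the replacement behind [key] this monomial has exponent 0 in s or in t. That exponent is a
    sum of nonnegative contributions, so a monomial with the same key has d-th powers at one end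
    only. *)
Lemma edge_key_inj (m m' : mon) : (forall i, interior_ord i -> m i = 0%N) ->
  (m ord0 < d)%N || (m ord_max < d)%N -> key m' = key m -> m' = m.
Proof.
move=> mint hm /keyP [hdeg hw hmod]; apply: mon_eq_divmod => //.
have wdeg (m1 : mon) : (\sum_(i < n) (N - i) * (m1 i %/ d) + quo_weight m1 = N * quo_deg m1)%N.
  rewrite -big_split big_distrr; apply: eq_bigr => i _ /=.
  by rewrite -mulnDl subnK // -ltnS.
have ends i : ~~ interior_ord i -> i = ord0 \/ i = ord_max.
  by rewrite negb_and !negbK => /orP [] /eqP; [left|right].
case/orP: hm => hm.
- have z : (\sum_(i < n) (N - i) * (m i %/ d) = 0)%N.
    rewrite big1 // => i _; case: (boolP (interior_ord i)) => [/mint ->|/ends [->|->]].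
    + by rewrite div0n muln0.
    + by rewrite divn_small ?muln0.
    + by rewrite subnn.
  have z' : (\sum_(i < n) (N - i) * (m' i %/ d) = 0)%N.
    have := wdeg m; have := wdeg m'; rewrite hdeg hw z; lia.
  have q0 i : i != ord_max -> (m' i %/ d = 0)%N.
    move=> iN; move/eqP: z'; rewrite sum_nat_eq0 => /forallP /(_ i) /=.
    rewrite muln_eq0 => /orP [|/eqP //]; move: iN; rewrite -val_eqE /=.
    have := ltn_ord i; lia.
  have q0m i : i != ord_max -> (m i %/ d = 0)%N.
    move=> iN; case: (boolP (interior_ord i)) => [/mint ->|/ends [->|/eqP]]; rewrite ?div0n //.
      exact: divn_small.
    by rewrite (negPf iN).
  move: hdeg; rewrite /quo_deg (bigD1 ord_max) //= big1 // addn0.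
  rewrite (bigD1 ord_max) //= big1 // addn0 => hN i.
  by have [->//|iN] := eqVneq i ord_max; rewrite q0 // q0m.
- have z : quo_weight m = 0%N.
    rewrite /quo_weight big1 // => i _; case: (boolP (interior_ord i)) => [/mint ->|/ends [->|->]] //.
      by rewrite div0n muln0.
    by rewrite divn_small ?muln0.
  have q0 i : i != ord0 -> (m' i %/ d = 0)%N.
    move=> i0; move/eqP: hw; rewrite z sum_nat_eq0 => /forallP /(_ i) /=.
    by rewrite muln_eq0 => /orP [|/eqP //]; move: i0; rewrite -val_eqE /= => /negPf ->.
  have q0m i : i != ord0 -> (m i %/ d = 0)%N.
    move=> i0; case: (boolP (interior_ord i)) => [/mint ->|/ends [/eqP|->]]; rewrite ?div0n //.
      by rewrite (negPf i0).
    exact: divn_small.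
  move: hdeg; rewrite /quo_deg (bigD1 ord0) //= big1 // addn0.
  rewrite (bigD1 ord0) //= big1 // addn0 => h0 i.
  by have [->//|i0] := eqVneq i ord0; rewrite q0 // q0m.
Qed.

End Key.

(** * Standard monomials as a basis over k[a, b] *)

Section StandardMonomials.
Variables (k : fieldType) (N d : nat).
Hypotheses (d0 : (0 < d)%N) (N3 : (3 <= N)%N).
Local Notation n := N.+1.
Local Notation R := {mpoly k[n]}.
Local Notation A := {poly {poly k}}.
Local Notation mon := 'X_{1..n}.
Variables (l s : n.-tuple R) (ls : coordinates l s).
Local Notation a := (tnth l ord0).
Local Notation b := (tnth l ord_max).
Variables (I : {pred R}) (homI : homogeneous_ideal I).
Hypothesis (quadI : forall i j i' j' : 'I_n, (i + j = i' + j')%N ->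
  tnth l i ^+ d * tnth l j ^+ d - tnth l i' ^+ d * tnth l j' ^+ d \in I).
Hypothesis (keyI : forall p kappa, p \in I -> key_sum d kappa (p \mPo s) = 0).

Let idI : is_ideal I. Proof. exact/idealr_is_ideal/(proj1 homI). Qed.

Definition lmon (m : mon) : R := 'X_[m] \mPo l.

Lemma lmonD m m' : lmon (m + m')%MM = lmon m * lmon m'.
Proof. by rewrite /lmon mpolyXD rmorphM. Qed.

Lemma lmonU i e : lmon (U_(i) *+ e)%MM = tnth l i ^+ e.
Proof. by rewrite /lmon -mpolyXn rmorphXn /= comp_mpolyXU -tnth_nth. Qed.

Lemma lmon_edge u t m : lmon (edge_mul u t m) = a ^+ u * b ^+ t * lmon m.
Proof. by rewrite /edge_mul !lmonD !lmonU -mulrA mulrC. Qed.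

Lemma lmon_s m : lmon m \mPo s = 'X_[m].
Proof.
have sl : coordinates s l by case: ls.
exact: (comp_coordK sl).
Qed.

Lemma lmon_homog m : lmon m \is (mdeg m).-homog.
Proof. by rewrite -[X in X.-homog]mul1n; apply: comp_mpoly_homog; [case: ls | rewrite dhomogX]. Qed.

Definition interior_deg (m : mon) : nat := (\sum_(i | interior_ord i) m i %/ d)%N.

Lemma interior_degD m i : interior_deg (m + U_(i) *+ d)%MM = (interior_deg m + interior_ord i)%N.
Proof.
rewrite /interior_deg (eq_bigr (fun j => m j %/ d + (i == j))%N) => [|j _]; last first.
  by rewrite mnmDE mulmnE mnm1E addnC divnMDl // addnC.
rewrite big_split /=; congr (_ + _)%N; rewrite big_mkcond (bigD1 i) //= eqxx big1 => [|j].
  by rewrite addn0; case: (interior_ord i).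
by rewrite eq_sym => /negPf ->; rewrite if_same.
Qed.

Lemma interior_factor m : (0 < interior_deg m)%N ->
  exists2 i, interior_ord i & exists m', m = (m' + U_(i) *+ d)%MM.
Proof.
move=> m0; have [i /andP [ii mi]] : exists i, interior_ord i && (0 < m i %/ d)%N.
  apply/existsP; apply: contraTT m0; rewrite negb_exists => /forallP h.
  rewrite -leqNgt leqn0 sum_nat_eq0; apply/forallP => i; apply/implyP => ii.
  by have := h i; rewrite ii /= lt0n negbK.
exists i => //; exists (m - U_(i) *+ d)%MM; rewrite submK //.
apply/mnm_lepP => j; rewrite mulmnE mnm1E; case: eqP => [<-|_]; last by rewrite mul0n.
by rewrite mul1n; move: mi; rewrite divn_gt0.
Qed.

(* Two interior factors [l_i ^ d], [l_j ^ d] are traded for an end factor and one other. *)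
Lemma reduce_to_standard m : exists u t m',
  standard d m' /\ lmon m - lmon (edge_mul u t m') \in I.
Proof.
move: {2}(interior_deg m).+1 (ltnSn (interior_deg m)) => e.
elim: e m => // e IH m; rewrite ltnS => me.
have [m1|m1] := leqP (interior_deg m) 1.
  pose m' : mon := [multinom if interior_ord i then m i else 0%N | i < n].
  have ne : (ord_max : 'I_n) != ord0 by rewrite -val_eqE /=; lia.
  exists (m ord0), (m ord_max), m'; split.
    apply/and3P; split; rewrite ?mnmE /interior_ord ?eqxx ?andbF //.
    rewrite (leq_trans _ m1) // /quo_deg /interior_deg [leqRHS]big_mkcond.
    by apply: leq_sum => i _; rewrite mnmE; case: ifP; rewrite ?div0n.
  suff -> : edge_mul (m ord0) (m ord_max) m' = m by rewrite subrr; apply: ideal0.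
  apply/mnmP => i; rewrite !mnmDE !mulmnE !mnm1E mnmE /interior_ord.
  have [->|i0] := eqVneq i ord0; first by rewrite (negPf ne) mul1n mul0n addn0.
  have [->|iN] := eqVneq i ord_max; first by rewrite mul1n mul0n.
  by rewrite !mul0n !addn0.
have [i ii [m2 m2E]] := interior_factor (ltnW m1).
have c2 : interior_deg m = (interior_deg m2).+1 by rewrite m2E interior_degD ii addn1.
have [j jj [m3 m3E]] : exists2 j, interior_ord j & exists m', m2 = (m' + U_(j) *+ d)%MM.
  by apply: interior_factor; rewrite c2 in m1.
have c3 : interior_deg m2 = (interior_deg m3).+1 by rewrite m3E interior_degD jj addn1.
(* An exchange that creates an end factor lowers the number of interior factors, so the induction
   applies. *)
have step (i' j' : 'I_n) : ~~ interior_ord i' || ~~ interior_ord j' ->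
    (i + j = i' + j')%N -> exists u t m', standard d m' /\ lmon m - lmon (edge_mul u t m') \in I.
  move=> edge ij; pose m4 := (m3 + U_(i') *+ d + U_(j') *+ d)%MM.
  have [|u [t [m' [sm' m'I]]]] := IH m4.
    rewrite /m4 !interior_degD; move: me; rewrite c2 c3; move: edge.
    by case: (interior_ord i'); case: (interior_ord j') => //= _; lia.
  exists u, t, m'; split=> //; rewrite -(subrKA (lmon m4)); apply: idealD => //.
  rewrite m2E m3E /m4 !lmonD !lmonU -!mulrA -mulrBr [tnth l j ^+ d * _]mulrC.
  by apply: idealM => //; apply: quadI.
have in0 : (i : nat) != 0%N by case/andP: ii; rewrite -val_eqE.
(* The new pair is (0, i + j) or (i + j - N, N), whichever has its indices in range. *)
have [ij|ij] := leqP (i + j) N.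
  apply: (step ord0 (inord (i + j))); first by rewrite /interior_ord eqxx.
  by rewrite inordK.
apply: (step (inord (i + j - N)) ord_max); first by rewrite /interior_ord eqxx andbF orbT.
by rewrite inordK /=; have := ltn_ord i; have := ltn_ord j; lia.
Qed.

Lemma standard_bound (m : mon) : standard d m -> (mdeg m < (n * (2 * d)).+1)%N.
Proof.
move=> sm; rewrite ltnS mdegE -[X in (_ <= X * _)%N](card_ord n) -sum_nat_const.
apply: leq_sum => i _; have mi : (m i %/ d <= 1)%N.
  by case: (standardP d0 sm) => [[_ ->]|[_ [j _ ->]]] //; case: (_ == _).
have := ltn_pmod (m i) d0; rewrite {2}(divn_eq (m i) d); nia.
Qed.

Definition std_mon : finType := {x : 'X_{1..n < (n * (2 * d)).+1} | standard d (bmnm x)}.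

Definition std_basis (q : 'I_#|std_mon|) : R := lmon (val (enum_val q)).
Definition std_degree (q : 'I_#|std_mon|) : nat := mdeg (val (enum_val q)).

Lemma std_mon_gt0 : (0 < #|std_mon|)%N.
Proof.
have s0 : standard d (0%MM : mon).
  by rewrite /standard !mnmE !eqxx /quo_deg big1 // => i _; rewrite mnmE div0n.
by apply/card_gt0P; exists (Sub (BMultinom (standard_bound s0)) s0).
Qed.

Lemma std_span p : exists c : 'I_#|std_mon| -> A,
  p - \sum_q biv a b (c q) * std_basis q \in I.
Proof.
rewrite -(comp_coordK ls p); move: (p \mPo s) => {}p.
elim/mpolyind: p => [|x m p _ _ [c cI]].
  exists (fun=> 0); rewrite comp_mpoly0 big1 ?subrr; first exact: ideal0.
  by move=> q _; rewrite biv0 mul0r.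
have [u [t [m' [sm' m'I]]]] := reduce_to_standard m.
pose q0 := enum_rank (Sub (BMultinom (standard_bound sm')) sm' : std_mon).
have q0E : std_basis q0 = lmon m' by rewrite /std_basis enum_rankK.
exists (fun q => (if q == q0 then (x *: 'X^u)%:P * 'X^t else 0) + c q).
rewrite comp_mpolyD comp_mpolyZ -/(lmon m).
have -> : \sum_q biv a b ((if q == q0 then (x *: 'X^u)%:P * 'X^t else 0) + c q) * std_basis q =
    x *: lmon (edge_mul u t m') + \sum_q biv a b (c q) * std_basis q.
  under eq_bigr do rewrite bivD mulrDl.
  rewrite big_split (bigD1 q0) //= eqxx big1 ?addr0 => [|q /negPf ->].
    by rewrite biv_mon q0E lmon_edge -scalerAl.
  by rewrite biv0 mul0r.
by rewrite opprD addrACA -scalerBr; apply: idealD => //; apply: idealZ.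
Qed.

(** By [standard_key_inj] the products of end powers with standard monomials have distinct keys, so
    each key sum, zero on [I], isolates one coefficient. *)
Lemma std_indep (c : 'I_#|std_mon| -> A) :
  \sum_q biv a b (c q) * std_basis q \in I -> forall q, c q = 0.
Proof.
move=> cI; have /choice [B BP] := fun q => poly_size_bound (c q) 0.
have sE : (\sum_q biv a b (c q) * std_basis q) \mPo s =
    \sum_q \sum_(t < B q) \sum_(u < B q)
      (c q)`_t`_u *: 'X_[edge_mul u t (val (enum_val q) : 'X_{1..n < _})].
  rewrite comp_mpoly_sum; apply: eq_bigr => q _; have [_ szc szct] := BP q.
  rewrite (bivE _ _ szc szct) mulr_suml comp_mpoly_sum; apply: eq_bigr => t _.
  rewrite mulr_suml comp_mpoly_sum; apply: eq_bigr => u _.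
  by rewrite -scalerAl comp_mpolyZ -lmon_edge lmon_s.
have inj (q q' : 'I_#|std_mon|) u t u' t' :
    key d (edge_mul u t (val (enum_val q) : 'X_{1..n < _})) =
    key d (edge_mul u' t' (val (enum_val q') : 'X_{1..n < _})) -> [/\ u = u', t = t' & q = q'].
  have N0 : (0 < N)%N by lia.
  case/(standard_key_inj d0 N0 (valP (enum_val q)) (valP (enum_val q'))) => -> -> E.
  by split=> //; apply/enum_val_inj/val_inj/val_inj.
move=> q0; have [_ szc szct] := BP q0.
apply/polyP => t0; rewrite coef0; apply/polyP => u0; rewrite coef0.
have [tB|tB] := leqP (B q0) t0; first by rewrite [(c q0)`_t0]nth_default ?coef0 // (leq_trans szc).
have [uB|uB] := leqP (B q0) u0; first by rewrite nth_default // (leq_trans (szct t0)).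
have := keyI (key d (edge_mul u0 t0 (val (enum_val q0) : 'X_{1..n < _}))) cI.
rewrite sE key_sum_sum (bigD1 q0) //= [X in _ + X]big1 ?addr0 => [|q /eqP qq0]; last first.
  rewrite key_sum_sum big1 // => t _; rewrite key_sum_sum big1 // => u _.
  by rewrite key_sumZX; case: eqP => // /inj [_ _ /qq0].
rewrite key_sum_sum (bigD1 (Ordinal tB)) //= [X in _ + X]big1 ?addr0 => [|t /eqP tt0]; last first.
  rewrite key_sum_sum big1 // => u _.
  by rewrite key_sumZX; case: eqP => // /inj [_ tt _]; case: tt0; apply/val_inj.
rewrite key_sum_sum (bigD1 (Ordinal uB)) //= [X in _ + X]big1 ?addr0 => [|u /eqP uu0]; last first.
  by rewrite key_sumZX; case: eqP => // /inj [uu _ _]; case: uu0; apply/val_inj.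
by rewrite key_sumZX eqxx.
Qed.

Lemma std_free : free_over a b I std_basis std_degree.
Proof. by split; [move=> q; apply: lmon_homog | exact: std_span | exact: std_indep]. Qed.

Definition corner : R := a ^+ d * b ^+ d - tnth l (inord 1) ^+ d * tnth l (inord N.-1) ^+ d.

Local Notation proj := (edge_proj l s ord0 ord_max).

Lemma edge_proj_corner : proj corner = a ^+ d * b ^+ d.
Proof.
have X p e : proj (p ^+ e) = proj p ^+ e.
  by rewrite /edge_proj !rmorphXn.
rewrite /corner edge_projB !edge_projM !X !(edge_projl ls) !eqxx orbT.
have -> : (inord 1 == ord0 :> 'I_n) || (inord 1 == ord_max :> 'I_n) = false.
  by rewrite -!val_eqE /= inordK; lia.
by rewrite expr0n eqn0Ngt d0 mul0r subr0.
Qed.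

(** Only monomials in the end coordinates survive the projection. One with an end exponent below d
    is alone with its key by [edge_key_inj], so its coefficient is a key sum and vanishes on [I];
    the others are divisible by a^d b^d. *)
Lemma edge_proj_multiple p : p \in I -> exists c, proj p = biv a b c * proj corner.
Proof.
move=> pI; rewrite edge_proj_corner /edge_proj comp_mpolyEX.
apply: (big_ind (fun x : R => exists c, x = biv a b c * (a ^+ d * b ^+ d))).
- by exists 0; rewrite biv0 mul0r.
- by move=> x y [c ->] [c' ->]; exists (c + c'); rewrite bivD mulrDl.
move=> m _; rewrite comp_mpolyX.
have [/forallP mint|] := boolP [forall i, interior_ord i ==> (m i == 0%N)]; last first.
  rewrite negb_forall => /existsP [i]; rewrite negb_imply => /andP [/andP [i0 iN] mi].
  exists 0; rewrite (bigD1 i) //= tnth_mktuple (negPf i0) (negPf iN) expr0n (negPf mi).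
  by rewrite mul0r scaler0 biv0 mul0r.
have {}mint i : interior_ord i -> m i = 0%N by move=> ii; have := mint i; rewrite ii => /eqP.
have [md|] := boolP ((m ord0 < d)%N || (m ord_max < d)%N).
  exists 0; rewrite -(key_sum_single _ (fun m' => @edge_key_inj N d d0 m m' mint md)) keyI //.
  by rewrite scale0r biv0 mul0r.
rewrite negb_or -!leqNgt => /andP [m0 mN].
exists (((p \mPo s)@_m *: 'X^(m ord0 - d))%:P * 'X^(m ord_max - d)).
rewrite biv_mon -scalerAl mulrACA -!exprD !subnK //; congr (_ *: _).
have ne : (ord_max : 'I_n) != ord0 by rewrite -val_eqE /=; lia.
rewrite (bigD1 ord0) //= (bigD1 ord_max) //= big1 ?mulr1 => [|i ii].
  by rewrite !tnth_mktuple !eqxx orbT.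
by rewrite mint ?expr0.
Qed.

Lemma maximal_multiplicity_of_key : maximal_multiplicity I.
Proof.
have [m [v [dv freeI]]] : exists m (v : 'I_m.+1 -> R) dv, free_over a b I v dv.
  move: std_mon_gt0 std_basis std_degree std_free; case: #|std_mon| => // m _ v dv h.
  by exists m, v, dv.
have ne : (ord0 : 'I_n) != ord_max by rewrite -val_eqE /=; lia.
have hl e i : tnth l i ^+ e \is e.-homog.
  by rewrite -[X in X.-homog]mul1n; apply: dhomogMn; case: ls.
apply: (@maximal_multiplicity_of_free _ _ _ _ ls _ _ ne _ _ _ _ homI freeI corner (d + d)).
- by apply: quadI; rewrite /= !inordK; lia.
- by rewrite rpredB //; apply: dhomogM.
- have l0 i : tnth l i != 0.
    apply/eqP => l0; case: ls => _ _ _ /(_ i); rewrite l0 comp_mpoly0.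
    move/(congr1 (mcoeff U_(i)%MM)); rewrite mcoeff0 mcoeffX eqxx.
    by move/esym/eqP; rewrite oner_eq0.
  by rewrite edge_proj_corner mulf_neq0 // expf_neq0.
- exact: edge_proj_multiple.
Qed.

End StandardMonomials.

(** * Hankel matrices of powers *)

Lemma det_mx22 (B : comNzRingType) (X : 'M[B]_2) : \det X = X 0 0 * X 1 1 - X 0 1 * X 1 0.
Proof.
rewrite (expand_det_row _ 0) !big_ord_recl big_ord0 addr0 /cofactor !det_mx11 !mxE /=.
rewrite expr0 mul1r expr1 mulN1r mulrN.
by congr (X _ _ * X _ _ - X _ _ * X _ _); apply/val_inj.
Qed.

Section Binomials.
Variables (k : fieldType) (N d : nat).
Hypothesis (d0 : (0 < d)%N).
Local Notation n := N.+1.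
Local Notation R := {mpoly k[n]}.

(** Multiplying by x_i^d adds 1 to [quo_deg], i to [quo_weight] and nothing to the remainders, so a
    monomial times either term of the quadric has the same key. *)
Lemma key_sum_mul_quadric kappa (c : R) (i j i' j' : 'I_n) : (i + j = i' + j')%N ->
  key_sum d kappa (c * ('X_i ^+ d * 'X_j ^+ d - 'X_i' ^+ d * 'X_j' ^+ d)) = 0.
Proof.
move=> ij; have modd (m : 'X_{1..n}) u v : ((m + U_(u) *+ d)%MM v %% d = m v %% d)%N.
  by rewrite mnmDE mulmnE addnC modnMDl.
have divd (m : 'X_{1..n}) u v : ((m + U_(u) *+ d)%MM v %/ d = (u == v) + m v %/ d)%N.
  by rewrite mnmDE mulmnE mnm1E addnC divnMDl.
have deg (m : 'X_{1..n}) u : quo_deg d (m + U_(u) *+ d)%MM = (quo_deg d m).+1.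
  rewrite /quo_deg (eq_bigr _ (fun v _ => divd m u v)) big_split /= (bigD1 u) //= eqxx.
  by rewrite big1 ?addn0 // => v; rewrite eq_sym => /negPf ->.
have wt (m : 'X_{1..n}) u : quo_weight d (m + U_(u) *+ d)%MM = (u + quo_weight d m)%N.
  rewrite /quo_weight (eq_bigr (fun v : 'I_n => v * (u == v) + v * (m v %/ d))%N); last first.
    by move=> v _; rewrite divd mulnDr.
  rewrite big_split /= (bigD1 u) //= eqxx muln1.
  by rewrite big1 ?addn0 // => v; rewrite eq_sym => /negPf ->; rewrite muln0.
rewrite [c]mpolyE mulr_suml key_sum_sum big1 // => m _.
rewrite !mpolyXn -!mpolyXD mulrBr -!scalerAl -!mpolyXD !addmA -scaleN1r scalerA.
have keyE : key d (m + U_(i) *+ d + U_(j) *+ d)%MM = key d (m + U_(i') *+ d + U_(j') *+ d)%MM.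
  apply/(keyP d); split; rewrite ?deg ?wt //; last by move=> v; rewrite !modd.
  by rewrite !addnA [(j + i)%N]addnC ij [(j' + i')%N]addnC.
rewrite key_sumD !key_sumZX keyE.
by case: ifP => _; rewrite ?addr0 // mulN1r subrr.
Qed.

End Binomials.

Lemma pihomog_mul (k : fieldType) n e f (c g : {mpoly k[n]}) : g \is f.-homog ->
  exists c', pihomog mdeg e (c * g) = c' * g.
Proof.
move=> hg; rewrite [c](pihomog_partitionE (leqnn (msize c))) mulr_suml pihomog_sum.
exists (\sum_(i < msize c) if (i + f == e)%N then pihomog mdeg i c else 0).
rewrite mulr_suml; apply: eq_bigr => i _.
have h : pihomog mdeg i c * g \is (i + f).-homog by apply: dhomogM => //; apply: pihomogP.
case: eqP => [<-|/eqP ne]; first exact: pihomog_dE.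
by rewrite (pihomog_ne0 ne h) mul0r.
Qed.

Lemma ideal_gen_homogeneous (k : fieldType) n (gs : seq {mpoly k[n]}) f :
  {in gs, forall g, g \is f.-homog} -> 1 \notin ideal_gen gs -> homogeneous_ideal (ideal_gen gs).
Proof.
move=> hgs g1; have idg : is_ideal (ideal_gen gs) by apply/ideal_adjoin_is_ideal/zero_is_ideal.
split; first by case: idg.
move=> p d /asboolP [c]; rewrite inE subr_eq0 big_nat => /eqP ->.
rewrite pihomog_sum; apply: ideal_sum => // i /andP [_ ilt].
have [c' ->] := pihomog_mul d (c i) (hgs _ (mem_nth 0 ilt)).
by apply: idealM => //; apply: ideal_adjoin_mem; [exact: zero_is_ideal | exact: mem_nth].
Qed.

Section Hankel.
Variables (k : fieldType) (d N r : nat).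
Hypotheses (d0 : (0 < d)%N) (N3 : (3 <= N)%N) (r2 : (2 <= r <= N)%N).
Local Notation n := N.+1.
Local Notation R := {mpoly k[n]}.
Local Notation I := (minors_ideal 2 (hankel_power k d N r)).

Let Y (i : nat) : R := 'X_(inord i) ^+ d.

Let idI : is_ideal I. Proof. exact/ideal_adjoin_is_ideal/zero_is_ideal. Qed.

Lemma hankel_minor (f : 'I_2 -> 'I_r) (g : 'I_2 -> 'I_(N - r + 2)) :
  \det (mxsub f g (hankel_power k d N r)) =
  Y (f 0 + g 0) * Y (f 1 + g 1) - Y (f 0 + g 1) * Y (f 1 + g 0).
Proof. by rewrite det_mx22 !mxE. Qed.

Lemma minor_mem a a' b b' : (a < r)%N -> (a' < r)%N -> (b < N - r + 2)%N -> (b' < N - r + 2)%N ->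
  Y (a + b) * Y (a' + b') - Y (a + b') * Y (a' + b) \in I.
Proof.
move=> ar ar' br br'.
pose f := [ffun x : 'I_2 => if x == 0 then Ordinal ar else Ordinal ar'].
pose g := [ffun x : 'I_2 => if x == 0 then Ordinal br else Ordinal br'].
apply: ideal_adjoin_mem; first exact: zero_is_ideal.
apply/imageP; exists (f, g) => //.
by rewrite [RHS]hankel_minor !ffunE.
Qed.

(* A pair of indices at distance at least 2 is replaced, by a minor of the given shape,
   by a strictly closer pair with the same sum. *)
Lemma hankel_middle i j : (i <= j <= N)%N ->
  Y i * Y j - Y ((i + j)./2) * Y (i + j - (i + j)./2) \in I.
Proof.
move: {2}(j - i)%N.+1 (ltnSn (j - i)) => e; elim: e i j => // e IH i j; rewrite ltnS => je ij.
have [D1|D2] := leqP (j - i) 1.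
  have -> : ((i + j)./2 = i)%N by lia.
  have -> : (i + j - i = j)%N by lia.
  by rewrite subrr; apply: ideal0.
(* Row distance [dl] and column distance [ep] of the minor add up to j - i; [dl] is the least
   positive value for which [ep] is at most N - r + 1, the largest column distance. The first row
   [a] is the largest one up to [i] leaving room for [dl]. *)
pose dl := maxn 1 (j - i - (N - r + 1)); pose ep := (j - i - dl)%N.
pose a := minn i (r - 1 - dl); pose b := (i - a)%N.
have step : Y i * Y j - Y (i + ep) * Y (i + dl) \in I.
  have := @minor_mem a (a + dl) b (b + ep).
  have -> : (a + b = i)%N by rewrite /a /b; lia.
  have -> : (a + dl + (b + ep) = j)%N by rewrite /a /b /ep /dl; lia.
  have -> : (a + (b + ep) = i + ep)%N by rewrite /a /b; lia.
  have -> : (a + dl + b = i + dl)%N by rewrite /a /b; lia.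
  by apply; rewrite /b /a /ep /dl; lia.
rewrite -(subrKA (Y (i + ep) * Y (i + dl))).
apply: (idealD idI step).
(* The two new indices may come in either order, while the induction hypothesis wants the smaller
   one first. *)
have [le|lt] := leqP ep dl.
  have := IH (i + ep)%N (i + dl)%N; have -> : (i + ep + (i + dl) = i + j)%N by rewrite /ep /dl; lia.
  by apply; rewrite /ep /dl; lia.
rewrite mulrC; have := IH (i + dl)%N (i + ep)%N.
have -> : (i + dl + (i + ep) = i + j)%N by rewrite /ep /dl; lia.
by apply; rewrite /ep /dl; lia.
Qed.

Let l : n.-tuple R := [tuple 'X_i | i < n].

Lemma var_coordinates : coordinates l l.
Proof.
have hX (i : 'I_n) : tnth l i \is 1.-homog by rewrite tnth_mktuple dhomogX /= mdeg1.
by split=> // i; rewrite comp_mpoly_id tnth_mktuple.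
Qed.

(** Pairs with equal sums reduce to the same middle pair, so the ideal contains all these quadrics
    whatever the shape [r] of the matrix. *)
Lemma hankel_quadric (i j i' j' : 'I_n) : (i + j = i' + j')%N ->
  tnth l i ^+ d * tnth l j ^+ d - tnth l i' ^+ d * tnth l j' ^+ d \in I.
Proof.
rewrite !tnth_mktuple => ij.
have YE (u : 'I_n) : 'X_u ^+ d = Y u by rewrite /Y inord_val.
have mid (u v : 'I_n) : Y u * Y v - Y ((u + v)./2) * Y (u + v - (u + v)./2) \in I.
  have := ltn_ord u; have := ltn_ord v => vN uN.
  case: (leqP u v) => uv; first by apply: hankel_middle; lia.
  by rewrite mulrC [(u + v)%N]addnC; apply: hankel_middle; lia.
rewrite !YE -(subrKA (Y ((i + j)./2) * Y (i + j - (i + j)./2))).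
apply: (idealD idI (mid i j)); rewrite ij -opprB.
exact: (idealN idI (mid i' j')).
Qed.

Lemma hankel_key_sum p kappa : p \in I -> key_sum d kappa p = 0.
Proof.
case/asboolP => c; rewrite inE subr_eq0 big_nat => /eqP ->.
rewrite key_sum_sum big1 // => i /andP [_ /(mem_nth 0) /imageP [[f g] _ ->]].
rewrite hankel_minor /Y /=; apply: key_sum_mul_quadric => //.
have fl x := ltn_ord (f x); have gl x := ltn_ord (g x).
have f0 := fl 0; have f1 := fl 1; have g0 := gl 0; have g1 := gl 1.
have [r1 rN] := andP r2.
have le u v : (u < r)%N -> (v < N - r + 2)%N -> (u + v < n)%N by lia.
rewrite !inordK ?le // [LHS]addnACA [RHS]addnACA; congr (_ + _)%N; exact: addnC.
Qed.

Lemma hankel_maximal_multiplicity : maximal_multiplicity I.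
Proof.
apply: (maximal_multiplicity_of_key d0 N3 var_coordinates _ hankel_quadric) => [|p kappa pI].
  apply: (@ideal_gen_homogeneous _ _ _ (d + d)) => [g /imageP [[f h] _ ->]|].
    have hY u : Y u \is d.-homog.
      by rewrite -[X in X.-homog]mul1n; apply: dhomogMn; rewrite dhomogX /= mdeg1.
    by rewrite hankel_minor rpredB //; apply: dhomogM.
  apply/negP => /(hankel_key_sum (key d 0%MM)) /eqP.
  have <- : 1 *: 'X_[0%MM] = 1 :> R by rewrite scale1r mpolyX0.
  by rewrite key_sumZX eqxx oner_eq0.
by rewrite comp_mpoly_id; apply: hankel_key_sum.
Qed.

End Hankel.

(** * Rational normal curves *)

Lemma mpolyX_inj (S : nzRingType) n : injective (fun m : 'X_{1..n} => 'X_[S, m]).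
Proof.
move=> m m' /(congr1 (mcoeff m)); rewrite !mcoeffX eqxx; case: eqP => // _ /eqP.
by rewrite oner_eq0.
Qed.

Section RationalNormalCurve.
Variables (k : fieldType) (N : nat).
Hypothesis (N3 : (3 <= N)%N).
Local Notation n := N.+1.
Local Notation R := {mpoly k[n]}.

Definition binary_mon (j : nat) : 'X_{1..2} := (U_(ord0) *+ (N - j) + U_(ord_max) *+ j)%MM.

Definition veronese : n.-tuple {mpoly k[2]} := [tuple 'X_[binary_mon j] | j < n].

Lemma binary_mon0 j : binary_mon j ord0 = (N - j)%N.
Proof. by rewrite mnmDE !mulmnE !mnm1E /= mul1n mul0n addn0. Qed.

Lemma binary_mon1 j : binary_mon j ord_max = j.
Proof. by rewrite mnmDE !mulmnE !mnm1E /= mul0n mul1n. Qed.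

Lemma binary_monP (e : 'X_{1..2}) : mdeg e = N -> e = binary_mon (e ord_max).
Proof.
rewrite mdegE !big_ord_recl big_ord0 addn0 => eN; apply/mnmP => i.
have lm : lift ord0 ord0 = ord_max :> 'I_2 by apply/val_inj.
rewrite lm in eN; case: (unliftP ord0 i) => [j|] ->.
  by rewrite [j]ord1 lm binary_mon1.
by rewrite binary_mon0 -eN addnK.
Qed.

Lemma binary_form_sum (p : {mpoly k[2]}) : p \is N.-homog ->
  p = \sum_(j < n) p@_(binary_mon j) *: 'X_[binary_mon j].
Proof.
move=> hp; apply/mpolyP => e; rewrite raddf_sum /=.
have [eN|eN] := eqVneq (mdeg e) N; last first.
  rewrite (dhomog_nemf_coeff hp eN) big1 // => j _; rewrite mcoeffZ mcoeffX.
  case: eqP => [je|]; last by rewrite mulr0.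
  case/eqP: eN; rewrite -je mdegE !big_ord_recl big_ord0 addn0.
  have -> : lift ord0 ord0 = ord_max :> 'I_2 by apply/val_inj.
  by rewrite binary_mon0 binary_mon1 subnK // -ltnS.
have e1 : (e ord_max < n)%N by rewrite ltnS -eN mdegE (bigD1 ord_max) //= leq_addr.
rewrite (bigD1 (Ordinal e1)) //= big1 => [|j /negP ne].
  by rewrite -binary_monP // mcoeffZ mcoeffX eqxx mulr1 addr0.
rewrite mcoeffZ mcoeffX; case: eqP => [je|]; last by rewrite mulr0.
by case: ne; apply/eqP/val_inj; rewrite /= -je binary_mon1.
Qed.

Lemma veronese_mon (m : 'X_{1..n}) : 'X_[m] \mPo veronese =
  'X_[U_(ord0) *+ (\sum_(i < n) m i * (N - i)) + U_(ord_max) *+ quo_weight 1 m].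
Proof.
have h (i : 'I_n) : tnth veronese i ^+ m i =
    'X_[U_(ord0)] ^+ (m i * (N - i)) * 'X_[U_(ord_max)] ^+ (i * (m i %/ 1)).
  rewrite tnth_mktuple /binary_mon mpolyXD -!mpolyXn exprMn -!exprM divn1.
  by rewrite [((N - i) * _)%N]mulnC.
rewrite comp_mpolyX (eq_bigr _ (fun i _ => h i)) big_split /= !prodrXr.
by rewrite mpolyXD -!mpolyXn.
Qed.

(** For d = 1 all remainders are 0, and the two exponents of the image add up to N * [quo_deg], so
    image and key determine each other. *)
Lemma veronese_key (m m' : 'X_{1..n}) :
  ('X_[m] \mPo veronese == 'X_[m'] \mPo veronese) = (key 1 m == key 1 m').
Proof.
have deg (u : 'X_{1..n}) : (\sum_(i < n) u i * (N - i) + quo_weight 1 u = N * quo_deg 1 u)%N.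
  rewrite -big_split big_distrr; apply: eq_bigr => i _ /=.
  by rewrite divn1 [(i * _)%N]mulnC -mulnDr subnK 1?mulnC // -ltnS.
rewrite !veronese_mon; apply/eqP/eqP => [E|/(keyP 1) [E1 E2 _]].
  have /mnmP H := mpolyX_inj E.
  have := H ord0; have := H ord_max; rewrite !mnmDE !mulmnE !mnm1E /= !mul0n !mul1n !addn0 !add0n.
  move=> E1 E0; apply/(keyP 1); split=> // [|i]; last by rewrite !modn1.
  by have := deg m; have := deg m'; rewrite E0 E1 => -> /eqP; rewrite eqn_pmul2l; [move/eqP|lia].
congr ('X_[U_(_) *+ _ + U_(_) *+ _]) => //.
by have := deg m; have := deg m'; rewrite E1 E2 => <- /addIn.
Qed.

(** By [veronese_key] a key sum for d = 1 is either empty or a coefficient of the image. *)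
Lemma veronese_key_sum kappa (q : R) : q \mPo veronese = 0 -> key_sum 1 kappa q = 0.
Proof.
move=> q0; have [/hasP [m0 m0q /eqP <-]|/hasPn none] := boolP (has (fun m => key 1 m == kappa) (msupp q)).
  move: q0; rewrite comp_mpolyEX.
  pose e : 'X_{1..2} := (U_(ord0) *+ (\sum_(i < n) m0 i * (N - i)) + U_(ord_max) *+ quo_weight 1 m0)%MM.
  move/(congr1 (mcoeff e)); rewrite mcoeff0 raddf_sum /= => E.
  rewrite -[RHS]E /key_sum big_mkcond; apply: eq_bigr => m _.
  rewrite mcoeffZ -veronese_key [X in _ == X]veronese_mon -/e veronese_mon mcoeffX.
  by rewrite (inj_eq (@mpolyX_inj _ _)); case: eqP; rewrite ?mulr1 ?mulr0.
by rewrite /key_sum big_seq_cond big1 // => m /andP [/none /negPf ->].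
Qed.

Variables (f : n.-tuple {mpoly k[2]}) (paramf : rational_normal_param f).

Let hf i : tnth f i \is N.-homog. Proof. by case: paramf. Qed.

Definition param_mx : 'M[k]_n := \matrix_(i, j) (tnth f i)@_(binary_mon j).

Lemma param_mx_unit : param_mx \in unitmx.
Proof.
rewrite -row_free_unit; apply/inj_row_free => u u0; apply/rowP => i; rewrite mxE.
case: paramf => _ /(_ (u 0)) /(_ _ i); apply.
rewrite (eq_bigr (fun i => \sum_(j < n) (u 0 i * param_mx i j) *: 'X_[binary_mon j])).
  rewrite exchange_big big1 // => j _; rewrite -scaler_suml.
  by have := congr1 (fun w : 'rV_n => w 0 j) u0; rewrite !mxE => ->; rewrite scale0r.
move=> i' _; rewrite [LHS](congr1 _ (binary_form_sum (hf i'))) scaler_sumr.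
by apply: eq_bigr => j _; rewrite [param_mx _ _]mxE scalerA.
Qed.

Definition linear_forms (M : 'M[k]_n) : n.-tuple R := [tuple \sum_j M i j *: 'X_j | i < n].

Lemma linear_forms_comp (M M' : 'M[k]_n) i : M *m M' = 1%:M ->
  tnth (linear_forms M) i \mPo linear_forms M' = 'X_i.
Proof.
move=> MM'; rewrite tnth_mktuple comp_mpoly_sum.
under eq_bigr do rewrite comp_mpolyZ comp_mpolyXU -tnth_nth tnth_mktuple scaler_sumr.
rewrite exchange_big /=.
have E j : \sum_u M i u *: (M' u j *: 'X_j) = (i == j)%:R *: 'X_j :> R.
  rewrite (eq_bigr (fun u => (M i u * M' u j) *: 'X_j)) => [|u _]; last by rewrite scalerA.
  by rewrite -scaler_suml; have /matrixP/(_ i j) := MM'; rewrite !mxE => ->.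
rewrite (eq_bigr _ (fun j _ => E j)) (bigD1 i) //= eqxx scale1r big1 ?addr0 // => j.
by rewrite eq_sym => /negPf ->; rewrite scale0r.
Qed.

Local Notation l := (linear_forms (invmx param_mx)).
Local Notation s := (linear_forms param_mx).

Lemma curve_coordinates : coordinates l s.
Proof.
have hom M i : tnth (linear_forms M) i \is 1.-homog.
  rewrite tnth_mktuple; apply: rpred_sum => j _; apply: rpredZ.
  by rewrite dhomogX /= mdeg1.
split=> // i; apply: linear_forms_comp; [exact: mulmxV param_mx_unit | exact: mulVmx param_mx_unit].
Qed.

(** The forms [f] are the image of the monomials [veronese] under [param_mx], so the curve becomes
    the monomial one in the coordinates [l]. *)
Lemma comp_param p : p \mPo f = (p \mPo s) \mPo veronese.
Proof.
elim/mpoly_alg_ind: p => [c|i|p q IHp IHq|p q IHp IHq].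
- by rewrite !comp_mpolyC.
- rewrite !comp_mpolyXU -!tnth_nth tnth_mktuple comp_mpoly_sum [LHS](binary_form_sum (hf i)).
  apply: eq_bigr => j _; rewrite comp_mpolyZ comp_mpolyXU -tnth_nth tnth_mktuple.
  by rewrite mxE.
- by rewrite !comp_mpolyD IHp IHq.
- by rewrite !rmorphM /= IHp IHq.
Qed.

Lemma curve_ideal_homogeneous : homogeneous_ideal (curve_ideal f).
Proof.
split; first split.
- by rewrite inE comp_mpoly0.
- by rewrite inE comp_mpoly1 oner_eq0.
- move=> x p q; rewrite !inE => /eqP p0 /eqP q0.
  by rewrite comp_mpolyD rmorphM /= p0 q0 mulr0 addr0.
- move=> p d; rewrite !inE => /eqP p0.
  by rewrite -(@pihomog_comp_mpoly _ _ _ _ N) ?p0 ?pihomog0 //; lia.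
Qed.

Lemma curve_maximal_multiplicity : maximal_multiplicity (curve_ideal f).
Proof.
apply: (maximal_multiplicity_of_key (ltn0Sn 0) N3 curve_coordinates curve_ideal_homogeneous).
- move=> i j i' j' ij; rewrite inE comp_param; apply/eqP.
  have [_ _ _ ls] := curve_coordinates.
  rewrite !expr1 !comp_mpolyB !rmorphM /= !ls !comp_mpolyXU -!tnth_nth !tnth_mktuple.
  rewrite -!mpolyXD; apply/eqP; rewrite subr_eq0; apply/eqP; congr 'X_[_]; apply/mnmP => u.
  (* The exponents depend on i + j only; the bounds on the indices make the truncated subtractions N
     - i exact. *)
  have := ltn_ord i; have := ltn_ord j; have := ltn_ord i'; have := ltn_ord j'.
  case: (unliftP ord_max u) => [v|] ->; last first.
    by rewrite ![(binary_mon _ + binary_mon _)%MM _]mnmDE !binary_mon1.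
  have -> : lift ord_max v = ord0 by apply/val_inj; rewrite [v]ord1.
  by rewrite ![(binary_mon _ + binary_mon _)%MM _]mnmDE !binary_mon0; lia.
- move=> p kappa; rewrite inE comp_param => /eqP; exact: veronese_key_sum.
Qed.

End RationalNormalCurve.

Local Close Scope ring_scope.

Theorem corollary2p16 (k : fieldType) :
  (forall d N r : nat, 1 <= d -> 3 <= N -> 2 <= r <= N ->
     maximal_multiplicity (minors_ideal 2 (hankel_power k d N r))) /\
  (forall (N : nat) (f : N.+1.-tuple {mpoly k[2]}), 3 <= N ->
     rational_normal_param f -> maximal_multiplicity (curve_ideal f)).
Proof.
split=> [d N r d0 N3 r2|N f N3 paramf]; first exact: hankel_maximal_multiplicity.
exact: curve_maximal_multiplicity.
Qed.
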